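(* Define the intensity matrix $$\hat q(\cdot,\cdot)=\sum_{y\in\mathcal Y}q(\cdot,\cdot|y)\pi(y)$$ on $I$, and let $(\hat X_t)_{t\in[0,\infty)}$ be the corresponding continuous-time Markov process with starting state $x_0$. Then $$(X_t^\epsilon)_{t\in[0,\infty)}\to(\hat X_t)_{t\in[0,\infty)}\quad\text{in distribution as }\epsilon\to0.$$
   Context: $\mathcal Y\subseteq\mathbb R$ is a finite set. A modulating process is a càdlàg process $Y=(Y_t)_{t\in[0,\infty)}$ with values in $\mathcal Y$ (not assumed Markovian) and discrete jump times $\gamma_0=0<\gamma_1<\gamma_2<\dots$, i.e. these times are strictly increasing and $Y$ is constant on $[\gamma_i,\gamma_{i+1})$ for all $i$ (with $\gamma_i=\infty$ after the last jump if there are only finitely many). Let $I\subseteq\mathbb R$ be countable, $x_0\in I$, and for each $y\in\mathcal Y$ let $q(\cdot,\cdot|y)$ be an intensity matrix on $I$. The switching process $X=X^Y$ is constructed conditionally on $Y$: at time $0$ start a continuous-time Markov chain $\tilde X^0$ with starting state $x_0$ and intensity matrix $q(\cdot,\cdot|Y_0)$; at $\gamma_1$ start a new chain $\tilde X^1$ with starting point $\tilde X^0_{\gamma_1}$ and intensity matrix $q(\cdot,\cdot|Y_{\gamma_1})$; inductively, at $\gamma_{i+1}$ start a new chain $\tilde X^{i+1}$ with starting point $\tilde X^i_{\gamma_{i+1}-\gamma_i}$ and intensity matrix $q(\cdot,\cdot|Y_{\gamma_{i+1}})$. Set $X_t=\tilde X^i_{t-\gamma_i}$ for $\gamma_i\leq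 t<\gamma_{i+1}$. Standing assumptions: for some finite set $J\subseteq\mathbb R\setminus\{0\}$, $q(i,i+j|y)=0$ for all $i\in I$, $y\in\mathcal Y$, $j\notin J$ ($j\neq0$); and, with $q(i|y):=\sum_{i'\neq i}q(i,i'|y)$, $q:=\sup_{i,y}q(i|y)<\infty$. Fix a modulating process $(Y_t)_{t\in[0,\infty)}$ that is ergodic in the sense that there is a probability distribution $\pi$ on $\mathcal Y$ with $\frac1t\int_0^t(1_{\{Y_s=y\}}-\pi(y))\,ds\to0$ a.s. as $t\to\infty$ for every $y\in\mathcal Y$. For $\epsilon>0$ let $Y_t^\epsilon=Y_{t/\epsilon}$, and let $X^\epsilon=X^{Y^\epsilon}$ be the corresponding switching process (starting in $x_0$). Convergence in distribution is weak convergence of the laws of the processes on the Skorokhod space of càdlàg paths on $[0,\infty)$. *)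

(* Defs.v *)
From HB Require Import structures.
From mathcomp Require Import all_boot all_order all_algebra.
From mathcomp Require Import all_classical all_reals all_analysis.
Set Implicit Arguments.
Unset Strict Implicit.
Unset Printing Implicit Defensive.
Import Order.TTheory GRing.Theory Num.Theory.
Import numFieldNormedType.Exports.
Local Open Scope classical_set_scope.
Local Open Scope ring_scope.

(* Paths on [0, +oo[ are total functions R -> R; only the values at times
   t >= 0 matter. *)
Definition cadlag {R : realType} (f : R -> R) : Prop :=
  forall t, 0 <= t ->
    (f s @[s --> t^'+] --> f t) /\
    (0 < t -> exists l : R, f s @[s --> t^'-] --> l).

(* The field [path_neg] makes the path determined by its restriction to
   [0, +oo[, so that equality of elements is equality of paths on [0, +oo[. *)
Record skorokhod (R : realType) := Skorokhod {
  path :> R -> R;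
  path_cadlag : cadlag path;
  path_neg : forall t, t < 0 -> path t = path 0 }.

Lemma cadlag_cst {R : realType} (c : R) : cadlag (fun=> c).
Proof. by move=> t _; split=> [|_]; [|exists c]; exact: cvg_cst. Qed.

Definition skorokhod_cst {R : realType} (c : R) : skorokhod R :=
  Skorokhod (cadlag_cst c) (fun _ _ => erefl).

HB.instance Definition _ (R : realType) := gen_eqMixin (skorokhod R).
HB.instance Definition _ (R : realType) := gen_choiceMixin (skorokhod R).
HB.instance Definition _ (R : realType) :=
  isPointed.Build (skorokhod R) (skorokhod_cst 0).

(* Increasing bijections of [0, +oo[ (hence homeomorphisms fixing 0). *)
Definition time_change {R : realType} (l : R -> R) : Prop :=
  [/\ forall s, 0 <= s -> 0 <= l s,
      forall s t, 0 <= s -> s < t -> l s < l t &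
      forall t, 0 <= t -> exists2 s, 0 <= s & l s = t].

(* For x fixed, these sets (a, e ranging over the positive reals) form a base
   of the neighbourhoods of x in the Skorokhod (J1) topology: x_n --> x iff
   there are time changes l_n with sup_s |l_n s - s| --> 0 and
   sup_(s <= a) |x_n (l_n s) - x s| --> 0 for every a. *)
Definition skorokhod_nbhd {R : realType} (x : skorokhod R) (a e : R) :
    set (skorokhod R) :=
  [set y : skorokhod R | exists l, [/\ time_change l,
    forall s, 0 <= s -> `|l s - s| <= e &
    forall s, 0 <= s <= a -> `|y (l s) - x s| <= e]].

Definition skorokhod_open {R : realType} (U : set (skorokhod R)) : Prop :=
  forall x, U x -> exists a e : R,
    [/\ 0 < a, 0 < e & skorokhod_nbhd x a e `<=` U].

Lemma skorokhod_nbhdS {R : realType} (x : skorokhod R) (a a' e e' : R) :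
  a' <= a -> e <= e' -> skorokhod_nbhd x a e `<=` skorokhod_nbhd x a' e'.
Proof.
move=> aa ee y [l [tl ls lx]]; exists l; split => // s.
  by move=> s0; apply: le_trans ee; exact: ls.
by move=> /andP[s0 sa]; apply: le_trans ee; apply: lx; rewrite s0 (le_trans sa).
Qed.

Lemma skorokhod_openT (R : realType) : @skorokhod_open R setT.
Proof. by move=> x _; exists 1, 1. Qed.

Lemma skorokhod_openI (R : realType) : setI_closed (@skorokhod_open R).
Proof.
move=> U V oU oV x [/oU[a [e [a0 e0 sU]]] /oV[b [f [b0 f0 sV]]]].
exists (Num.max a b), (Num.min e f); split.
- by rewrite lt_max a0.
- by rewrite lt_min e0.
- move=> y Ny; split; [apply: sU|apply: sV]; apply: skorokhod_nbhdS Ny;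
  by rewrite ?le_max ?ge_min lexx ?orbT.
Qed.

Lemma skorokhod_open_bigU (R : realType) (I : Type)
    (f : I -> set (skorokhod R)) :
  (forall i, skorokhod_open (f i)) -> skorokhod_open (\bigcup_i f i).
Proof.
move=> of_ x [i _ /of_[a [e [a0 e0 sU]]]]; exists a, e; split=> // y /sU.
by exists i.
Qed.

HB.instance Definition _ (R : realType) :=
  isOpenTopological.Build (skorokhod R) (@skorokhod_openT R)
    (@skorokhod_openI R) (@skorokhod_open_bigU R).

(* Borel sigma-algebra. *)
HB.instance Definition _ (R : realType) :=
  Measurable.copy (skorokhod R) (g_sigma_algebraType (@open (skorokhod R))).

Definition weak_cvg {R : realType} (F : set_system R)
    (mu : R -> probability (skorokhod R) R)
    (nu : probability (skorokhod R) R) : Prop :=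
  forall f : skorokhod R -> R,
    continuous f -> (exists M : R, forall x, `|f x| <= M) ->
    \int[mu e]_x f x @[e --> F] --> \int[nu]_x f x.

Definition cadlag_process {R : realType} {T : Type} (E : set R)
    (Z : R -> T -> R) : Prop :=
  forall w, cadlag (Z ^~ w) /\ (forall t, 0 <= t -> E (Z t w)).

(* [g] enumerates the successive jump times of the path [y], with the value
   +oo after the last jump, if any. For a cadlag path [y] in a finite set,
   such a [g] exists, is unique and tends to +oo. *)
Definition jump_times {R : realType} (y : R -> R) (g : nat -> \bar R) : Prop :=
  [/\ g 0%N = 0%:E,
      forall i, (g i < +oo)%E -> (g i < g i.+1)%E,
      forall i, g i = +oo%E -> g i.+1 = +oo%E,
      forall i t, (g i <= t%:E)%E -> (t%:E < g i.+1)%E -> y t = y (fine (g i)) &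
      forall i, (g i.+1 < +oo)%E -> y (fine (g i.+1)) <> y (fine (g i))].

Definition modulating_process {R : realType} {T : Type} (E : set R)
    (Y : R -> T -> R) : Prop :=
  cadlag_process E Y /\ forall w, exists g, jump_times (Y ^~ w) g.

Definition prob_dist {R : realType} (E : set R) (pi : R -> R) : Prop :=
  (forall y, E y -> 0 <= pi y) /\ \sum_(y \in E) pi y = 1.

Definition ergodic {d} {T : measurableType d} {R : realType}
    (P : probability T R) (E : set R) (pi : R -> R) (Y : R -> T -> R) : Prop :=
  forall y, E y -> {ae P, forall w,
    t^-1 * \int[lebesgue_measure]_(s in `[0, t]) ((Y s w == y)%:R - pi y)
      @[t --> +oo] --> (0 : R)}.

Definition exit_rate {R : realType} (I : set R) (Q : R -> R -> R) (i : R) :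
    \bar R :=
  \esum_(j in I `\ i) (Q i j)%:E.

Definition intensity_matrix {R : realType} (I : set R) (Q : R -> R -> R) :
    Prop :=
  (forall i j, I i -> I j -> i != j -> 0 <= Q i j) /\
  (forall i, I i -> (Q i i)%:E = (- exit_rate I Q i)%E).

(* [p t i j] is the transition function of a continuous-time Markov chain on
   [I] with intensity matrix [Q]: a stochastic semigroup satisfying
   p h i j = delta i j + h * Q i j + o(h) as h --> 0+. *)
Definition transition_function {R : realType} (I : set R) (Q : R -> R -> R)
    (p : R -> R -> R -> R) : Prop :=
  [/\ forall t i j, 0 <= t -> I i -> I j -> 0 <= p t i j,
      forall t i, 0 <= t -> I i -> \esum_(j in I) (p t i j)%:E = 1%E,
      forall i j, I i -> I j -> p 0 i j = (i == j)%:R,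
      forall s t i j, 0 <= s -> 0 <= t -> I i -> I j ->
        \esum_(k in I) (p s i k * p t k j)%:E = (p (s + t) i j)%:E &
      forall i j, I i -> I j ->
        h^-1 * (p h i j - (i == j)%:R) @[h --> 0^'+] --> Q i j].

(* On the event [A] (conditionally on [A], if it has positive probability),
   [Z] has the finite-dimensional distributions of the Markov chain on [I]
   with intensity matrix [Q] started at [x]. *)
Definition markov_chain_on {d} {T : measurableType d} {R : realType}
    (P : probability T R) (A : set T) (I : set R) (Q : R -> R -> R) (x : R)
    (Z : R -> T -> R) : Prop :=
  exists2 p, transition_function I Q p &
  forall (n : nat) (t a : nat -> R),
    t 0%N = 0 -> (forall k, t k <= t k.+1) ->
    a 0%N = x -> (forall k, I (a k)) ->
    P (A `&` [set w | forall k, (k <= n)%N -> Z (t k) w = a k]) =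
    (P A * (\prod_(k < n) p (t k.+1 - t k) (a k) (a k.+1))%:E)%E.

Definition markov_chain {d} {T : measurableType d} {R : realType}
    (P : probability T R) (I : set R) (Q : R -> R -> R) (x : R)
    (Z : R -> T -> R) : Prop :=
  cadlag_process I Z /\ markov_chain_on P setT I Q x Z.

(* The sigma-algebra generated by the whole process [Y] and by the processes
   [Z 0], ..., [Z i.-1]. *)
Definition history {T : Type} {R : realType}
    (Y : R -> T -> R) (Z : nat -> R -> T -> R) (i : nat) : set (set T) :=
  <<s [set A | exists t (B : set R), [/\ 0 <= t, measurable B &
        A = Y t @^-1` B \/
        exists k, (k < i)%N /\ A = Z k t @^-1` B]] >>.

Definition chain_start {T : Type} {R : realType} (x0 : R)
    (g : nat -> T -> \bar R) (Z : nat -> R -> T -> R) (i : nat) (w : T) : R :=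
  if i is k.+1 then Z k (fine (g k.+1 w) - fine (g k w)) w else x0.

(* [X] is built from the chains [Z i] as the switching process modulated by
   [Y]. The third condition says that, conditionally on [Y] and the previous
   chains, [Z i] is a Markov chain with intensity matrix q(.,.|y) started at
   [x], where y is the value of [Y] at the i-th jump time and x the starting
   point; since both take countably many values, it suffices to condition on
   the events of [history] on which they are constant. *)
Definition switching_process {d} {T : measurableType d} {R : realType}
    (P : probability T R) (E I : set R) (q : R -> R -> R -> R) (x0 : R)
    (Y : R -> {RV P >-> R}) (X : R -> T -> R) : Prop :=
  exists (g : nat -> T -> \bar R) (Z : nat -> R -> {RV P >-> R}),
  [/\ forall w, jump_times (Y ^~ w) (g ^~ w),
      forall i, cadlag_process I (Z i),
      forall i x y A, I x -> E y -> history Y (fun k t => Z k t) i A ->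
        (forall w, A w -> [/\ (g i w < +oo)%E, Y (fine (g i w)) w = y &
                              chain_start x0 g (fun k t => Z k t) i w = x]) ->
        markov_chain_on P A I (q y) x (Z i) &
      forall i w t, (g i w <= t%:E)%E -> (t%:E < g i.+1 w)%E ->
        X t w = Z i (t - fine (g i w)) w].

Definition averaged {R : realType} (E : set R) (q : R -> R -> R -> R)
    (pi : R -> R) (i j : R) : R :=
  \sum_(y \in E) q y i j * pi y.

(* Main.v *)
Require Import Defs.
From mathcomp Require Import all_boot all_order all_algebra.
From mathcomp Require Import all_classical all_reals all_analysis.
From mathcomp Require Import measurable_realfun.
From mathcomp Require Import ring lra.
Import Order.TTheory GRing.Theory Num.Theory.
Import numFieldNormedType.Exports.
Set Implicit Arguments.
Unset Strict Implicit.
Unset Printing Implicit Defensive.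
Local Open Scope classical_set_scope.
Local Open Scope ring_scope.

(** Why the theorem is true. While [Y] stays at [y], the process [X e] moves
    with the rates [q y]. The environment of [X e] runs [1 / e] times faster than
    [Y]: in a short block of time [[s, s + del]] the process makes a move with
    probability of order [del] only, whereas by ergodicity the environment
    spends in each state [y] a share of the block close to [pi y]. Up to
    [del ^+ 2] and up to the deviation of the occupation times of the
    environment, the conditional expectation of [u (X (s + del))] is therefore
    [u + del * L u] at the present state, where [L], the mean of the generators
    of the [q y] weighted by [pi], is the generator of the averaged chain. The
    averaged chain satisfies the same estimate, and both processes follow the
    same Euler scheme.

    Conditioning. The Markov property of the chains is assumed on events of the
    history only, and all conditional statements are inequalities between
    expectations on the events [passes X n t a], on which [X] is observed in the
    states [a k] at the times [t k]. They are first proved for one chain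
    ([chain_step], [chain_jump_le]) and carried over to [X] in [switching_step],
    as long as the environment does not jump. The chain alive at a given time
    was started at a random time, and its age is random; but this age is
    determined by the environment, it can be rounded to countably many values,
    and almost surely the chain is constant near its true age ([chain_near],
    [shifted_chain]). The same fact shows that [X] does not move when the
    environment jumps, whence the bound [b * h] on the probability of a move
    during a time [h], whatever the environment does ([switching_stay]).

    Averaging. A block is cut into pieces so short that the environment is
    constant on most of them. As the rates may be frozen at the state occupied
    at the start of the block, the sum over the pieces produces the occupation
    times of the environment, which become those of the block in the limit of
    vanishing pieces ([block_step], [occupation_riemann]). Iterating over the
    blocks compares the law of the values on a grid with the Euler scheme
    ([slow_euler], [averaged_euler]); letting first [e] tend to [0] and then the
    blocks shrink, the values on any fixed grid converge in law
    ([grid_path_cvg1]).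

    From the grid to the path. The probability that [X e] moves twice inside some
    mesh is at most [N * b ^+ 2 * w ^+ 2] for [N] meshes of width [w]
    ([bad_grid_le]), uniformly in [e]; with a horizon [N * w] that grows slowly
    it tends to [0]. Otherwise the path is determined, up to a time change of
    size [w], by its values on the grid ([one_switch_nbhd]). So a bounded
    continuous functional [f] is bounded, outside a small event, by a function
    of these values, the supremum of [f] over the paths with these values and at
    most one switch in each mesh. The supremum tends to [f] along every fixed
    path as the grid is refined, so that the limit superior of the expectations
    of [f] is at most the expectation under the averaged chain ([Ex_upper]). The
    same applies to [- f]. *)

(** * Expectations of bounded measurable functions *)

Section Expectation.
Context {d : measure_display} {T : measurableType d} {R : realType}.
Implicit Types (f g : T -> R).

Definition bmeas (f : T -> R) : Prop :=
  measurable_fun setT f /\ exists M : R, forall w, `|f w| <= M.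

Lemma bmeas_cst c : bmeas (fun=> c).
Proof. by split; [exact: measurable_cst | exists `|c|]. Qed.

Lemma bmeasD f g : bmeas f -> bmeas g -> bmeas (fun w => f w + g w).
Proof.
move=> [mf [M fM]] [mg [N gN]]; split; first exact: measurable_funD.
by exists (M + N) => w; apply: le_trans (ler_normD _ _) _; exact: lerD.
Qed.

Lemma bmeasN f : bmeas f -> bmeas (fun w => - f w).
Proof.
move=> [mf [M fM]]; split; first exact: measurableT_comp.
by exists M => w; rewrite normrN.
Qed.

Lemma bmeasB f g : bmeas f -> bmeas g -> bmeas (fun w => f w - g w).
Proof. by move=> bf bg; apply: bmeasD => //; exact: bmeasN. Qed.

Lemma bmeasM f g : bmeas f -> bmeas g -> bmeas (fun w => f w * g w).
Proof.
move=> [mf [M fM]] [mg [N gN]]; split; first exact: measurable_funM.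
by exists (M * N) => w; rewrite normrM ler_pM.
Qed.

Lemma bmeasZ c f : bmeas f -> bmeas (fun w => c * f w).
Proof. by move=> bf; apply: bmeasM => //; exact: bmeas_cst. Qed.

Lemma bmeas_abs f : bmeas f -> bmeas (fun w => `|f w|).
Proof.
move=> [mf [M fM]]; split; first exact: measurableT_comp.
by exists M => w; rewrite normr_id.
Qed.

Lemma bmeas_ind (A : set T) : measurable A -> bmeas \1_A.
Proof.
move=> mA; split; first exact: measurable_indic.
by exists 1 => w; rewrite indicE; case: (_ \in _); rewrite ?normr1 ?normr0.
Qed.

Lemma bmeas_sum (K : Type) (s : seq K) (p : pred K) (f : K -> T -> R) :
  (forall k, bmeas (f k)) -> bmeas (fun w => \sum_(k <- s | p k) f k w).
Proof.
move=> bf; elim: s => [|k s IHs].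
  by under eq_fun do rewrite big_nil; exact: bmeas_cst.
under eq_fun do rewrite big_cons.
by case: (p k) => //; exact: bmeasD.
Qed.

Variable P : probability T R.
Local Notation Ex f := (Rintegral P setT f).

Lemma bmeas_integrable f : bmeas f -> P.-integrable setT (EFin \o f).
Proof.
move=> [mf [M fM]]; apply: measurable_bounded_integrable => //.
  exact: le_lt_trans (probability_le1 P measurableT) (ltry 1).
exists M; split; first by rewrite num_real.
by move=> x Mx w _ /=; exact: le_trans (fM w) (ltW Mx).
Qed.

Lemma ExD f g : bmeas f -> bmeas g ->
  Ex (fun w => f w + g w) = Ex f + Ex g.
Proof. by move=> ? ?; apply: RintegralD => //; exact: bmeas_integrable. Qed.

Lemma ExB f g : bmeas f -> bmeas g ->
  Ex (fun w => f w - g w) = Ex f - Ex g.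
Proof. by move=> ? ?; apply: RintegralB => //; exact: bmeas_integrable. Qed.

Lemma ExZ c f : bmeas f -> Ex (fun w => c * f w) = c * Ex f.
Proof. by move=> ?; apply: RintegralZl => //; exact: bmeas_integrable. Qed.

Lemma Ex_cst c : Ex (fun=> c) = c.
Proof. by rewrite Rintegral_cst//= probability_setT mulr1. Qed.

Lemma ExN f : bmeas f -> Ex (fun w => - f w) = - Ex f.
Proof.
by move=> bf; rewrite -[RHS]mulN1r -ExZ//; apply: eq_Rintegral => w _; rewrite mulN1r.
Qed.

Lemma eq_Ex f g : f =1 g -> Ex f = Ex g.
Proof. by move=> fg; apply: eq_Rintegral => w _. Qed.

Lemma Ex_sum (K : Type) (s : seq K) (p : pred K) (f : K -> T -> R) :
  (forall k, bmeas (f k)) ->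
  Ex (fun w => \sum_(k <- s | p k) f k w) = \sum_(k <- s | p k) Ex (f k).
Proof.
move=> bf; elim: s => [|k s IHs].
  rewrite big_nil -[RHS](Ex_cst 0).
  by apply: eq_Ex => w; rewrite big_nil.
rewrite big_cons -IHs; case: ifPn => pk; last first.
  by apply: eq_Ex => w; rewrite big_cons (negbTE pk).
rewrite -ExD//; first by apply: eq_Ex => w; rewrite big_cons pk.
exact: bmeas_sum.
Qed.

Lemma le_Ex f g : bmeas f -> bmeas g -> (forall w, f w <= g w) -> Ex f <= Ex g.
Proof. by move=> ? ? fg; apply: le_Rintegral => //; exact: bmeas_integrable. Qed.

Lemma Ex_ge0 f : (forall w, 0 <= f w) -> 0 <= Ex f.
Proof. by move=> f0; apply: Rintegral_ge0. Qed.

Lemma abs_Ex f : bmeas f -> `|Ex f| <= Ex (fun w => `|f w|).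
Proof. by move=> ?; apply: le_normr_Rintegral => //; exact: bmeas_integrable. Qed.

Lemma Ex_ind A : measurable A -> Ex \1_A = fine (P A).
Proof. by move=> mA; rewrite /Rintegral integral_indic// setIT. Qed.

Lemma Ex_indI A B : measurable A -> measurable B ->
  Ex (fun w => \1_A w * \1_B w) = fine (P (A `&` B)).
Proof.
move=> mA mB; rewrite -Ex_ind; last exact: measurableI.
by apply: eq_Ex => w; rewrite indicI.
Qed.

Lemma Ex_cvg (f_ : nat -> T -> R) f M :
  (forall n, bmeas (f_ n)) -> bmeas f -> (forall n w, `|f_ n w| <= M) ->
  {ae P, forall w, f_ n w @[n --> \oo] --> f w} ->
  Ex (f_ n) @[n --> \oo] --> Ex f.
Proof.
move=> bf_ bf fM cf.
have /integrable_fin_num If := bmeas_integrable bf.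
suff : (\int[P]_w (f_ n w)%:E)%E @[n --> \oo] --> (\int[P]_w (f w)%:E)%E.
  move=> h; apply: fine_cvg; rewrite fineK//; exact: If.
have [|||||_ _] := @dominated_convergence _ _ _ P setT measurableT
  (fun n w => (f_ n w)%:E) (EFin \o f) (cst M%:E) => //.
- by move=> n; apply/measurable_EFinP; have [] := bf_ n.
- by apply/measurable_EFinP; have [] := bf.
- apply: filterS cf => w cw _.
  by apply: cvg_EFin => //; near=> x.
- exact: (bmeas_integrable (bmeas_cst M)).
- by apply: aeW => w n _; rewrite lee_fin.
Unshelve. all: by end_near. Qed.

Lemma ae_eq_Ex f g : bmeas f -> bmeas g -> {ae P, forall w, f w = g w} ->
  Ex f = Ex g.
Proof.
move=> bf bg fg; congr fine; apply: ae_eq_integral => //.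
- by apply/measurable_EFinP; have [] := bf.
- by apply/measurable_EFinP; have [] := bg.
by apply: filterS fg => w /= -> _.
Qed.

(** By dominated convergence both expectations are limits of the contributions
    of finitely many cells. Inequalities cell by cell play the role of
    inequalities between conditional expectations. *)
Lemma le_Ex_partition (V : T -> nat) f g :
  (forall v, measurable (V @^-1` [set v])) -> bmeas f -> bmeas g ->
  (forall v, Ex (fun w => \1_(V @^-1` [set v]) w * f w) <=
             Ex (fun w => \1_(V @^-1` [set v]) w * g w)) ->
  Ex f <= Ex g.
Proof.
move=> mV bf bg fg.
pose h_ (f : T -> R) n w := (\sum_(v < n) \1_(V @^-1` [set (v : nat)]) w) * f w.
have S01 n w : (\sum_(v < n) \1_(V @^-1` [set (v : nat)]) w : R) = (V w < n)%:R.
  case: ltnP => Vn.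
    rewrite (bigD1 (Ordinal Vn))//= big1 ?addr0.
      by rewrite indicE mem_set.
    move=> v vV; rewrite indicE memNset//= => E.
    by move: vV; rewrite -val_eqE /= -E eqxx.
  rewrite big1// => v _; rewrite indicE memNset//= => E.
  by have := ltn_ord v; rewrite -E ltnNge Vn.
have bh_ f' n : bmeas f' -> bmeas (h_ f' n).
  move=> bf'; apply: bmeasM => //; apply: bmeas_sum => v.
  exact: bmeas_ind.
have ch f' : bmeas f' -> Ex (h_ f' n) @[n --> \oo] --> Ex f'.
  move=> bf'; have [M f'M] := bf'.2.
  apply: (@Ex_cvg _ _ M) => //.
  - by move=> n; exact: bh_.
  - move=> n w; rewrite /h_ S01 normrM.
    apply: le_trans (f'M w); rewrite ler_piMl//.
    by case: (_ < _)%N; rewrite ?normr1 ?normr0.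
  apply: aeW => w; apply: cvg_near_cst; near=> n.
  by rewrite /h_ S01 (_ : (V w < n)%N) ?mul1r//; near: n; exact: nbhs_infty_gt.
apply: (ler_cvg_to (ch _ bf) (ch _ bg)); apply: nearW => n.
have hE f' : bmeas f' -> Ex (h_ f' n) =
    \sum_(v < n) Ex (fun w => \1_(V @^-1` [set (v : nat)]) w * f' w).
  move=> bf'; rewrite -Ex_sum; first by apply: eq_Ex => w; rewrite /h_ mulr_suml.
  by move=> v; apply: bmeasM => //; exact: bmeas_ind.
by rewrite !hE//; apply: ler_sum => v _; exact: fg.
Unshelve. all: by end_near. Qed.

End Expectation.

(** * Paths with at most one switch in each mesh of a grid *)

Section Cadlag.
Context {R : realType}.
Implicit Types (x z f : R -> R) (w s t u e : R).

Lemma cadlag_right x t e : cadlag x -> 0 <= t -> 0 < e ->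
  exists2 n : R, 0 < n & forall s, t <= s < t + n -> `|x s - x t| < e.
Proof.
move=> cx t0 e0; have [+ _] := cx t t0.
move=> /cvgrPdist_lt /(_ _ e0) /nbhs_ballP [n /= n0 H].
exists n => // s /andP[]; rewrite le_eqVlt => /predU1P[<- _|ts sn].
  by rewrite subrr normr0.
rewrite distrC; apply: H => //=.
by rewrite /ball /= ltr_norml; apply/andP; split; lra.
Qed.

Lemma cadlag_left x t e : cadlag x -> 0 < t -> 0 < e ->
  exists2 n : R, 0 < n & forall s s', t - n < s < t -> t - n < s' < t ->
    `|x s - x s'| < e.
Proof.
move=> cx t0 e0; have [_ /(_ t0) [l]] := cx t (ltW t0).
have e20 : 0 < e / 2 by rewrite divr_gt0.
move=> /cvgrPdist_lt /(_ _ e20) /nbhs_ballP [n /= n0 H].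
exists n => // s s' /andP[ns st] /andP[ns' s't].
have Hs u : t - n < u -> u < t -> `|l - x u| < e / 2.
  by move=> u1 u2; apply: H => //=; rewrite /ball /= ltr_norml; apply/andP; split; lra.
have := Hs s ns st; have := Hs s' ns' s't; rewrite !ltr_norml => /andP[? ?] /andP[? ?].
by apply/andP; split; lra.
Qed.

Lemma cadlag_eq_right x t (c : R) : cadlag x -> 0 <= t ->
  (forall n, 0 < n -> exists2 s, t < s < t + n & x s = c) -> x t = c.
Proof.
move=> cx t0 H; apply/eqP; rewrite -subr_eq0 -normr_eq0; apply/negPn/negP => ne.
have {ne}e0 : 0 < `|x t - c| by rewrite lt0r ne normr_ge0.
have [n n0 Hn] := cadlag_right cx t0 e0.
have [s /andP[ts sn] sc] := H n n0.
have /Hn : t <= s < t + n by rewrite (ltW ts).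
by rewrite sc distrC ltxx.
Qed.

(** The points of [t :: L] cut an interval into left-closed, right-open pieces,
    as is natural for cadlag paths. *)
Fixpoint small_osc x e t (L : seq R) : Prop :=
  if L is u :: L' then
    [/\ t < u, forall s s', t <= s < u -> t <= s' < u -> `|x s - x s'| <= e &
        small_osc x e u L']
  else True.

Lemma small_osc_rcons x e t L u : small_osc x e t L -> last t L < u ->
  (forall s s', last t L <= s < u -> last t L <= s' < u -> `|x s - x s'| <= e) ->
  small_osc x e t (rcons L u).
Proof.
elim: L t => [|v L IHL] t /=; first by [].
by move=> [tv ov oL] vu ou; split=> //; exact: IHL.
Qed.

Lemma small_osc_last x e t L : small_osc x e t L -> t <= last t L.
Proof.
elim: L t => [|v L IHL] t //= [tv _ /IHL vL].
exact: le_trans (ltW tv) vL.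
Qed.

(** Consider the supremum of the right ends of such partitions: it is itself a
    right end, thanks to the left limit there, and right-continuity would push
    the partition beyond it. *)
Lemma cadlag_partition x e a : cadlag x -> 0 < e ->
  exists2 L, small_osc x e 0 L & a < last 0 L.
Proof.
move=> cx e0; apply: contrapT => noL.
have {}noL L : small_osc x e 0 L -> last 0 L <= a.
  by move=> oL; rewrite leNgt; apply/negP => aL; apply: noL; exists L.
pose S := [set last 0 L | L in small_osc x e 0].
have S0 : S 0 by exists [::].
have supS : has_sup S.
  by split; [exists 0|exists a => _ [L oL <-]; exact: noL].
have e20 : 0 < e / 2 by rewrite divr_gt0.
set b := sup S.
have b0 : 0 <= b by apply: ub_le_sup => //; exact: supS.2.
have osc_right t : 0 <= t -> exists2 n : R, 0 < n & forall s s', t <= s < t + n ->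
    t <= s' < t + n -> `|x s - x s'| <= e.
  move=> t0; have [n n0 Hn] := cadlag_right cx t0 e20; exists n => // s s' /Hn + /Hn.
  by rewrite !ltr_norml => /andP[? ?] /andP[? ?]; rewrite ler_norml; apply/andP; split; lra.
have Sb : S b.
  move: b0; rewrite le_eqVlt => /predU1P[<-//|b0].
  have [n n0 Hn] := cadlag_left cx b0 e0.
  have [_ [L oL <-] nL] := sup_adherent n0 supS.
  have : last 0 L <= b by apply: ub_le_sup; [exact: supS.2|exists L].
  rewrite le_eqVlt => /predU1P[<-|Lb]; first by exists L.
  exists (rcons L b); last by rewrite last_rcons.
  apply: small_osc_rcons => // s s' /andP[s1 s2] /andP[s3 s4]; apply: ltW; apply: Hn.
    by rewrite s2 (lt_le_trans nL).
  by rewrite s4 (lt_le_trans nL).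
have [L oL Lb] := Sb; have [n n0 Hn] := osc_right b b0.
have : b + n <= b.
  apply: ub_le_sup; first exact: supS.2.
  exists (rcons L (b + n)); last by rewrite last_rcons.
  by apply: small_osc_rcons => //; rewrite Lb // ltrDl.
by rewrite gerDl leNgt n0.
Qed.

Lemma small_osc_gap x e t L : small_osc x e t L ->
  exists2 w, 0 < w & path (fun a b => a + w <= b) t L.
Proof.
elim: L t => [|u L IHL] t /=; first by exists 1.
move=> [tu _ /IHL[w w0 wL]]; exists (Num.min w (u - t)).
  by rewrite lt_min w0 subr_gt0.
apply/andP; split; first by rewrite -lerBrDl ge_min lexx orbT.
apply: sub_path wL => a b; apply: le_trans; rewrite lerD2l.
by rewrite ge_min lexx.
Qed.

(** Inside each mesh of the grid, [z] switches at most once from its value at the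
    left end to its value at the right end. The time of the switch is not
    mentioned, so that two observations are enough to refute the property. *)
Definition one_switch w (N : nat) z : Prop :=
  forall k : nat, (k < N)%N -> forall s s',
    k%:R * w <= s -> s <= s' -> s' <= k.+1%:R * w ->
    z s = z (k%:R * w) \/ z s' = z (k.+1%:R * w).

(** The switch happens at the infimum of the times at which the value differs
    from the initial one. *)
Lemma one_switch_time w N z k : cadlag z -> 0 < w -> one_switch w N z ->
  (k < N)%N -> exists2 u, k%:R * w < u <= k.+1%:R * w &
    (forall s, k%:R * w <= s < u -> z s = z (k%:R * w)) /\
    (forall s, u <= s <= k.+1%:R * w -> z s = z (k.+1%:R * w)).
Proof.
move=> cz w0 oz kN; set a := k%:R * w; set b := k.+1%:R * w.
have ab : a < b by rewrite ltr_pM2r// ltr_nat.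
have a0 : 0 <= a by rewrite mulr_ge0// ltW.
pose S := [set s | a <= s <= b /\ z s != z a].
have [Sne|S0] := pselect (S !=set0); last first.
  have zab s : a <= s <= b -> z s = z a.
    by move=> sab; apply/eqP/negPn/negP => zs; apply: S0; exists s.
  exists b; first by rewrite ab lexx.
  split=> [s /andP[s1 s2]|s /andP[s1 s2]]; first by apply: zab; rewrite s1 ltW.
  by rewrite !zab//; [rewrite (ltW ab) lexx|rewrite s2 (le_trans (ltW ab))].
have lbS : has_lbound S by exists a => s [/andP[]].
set u := inf S.
have au : a <= u by apply: lb_le_inf => // s [/andP[]].
have ub : u <= b.
  by have [s Ss] := Sne; have [/andP[_ sb] _] := Ss; apply: le_trans sb; exact: ge_inf.
have pre s : a <= s < u -> z s = z a.
  move=> /andP[s1 s2]; apply/eqP/negPn/negP => zs.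
  have : u <= s by apply: ge_inf => //; split=> //; rewrite s1 (le_trans (ltW s2)).
  by rewrite leNgt s2.
have post s : u < s <= b -> z s = z b.
  move=> /andP[us sb].
  have e0 : 0 < s - u by rewrite subr_gt0.
  have [v Sv] := inf_adherent e0 (conj Sne lbS).
  rewrite addrC subrK => vs; have [/andP[av vb] /eqP zv] := Sv.
  by have [//|//] := oz k kN v s av (ltW vs) sb.
have zu : z u = z b.
  move: ub; rewrite le_eqVlt => /predU1P[-> //|ub].
  apply: cadlag_eq_right => //; first exact: le_trans au.
  move=> n n0; have [m1 m2] : u < u + Num.min n (b - u) / 2 /\
      Num.min n (b - u) / 2 < n.
    have m0 : 0 < Num.min n (b - u) by rewrite lt_min n0 subr_gt0.
    have : Num.min n (b - u) <= n by rewrite ge_min lexx.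
    by split; lra.
  have m3 : Num.min n (b - u) <= b - u by rewrite ge_min lexx orbT.
  exists (u + Num.min n (b - u) / 2); first by rewrite m1 ltrD2l.
  by apply: post; rewrite m1 /=; lra.
have au' : a < u.
  move: au; rewrite le_eqVlt => /predU1P[au|//]; exfalso.
  have [s [/andP[s1 s2] /eqP zs]] := Sne.
  apply: zs; rewrite au zu; move: s1; rewrite le_eqVlt => /predU1P[<-|s1].
    by rewrite -zu -au.
  by apply: post; rewrite -au s1.
exists u; first by rewrite au'.
split=> // s /andP[]; rewrite le_eqVlt => /predU1P[<- //|us sb].
by apply: post; rewrite us.
Qed.

Lemma grid_floor w t : 0 < w -> 0 <= t ->
  exists k : nat, k%:R * w <= t < k.+1%:R * w.
Proof.
move=> w0 t0; exists (Num.truncn (t / w)).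
by rewrite -ler_pdivlMr// -ltr_pdivrMr//; apply: truncn_itv; rewrite divr_ge0// ltW.
Qed.

Lemma grid_ceil w t : 0 < w -> 0 < t ->
  exists k : nat, k%:R * w < t <= k.+1%:R * w.
Proof.
move=> w0 t0; have [k /andP[]] := grid_floor w0 (ltW t0).
rewrite le_eqVlt => /predU1P[kt _|k1 k2]; last by exists k; rewrite k1 ltW.
case: k kt => [|k] kt; first by move: t0; rewrite -kt mul0r ltxx.
by exists k; rewrite -kt lexx ltr_pM2r// ltr_nat ltnSn.
Qed.

(** The time change is affine between consecutive points of the partition of
    [x] and sends each of them to the time at which [z] switches inside the mesh
    containing it; then [z \o l] only visits, on each piece of the partition,
    grid values of [x] taken on the same piece. *)
Lemma one_switch_time_change x z e w N L t u m : cadlag z -> 0 < w ->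
  one_switch w N z -> (forall k, (k <= N)%N -> z (k%:R * w) = x (k%:R * w)) ->
  small_osc x e t L -> path (fun a b => a + w <= b) t L -> last t L <= N%:R * w ->
  (m <= N)%N -> t <= m%:R * w < t + w -> u <= m%:R * w -> 0 <= t -> 0 <= u -> `|u - t| <= w ->
  (forall s, u <= s <= m%:R * w -> z s = z (m%:R * w)) ->
  exists l : R -> R, [/\ l t = u,
    forall s s', t <= s -> s < s' -> l s < l s',
    forall v, u <= v -> exists2 s, t <= s & l s = v,
    forall s, t <= s -> `|l s - s| <= w &
    forall s, t <= s < last t L -> `|z (l s) - x s| <= e].
Proof.
move=> cz w0 oz zx.
elim: L t u m => [|t' L IHL] t u m.
  move=> _ _ _ _ _ _ t0 u0 ut _; exists (fun s => u + (s - t)); split.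
  - by rewrite subrr addr0.
  - by move=> s s' _ ss'; rewrite ltrD2l ltrD2r.
  - by move=> v uv; exists (v - u + t); [rewrite lerDr subr_ge0|ring].
  - by move=> s _; rewrite (_ : _ - s = u - t)//; ring.
  - by move=> s /=; rewrite ltNge => /andP[->].
move=> /= [tt' ox oL] /andP[tw gL] lN mN /andP[tm mt] um t0 u0 ut zm.
have t'0 : 0 < t' by exact: le_lt_trans tt'.
have [k /andP[kt' t'k]] := grid_ceil w0 t'0.
have kN : (k < N)%N.
  have : k%:R * w < N%:R * w.
    by apply: lt_le_trans kt' _; apply: le_trans lN; exact: small_osc_last oL.
  by rewrite ltr_pM2r// ltr_nat.
have mk : (m <= k)%N.
  have : m%:R * w < k.+1%:R * w.
    by apply: lt_le_trans t'k; exact: lt_le_trans tw.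
  by rewrite ltr_pM2r// ltr_nat ltnS.
have [u' /andP[ku' u'k] [pre post]] := one_switch_time cz w0 oz kN.
have mkw : m%:R * w <= k%:R * w by rewrite ler_pM2r// ler_nat.
have uu' : u < u' by apply: le_lt_trans ku'; exact: le_trans mkw.
have kk : k.+1%:R * w = k%:R * w + w by rewrite -natr1 mulrDl mul1r.
have k0 : 0 <= k%:R * w by rewrite mulr_ge0// ltW.
have [l [lt' lmono lsurj lid lz]] : exists l : R -> R, [/\ l t' = u',
    forall s s', t' <= s -> s < s' -> l s < l s',
    forall v, u' <= v -> exists2 s, t' <= s & l s = v,
    forall s, t' <= s -> `|l s - s| <= w &
    forall s, t' <= s < last t' L -> `|z (l s) - x s| <= e].
  apply: (IHL t' u' k.+1) => //.
  - by rewrite t'k kk ltrD2r.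
  - exact: ltW.
  - by apply: ltW; exact: le_lt_trans ku'.
  - by rewrite ler_norml; apply/andP; split; lra.
pose c := (u' - u) / (t' - t).
have t't : 0 < t' - t by rewrite subr_gt0.
have c0 : 0 < c by rewrite divr_gt0// subr_gt0.
have ct' : u + c * (t' - t) = u'.
  by rewrite /c divfK ?gt_eqF//; ring.
exists (fun s => if s < t' then u + c * (s - t) else l s); split.
- by rewrite tt' subrr mulr0 addr0.
- move=> s s' ts ss'; case: (ltP s t') => st'; case: (ltP s' t') => s't'.
  + by rewrite ltrD2l ltr_pM2l// ltrD2r.
  + apply: (@lt_le_trans _ _ u').
      by rewrite -ct' ltrD2l ltr_pM2l// ltrD2r.
    rewrite -lt'; move: s't'; rewrite le_eqVlt => /predU1P[-> //|s't'].
    by apply: ltW; exact: lmono.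
  + by move: (lt_trans ss' s't'); rewrite ltNge st'.
  + exact: lmono.
- move=> v uv; case: (ltP v u') => vu'.
    exists (t + (v - u) / c).
      by rewrite lerDl divr_ge0// ?subr_ge0// ltW.
    rewrite ifT; first by rewrite addrAC subrr add0r mulrC divfK ?gt_eqF//; ring.
    rewrite -ltrBrDl ltr_pdivrMr//; lra.
  have [s ts lsv] := lsurj v vu'.
  by exists s; [exact: le_trans (ltW tt') ts|rewrite ltNge ts].
- move=> s ts; case: ifPn => [st'|]; last by rewrite -leNgt => /lid.
  have -> : u + c * (s - t) - s =
     ((t' - s) / (t' - t)) * (u - t) + ((s - t) / (t' - t)) * (u' - t').
    by rewrite /c; field; rewrite gt_eqF.
  apply: le_trans (ler_normD _ _) _.
  rewrite (normrM ((t' - s) / (t' - t))) (normrM ((s - t) / (t' - t))).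
  have u't' : `|u' - t'| <= w by rewrite ler_norml; apply/andP; split; lra.
  rewrite (ger0_norm (x := (t' - s) / _)); last by rewrite divr_ge0// ?subr_ge0 ltW.
  rewrite (ger0_norm (x := (s - t) / _)); last by rewrite divr_ge0// ?subr_ge0// ltW.
  apply: (@le_trans _ _ ((t' - s) / (t' - t) * w + (s - t) / (t' - t) * w)).
    by apply: lerD; rewrite ler_wpM2l// divr_ge0// ?subr_ge0// ltW.
  rewrite -mulrDl -mulrDl (_ : t' - s + (s - t) = t' - t); last by ring.
  by rewrite divff ?mul1r// gt_eqF.
- move=> s /andP[ts sL]; case: ifPn => [st'|]; last first.
    by rewrite -leNgt => t's; apply: lz; rewrite t's.
  set v := u + c * (s - t).
  have uv : u <= v by rewrite lerDl mulr_ge0//; [exact: ltW|rewrite subr_ge0].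
  have vu' : v < u' by rewrite -ct' ltrD2l ltr_pM2l// ltrD2r.
  have [j /andP[mj jk] ->] : exists2 j, (m <= j <= k)%N & z v = z (j%:R * w).
    have [vm|mv] := lerP v (m%:R * w).
      by exists m; [rewrite leqnn|apply: zm; rewrite uv].
    have [j /andP[j1 j2]] := grid_floor w0 (le_trans u0 uv).
    have jm : (m <= j)%N.
      by have : m%:R * w < j.+1%:R * w by [exact: lt_trans j2]; rewrite ltr_pM2r// ltr_nat ltnS.
    have jk : (j <= k)%N.
      have : j%:R * w < k.+1%:R * w by apply: le_lt_trans j1 _; exact: lt_le_trans u'k.
      by rewrite ltr_pM2r// ltr_nat ltnS.
    move: jk; rewrite leq_eqVlt => /predU1P[jk|jk].
      exists k; first by rewrite mk leqnn.
      by apply: pre; rewrite vu' -[in X in X <= _]jk j1.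
    have [H|H] := oz j (ltn_trans jk kN) v v j1 (lexx _) (ltW j2).
      by exists j => //; rewrite jm ltnW.
    by exists j.+1 => //; rewrite jk (leqW jm).
  rewrite zx; last by apply: leq_trans jk (ltnW kN).
  apply: ox; last by rewrite ts.
  apply/andP; split.
    by apply: le_trans tm _; rewrite ler_pM2r// ler_nat.
  by apply: le_lt_trans kt'; rewrite ler_pM2r// ler_nat.
Qed.

(** A path [z] satisfying [one_switch] is determined, up to a small change of
    time, by its values on the grid. The bounds [w0] and [A] depend on [x] only: the mesh has to
    separate the points of a partition on the pieces of which [x] oscillates
    little. *)
Lemma one_switch_nbhd (x : skorokhod R) a e : 0 < e ->
  exists w0 A : R, 0 < w0 /\ forall w N (z : skorokhod R), 0 < w <= w0 ->
    A <= N%:R * w -> one_switch w N z ->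
    (forall k, (k <= N)%N -> z (k%:R * w) = x (k%:R * w)) ->
    skorokhod_nbhd x a e z.
Proof.
move=> e0; have [L oL aL] := cadlag_partition a (path_cadlag x) e0.
have [w1 w10 gL] := small_osc_gap oL.
exists (Num.min w1 e), (last 0 L); split; first by rewrite lt_min w10.
move=> w N z /andP[w0 ww1] LN oz zx.
have [wa wb] : w <= w1 /\ w <= e by apply/andP; rewrite -le_min.
have gL' : path (fun a b => a + w <= b) 0 L.
  by apply: sub_path gL => b c; apply: le_trans; rewrite lerD2l.
have [||||||l [l0 lm ls li lz]] := @one_switch_time_change x z e w N L 0 0 0%N
    (path_cadlag z) w0 oz zx oL gL' LN (leq0n _).
- by rewrite mul0r lexx add0r.
- by rewrite mul0r.
- by [].
- by [].
- by rewrite subrr normr0 ltW.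
- by move=> s; rewrite mul0r => s0; rewrite (le_anti s0).
exists l; split; first split => //.
- by move=> s; rewrite le_eqVlt => /predU1P[<-|s0]; [rewrite l0|rewrite -l0 ltW ?lm].
- by move=> s s0; apply: le_trans wb; exact: li.
- by move=> s /andP[s0 sa]; apply: lz; rewrite s0 (le_lt_trans sa).
Qed.

End Cadlag.

(** * The Borel structure of the Skorokhod space *)

Section SkorokhodBorel.
Context {R : realType}.

Lemma open_skorokhod_measurable (U : set (skorokhod R)) :
  skorokhod_open U -> measurable U.
Proof. by move=> oU; apply: sub_sigma_algebra. Qed.

(** The supremum of a path over an open time interval is lower semicontinuous,
    since time changes only move points slightly. *)
Lemma skorokhod_open_exists_gt (t u c : R) : 0 <= t ->
  skorokhod_open [set x : skorokhod R | exists2 s, t < s < u & c < x s].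
Proof.
move=> t0 x /= [s /andP[ts su] cs].
pose e := Num.min (x s - c) (Num.min (s - t) (u - s)) / 2.
have m0 : 0 < Num.min (x s - c) (Num.min (s - t) (u - s)) by rewrite !lt_min !subr_gt0 cs ts.
have [m1 m2 m3] : [/\ 2 * e <= x s - c, 2 * e <= s - t & 2 * e <= u - s].
  by rewrite /e mulrC divfK// !ge_min !lexx !orbT.
have e0 : 0 < e by rewrite divr_gt0.
exists (s + 1), e; split=> //; first by lra.
move=> y [l [_ le lx]]; exists (l s).
  have /le : 0 <= s by exact: ltW (le_lt_trans t0 ts).
  by rewrite ler_norml => /andP[? ?]; apply/andP; split; lra.
have : 0 <= s <= s + 1 by apply/andP; split; lra.
by move=> /lx; rewrite ler_norml => /andP[? ?]; lra.
Qed.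

(** By right-continuity, [c <= x t] can be read off the suprema of [x] over the
    open intervals that start at [t]. *)
Lemma measurable_eval (t : R) : 0 <= t ->
  measurable_fun setT (fun x : skorokhod R => x t).
Proof.
move=> t0; apply: (measurability _ (@RGenCInfty.measurableE R)).
move=> _ [_ [c ->]] <-; rewrite setTI.
rewrite (_ : _ @^-1` _ = \bigcap_m \bigcap_n
  [set x : skorokhod R | exists2 s, t < s < t + n.+1%:R^-1 & c - m.+1%:R^-1 < x s]).
  apply: bigcapT_measurable => m; apply: bigcapT_measurable => n.
  by apply: open_skorokhod_measurable; exact: skorokhod_open_exists_gt.
apply/seteqP; split=> [x /=|x /= H].
  rewrite in_itv/= andbT => ct m _ n _.
  have : (0 : R) < m.+1%:R^-1 by rewrite invr_gt0.
  have : (0 : R) < n.+1%:R^-1 by rewrite invr_gt0.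
  move: (n.+1%:R^-1) (m.+1%:R^-1) => b c' n0 m0.
  have [h h0 Hh] := cadlag_right (path_cadlag x) t0 m0.
  have [k [k0 kh kn]] : exists k : R, [/\ 0 < k, k <= h & k <= b].
    by exists (Num.min h b); rewrite lt_min h0 n0 !ge_min !lexx orbT.
  exists (t + k / 2); first by apply/andP; split; lra.
  have /Hh : t <= t + k / 2 < t + h by apply/andP; split; lra.
  by rewrite ltr_norml => /andP[? ?]; lra.
rewrite in_itv/= andbT leNgt; apply/negP => xc.
pose e := (c - x t) / 2; have e0 : 0 < e by rewrite divr_gt0// subr_gt0.
have [h h0 Hh] := cadlag_right (path_cadlag x) t0 e0.
have archi (r : R) : 0 < r -> exists n, n.+1%:R^-1 < r.
  move=> r0; exists (Num.truncn r^-1).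
  rewrite invf_plt ?posrE//.
  have ri : 0 <= r^-1 by rewrite invr_ge0 ltW.
  by have /andP[] := truncn_itv ri.
have [n hn] := archi h h0; have [m hm] := archi e e0.
have [s /andP[ts sn] sc] := H m I n I.
move: (n.+1%:R^-1) (m.+1%:R^-1) hn hm sn sc => b c' hn hm sn sc.
have eE : 2 * e = c - x t by rewrite /e mulrC divfK.
have /Hh : t <= s < t + h by apply/andP; split; lra.
by rewrite ltr_norml => /andP[? ?]; lra.
Qed.

Lemma continuous_measurable_skorokhod (f : skorokhod R -> R) :
  continuous f -> measurable_fun setT f.
Proof.
move=> cf; apply: (measurability _ (@RGenOInfty.measurableE R)).
move=> _ [_ [c ->]] <-; rewrite setTI; apply: open_skorokhod_measurable.
suff : open (f @^-1` `]c, +oo[) by [].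
apply: open_comp => //; exact: interval_open.
Qed.

Lemma continuous_skorokhod_nbhd (f : skorokhod R -> R) x e : continuous f -> 0 < e ->
  exists a n : R, 0 < n /\ forall z, skorokhod_nbhd x a n z -> `|f z - f x| < e.
Proof.
move=> cf e0; pose U := f @^-1` (ball (f x) e).
have oU : open U by apply: open_comp => //; exact: ball_open.
have [] := (oU : skorokhod_open U) x; first exact: ballxx.
move=> a [n [a0 n0 sU]]; exists a, n; split=> // z /sU.
by rewrite /U /= /ball /= distrC.
Qed.

End SkorokhodBorel.

(** * Jump rates and transition probabilities over short times *)

Section CountableValued.
Context {d : measure_display} {T : measurableType d}.

Lemma measurable_nat_preimage (V : T -> nat) (B : set nat) :
  (forall v, measurable (V @^-1` [set v])) -> measurable (V @^-1` B).
Proof.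
move=> mV; rewrite (_ : V @^-1` B = \bigcup_(v in B) V @^-1` [set v]).
  exact: bigcup_measurable.
by apply/seteqP; split=> [w Bw|w [v Bv /= Vv]]; [exists (V w)|rewrite /= Vv].
Qed.

Lemma measurable_nat_comp {R : realType} (V : T -> nat) (g : nat -> R) :
  (forall v, measurable (V @^-1` [set v])) -> measurable_fun setT (g \o V).
Proof.
move=> mV _ B _; rewrite setTI -[_ @^-1` _]/(V @^-1` (g @^-1` B)).
exact: measurable_nat_preimage.
Qed.

Lemma measurable_code {R : realType} (I : set R) (c : R -> nat) (V : T -> R) v :
  {in I &, injective c} -> (forall w, I (V w)) ->
  (forall a, measurable (V @^-1` [set a])) -> measurable ((c \o V) @^-1` [set v]).
Proof.
move=> cI IV mV; have [[a [Ia av]]|na] := pselect (exists a, I a /\ c a = v).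
  rewrite (_ : _ @^-1` _ = V @^-1` [set a]) //.
  apply/seteqP; split=> w /= => [|->//] cV.
  by apply: cI; rewrite ?inE// av.
rewrite (_ : _ @^-1` _ = set0) // -subset0 => w /= cV.
by apply: na; exists (V w).
Qed.

Lemma measurable_countable_preimage {R : realType} (I : set R) (V : T -> R) (B : set R) :
  countable I -> (forall w, I (V w)) -> (forall a, measurable (V @^-1` [set a])) ->
  measurable (V @^-1` B).
Proof.
move=> /countable_injP[c cI] IV mV.
rewrite (_ : V @^-1` B = (c \o V) @^-1` (c @` (I `&` B))).
  by apply: measurable_nat_preimage => v; exact: measurable_code cI IV mV.
apply/seteqP; split=> [w Bw|w [a [Ia Ba] /= /cI]]; first by exists (V w).
by rewrite !inE => /(_ Ia (IV w)) <-.
Qed.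

End CountableValued.

Section TransitionRates.
Context {R : realType}.
Implicit Types (I : set R) (Q : R -> R -> R) (p : R -> R -> R -> R) (Jl : seq R).

Lemma esum_ge_seq I (f : R -> R) (s : seq R) : (forall k, I k -> 0 <= f k) -> uniq s ->
  (forall k, k \in s -> I k) ->
  ((\sum_(k <- s) f k)%:E <= \esum_(k in I) (f k)%:E)%E.
Proof.
move=> f0 us sI; apply: esum_ge; exists [set` s].
  by split; [exact: finite_seq | move=> k /sI].
by rewrite -fsbig_seq// sumEFin.
Qed.

(** Cut off at the boundary of the state space: [a + j] may fail to be a state. *)
Definition jump_rate I Q (a j : R) : R := if `[< I (a + j) >] then Q a (a + j) else 0.

Definition generator I Q Jl (u : R -> R) (a : R) : R :=
  \sum_(j <- Jl) jump_rate I Q a j * (u (a + j) - u a).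

(** What remains of an intensity matrix with jumps in [Jl] and exit rates at
    most [b], expressed by finite sums. *)
Definition bounded_rates I Q Jl (b : R) : Prop := forall a, I a ->
  [/\ forall j, j \in Jl -> 0 <= jump_rate I Q a j,
      Q a a = - \sum_(j <- Jl) jump_rate I Q a j &
      \sum_(j <- Jl) jump_rate I Q a j <= b].

Lemma jump_rate_le I Q Jl b a j : bounded_rates I Q Jl b -> I a -> uniq Jl -> j \in Jl ->
  jump_rate I Q a j <= b.
Proof.
move=> bQ Ia uJ jJ; have [r0 _] := bQ a Ia; apply: le_trans.
rewrite (bigD1_seq j)//= lerDl big_seq_cond; apply: sumr_ge0 => k /andP[kJ _].
exact: r0.
Qed.

Lemma generator_bound I Q Jl b u a : bounded_rates I Q Jl b -> I a ->
  (forall c, `|u c| <= 1) -> `|generator I Q Jl u a| <= 2 * b.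
Proof.
move=> bQ Ia u1; have [r0 _ rb] := bQ a Ia.
apply: le_trans (ler_norm_sum _ _ _) _.
apply: (@le_trans _ _ (\sum_(j <- Jl) jump_rate I Q a j * 2)).
  rewrite big_seq [leRHS]big_seq; apply: ler_sum => j jJ.
  rewrite normrM (ger0_norm (r0 _ jJ)) ler_wpM2l// ?r0//.
  by apply: le_trans (ler_normB _ _) _; have := u1 (a + j); have := u1 a; lra.
by rewrite -mulr_suml mulrC ler_pM2l.
Qed.

Section Transition.
Variables (I : set R) (Q : R -> R -> R) (p : R -> R -> R -> R).
Hypothesis tp : transition_function I Q p.

Lemma transition_ge0 t i j : 0 <= t -> I i -> I j -> 0 <= p t i j.
Proof. by have [+ _ _ _ _] := tp; apply. Qed.

Lemma transition_sum_le1 t i s : 0 <= t -> I i -> uniq s -> (forall k, k \in s -> I k) ->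
  \sum_(k <- s) p t i k <= 1.
Proof.
move=> t0 Ii us sI; have [_ p1 _ _ _] := tp.
rewrite -lee_fin -[leRHS](p1 t i)//; apply: esum_ge_seq => // k Ik.
exact: transition_ge0.
Qed.

Lemma transition_le1 t i j : 0 <= t -> I i -> I j -> p t i j <= 1.
Proof.
move=> t0 Ii Ij; have := @transition_sum_le1 t i [:: j] t0 Ii.
by rewrite big_seq1; apply => // k; rewrite inE => /eqP ->.
Qed.

Lemma transition_CK_ge s t i j r : 0 <= s -> 0 <= t -> I i -> I j -> uniq r ->
  (forall k, k \in r -> I k) -> \sum_(k <- r) p s i k * p t k j <= p (s + t) i j.
Proof.
move=> s0 t0 Ii Ij ur rI; have [_ _ _ ck _] := tp.
rewrite -lee_fin -ck//; apply: esum_ge_seq => // k Ik.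
by rewrite mulr_ge0// transition_ge0.
Qed.

Lemma transition_rate_cvg (i j h : R) : I i -> I j -> 0 < h ->
  n.+1%:R * (p (h / n.+1%:R) i j - (i == j)%:R) @[n --> \oo] --> h * Q i j.
Proof.
move=> Ii Ij h0; have [_ _ _ _ /(_ i j Ii Ij)] := tp.
move=> /cvg_at_rightP /(_ (fun n => h / n.+1%:R)) H.
have {}H : (h / n.+1%:R)^-1 * (p (h / n.+1%:R) i j - (i == j)%:R) @[n --> \oo] --> Q i j.
  apply: H; split=> [n|]; first by rewrite divr_gt0.
  have : h * harmonic n @[n --> \oo] --> h * 0.
    by apply: cvgMl_tmp; exact: cvg_harmonic.
  by rewrite mulr0.
have : h * ((h / n.+1%:R)^-1 * (p (h / n.+1%:R) i j - (i == j)%:R)) @[n --> \oo] --> h * Q i j.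
  by apply: cvgMl_tmp.
apply: cvg_trans; apply: near_eq_cvg; apply: nearW => n /=.
by rewrite [in LHS]mulrA (_ : h * (h / _)^-1 = n.+1%:R)// invf_div mulrC divfK// gt_eqF.
Qed.

(** By the Chapman-Kolmogorov equation the chain may stay put in each of [n]
    short intervals; as [n] grows, the derivative at [0] appears. *)
Lemma transition_stay h i : 0 <= h -> I i -> 1 - p h i i <= h * - Q i i.
Proof.
rewrite le_eqVlt => /predU1P[<- Ii|h0 Ii].
  by have [_ _ -> // _ _] := tp; rewrite eqxx subrr mul0r.
have sub n s : 0 <= s -> 1 - p (n%:R * s) i i <= n%:R * (1 - p s i i).
  move=> s0; elim: n => [|n IHn].
    by rewrite !mul0r; have [_ _ -> // _ _] := tp; rewrite eqxx subrr.
  have ns0 : 0 <= n%:R * s by rewrite mulr_ge0.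
  have := @transition_CK_ge (n%:R * s) s i i [:: i] ns0 s0 Ii Ii isT.
  rewrite big_seq1 (_ : n%:R * s + s = n.+1%:R * s); last by rewrite -natr1 mulrDl mul1r.
  move=> H.
  have {}H : p (n%:R * s) i i * p s i i <= p (n.+1%:R * s) i i.
    by apply: H => k; rewrite inE => /eqP ->.
  rewrite -[in leRHS]natr1 mulrDl mul1r.
  have := transition_le1 ns0 Ii Ii; have := transition_le1 s0 Ii Ii.
  have := transition_ge0 ns0 Ii Ii; have := transition_ge0 s0 Ii Ii.
  nra.
have c : n.+1%:R * (1 - p (h / n.+1%:R) i i) @[n --> \oo] --> h * - Q i i.
  have := transition_rate_cvg Ii Ii h0; rewrite eqxx => /cvgN.
  rewrite mulrN; apply: cvg_trans; apply: near_eq_cvg; apply: nearW => n /=.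
  by rewrite -mulrN opprB.
apply: (ler_cvg_to (cvg_cst (1 - p h i i)) c); apply: nearW => n.
have := @sub n.+1 (h / n.+1%:R); rewrite mulrCA divff ?mulr1//.
by apply; rewrite divr_ge0// ltW.
Qed.

Variables (Jl : seq R) (b : R).
Hypotheses (bQ : bounded_rates I Q Jl b) (uJ : uniq Jl) (J0 : 0 \notin Jl).

Lemma bounded_rates_stay h i : 0 <= h -> I i -> 1 - p h i i <= b * h.
Proof.
move=> h0 Ii; apply: le_trans (transition_stay h0 Ii) _.
by have [_ -> Sb] := bQ Ii; rewrite opprK mulrC ler_wpM2r.
Qed.

(** A jump [i -> i + j] during a short time interval is at least as likely as
    the jump happening in one of many subintervals with the chain staying put
    in all the others. *)
Lemma transition_jump_ge h i j : 0 <= h -> I i -> j \in Jl -> I (i + j) ->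
  h * Q i (i + j) - 2 * b ^+ 2 * h ^+ 2 <= p h i (i + j).
Proof.
rewrite le_eqVlt => /predU1P[<- Ii jJ Ij|h0 Ii jJ Ij].
  by rewrite expr0n/= mulr0 mul0r subrr transition_ge0.
set k := i + j.
have jrE : jump_rate I Q i j = Q i k by rewrite /jump_rate asboolT.
have Qb : Q i k <= b by rewrite -jrE; exact: (jump_rate_le bQ).
have Q0 : 0 <= Q i k by rewrite -jrE; have [r0 _ _] := bQ Ii; exact: r0.
have b0 : 0 <= b by exact: le_trans Qb.
have ik : i != k.
  by apply: contraNneq J0 => ik; rewrite -(_ : j = 0)// -(addKr i j) -/k -ik addNr.
have sub n s : 0 <= s -> n%:R * s <= h ->
    n%:R * (p s i k * (1 - b * h) - b ^+ 2 * s * h) <= p (n%:R * s) i k.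
  move=> s0; elim: n => [|n IHn] nsh.
    by rewrite !mul0r transition_ge0.
  have ns0 : 0 <= n%:R * s by rewrite mulr_ge0.
  have nsE : n.+1%:R * s = s + n%:R * s by rewrite -nat1r mulrDl mul1r.
  have nh : n%:R * s <= h by move: nsh; rewrite nsE; lra.
  have := @transition_CK_ge s (n%:R * s) i k [:: i; k] s0 ns0 Ii Ij.
  rewrite /= inE ik big_cons big_seq1 -nsE => /(_ isT) H.
  have {}H : p s i i * p (n%:R * s) i k + p s i k * p (n%:R * s) k k <=
      p (n.+1%:R * s) i k.
    by apply: H => l; rewrite !inE => /orP[] /eqP ->.
  rewrite -[in leLHS]natr1 mulrDl mul1r.
  have {}IHn := IHn nh.
  have h1 := bounded_rates_stay s0 Ii.
  have h2 := bounded_rates_stay ns0 Ij.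
  have h3 := bounded_rates_stay ns0 Ii.
  have h4 : p (n%:R * s) i i + p (n%:R * s) i k <= 1.
    have := @transition_sum_le1 (n%:R * s) i [:: i; k] ns0 Ii.
    rewrite big_cons big_seq1 /= inE ik; apply => // l.
    by rewrite !inE => /orP[] /eqP ->.
  have h5 := transition_ge0 ns0 Ii Ij.
  have h6 := transition_ge0 s0 Ii Ij.
  have h7 : p (n%:R * s) i k <= b * h.
    have : b * (n%:R * s) <= b * h by rewrite ler_wpM2l.
    lra.
  have h8 : (1 - p s i i) * p (n%:R * s) i k <= b ^+ 2 * s * h.
    rewrite (_ : b ^+ 2 * s * h = (b * s) * (b * h)); last by ring.
    apply: ler_pM => //; rewrite subr_ge0; exact: transition_le1.
  have h9 : p s i k * (1 - b * h) <= p s i k * p (n%:R * s) k k.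
    apply: ler_wpM2l => //.
    have : b * (n%:R * s) <= b * h by rewrite ler_wpM2l.
    lra.
  lra.
have c : n.+1%:R * p (h / n.+1%:R) i k * (1 - b * h) - b ^+ 2 * h * h @[n --> \oo] -->
    h * Q i k * (1 - b * h) - b ^+ 2 * h * h.
  apply: cvgB; last exact: cvg_cst.
  apply: cvgMr_tmp.
  have := transition_rate_cvg Ii Ij h0; rewrite (negbTE ik).
  by under eq_fun do rewrite subr0.
apply: (@le_trans _ _ (h * Q i k * (1 - b * h) - b ^+ 2 * h * h)).
  have : h * (Q i k * (b * h)) <= h * (b * (b * h)).
    by rewrite ler_pM2l// ler_wpM2r// mulr_ge0// ltW.
  rewrite !expr2; lra.
apply: (ler_cvg_to c (cvg_cst (p h i k))); apply: nearW => n.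
have nE : n.+1%:R * (h / n.+1%:R) = h by rewrite mulrCA divff ?mulr1.
have s0 : 0 <= h / n.+1%:R by rewrite divr_ge0// ltW.
have := @sub n.+1 (h / n.+1%:R) s0; rewrite nE lexx => /(_ isT).
rewrite mulrBr mulrA; congr (_ - _ <= _).
by field; rewrite addrC natr1 pnatr_eq0.
Qed.

End Transition.
End TransitionRates.

(** * One step of a Markov chain after a prescribed past *)

Section Passes.
Context {d : measure_display} {T : measurableType d} {R : realType}.
Implicit Types (Z : R -> T -> R) (t a : nat -> R).

Definition passes Z n t a : set T := [set w | forall k, (k <= n)%N -> Z (t k) w = a k].

Lemma measurable_passes Z n t a : (forall k, (k <= n)%N -> measurable_fun setT (Z (t k))) ->
  measurable (passes Z n t a).
Proof.
move=> mZ; rewrite (_ : passes Z n t a =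
    \bigcap_k if (k <= n)%N then Z (t k) @^-1` [set a k] else setT).
  apply: bigcapT_measurable => k; case: ifPn => kn; last exact: measurableT.
  by rewrite -[X in measurable X]setTI; exact: mZ.
apply/seteqP; split=> w H k; first by move=> _; case: ifPn => // /H.
by move=> kn; have := H k I; rewrite kn.
Qed.

End Passes.

Lemma indic_eq {T : Type} {R : pzRingType} (A : set T) w (b : bool) : (A w <-> b) ->
  \1_A w = b%:R :> R.
Proof.
move=> Ab; rewrite indicE; congr (_%:R); case: b Ab => [[_ Ab]|[Ab _]].
  by rewrite mem_set//; exact: Ab.
by rewrite memNset// => /Ab.
Qed.

Lemma indic_range {T : Type} {R : numDomainType} (A : set T) w : 0 <= (\1_A w : R) <= 1.
Proof. by rewrite indicE; case: (_ \in _); rewrite /= lexx ler01. Qed.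

Section Chain.
Context {d : measure_display} {T : measurableType d} {R : realType}.
Variables (P : probability T R) (I : set R) (Q : R -> R -> R) (Jl : seq R) (b : R).
Variables (A : set T) (x : R) (Z : R -> T -> R).
Hypotheses (mZ : forall t : R, 0 <= t -> measurable_fun setT (Z t)).
Hypotheses (ZI : forall (t : R) w, 0 <= t -> I (Z t w)).
Hypotheses (mA : measurable A) (cI : countable I).
Hypothesis chainZ : markov_chain_on P A I Q x Z.
Hypotheses (bQ : bounded_rates I Q Jl b) (uJ : uniq Jl) (J0 : 0 \notin Jl).
Local Notation Ex f := (Rintegral P setT f).

Lemma mono_ge0 (t : nat -> R) k : t 0%N = 0 -> (forall k, t k <= t k.+1) -> 0 <= t k.
Proof. by move=> t0 tm; elim: k => [|k IHk]; rewrite ?t0//; exact: le_trans (tm k). Qed.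

Lemma chain_next : exists2 p, transition_function I Q p &
  forall n t a h c, t 0%N = 0 -> (forall k, t k <= t k.+1) -> a 0%N = x ->
    (forall k, I (a k)) -> 0 <= h -> I c ->
    Ex (fun w => \1_(A `&` passes Z n t a) w * \1_(Z (t n + h) @^-1` [set c]) w) =
    Ex \1_(A `&` passes Z n t a) * p h (a n) c.
Proof.
have [p tp HP] := chainZ; exists p => // n t a h c t0 tm a0 Ia h0 Ic.
have tn0 k : 0 <= t k by exact: mono_ge0.
have mpass : measurable (A `&` passes Z n t a).
  by apply: measurableI => //; apply: measurable_passes => k _; exact: mZ.
have mc : measurable (Z (t n + h) @^-1` [set c]).
  by rewrite -[X in measurable X]setTI; apply: mZ => //; rewrite addr_ge0.
pose t' k := if (k <= n)%N then t k else t n + h.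
pose a' k := if (k <= n)%N then a k else c.
rewrite Ex_indI// Ex_ind// (_ : _ `&` _ `&` _ = A `&` passes Z n.+1 t' a'); last first.
  rewrite -setIA; congr (_ `&` _); apply/seteqP; split=> w /=.
    move=> [H1 H2] k; rewrite /t' /a' leq_eqVlt ltnS => /predU1P[->|kn].
      by rewrite ltnn.
    by rewrite kn; exact: H1.
  move=> H; split=> [k kn|].
    by have := H k (leqW kn); rewrite /t' /a' kn.
  by have := H n.+1 (leqnn _); rewrite /t' /a' ltnn.
have t'm k : t' k <= t' k.+1.
  rewrite /t'; case: (ltngtP k n) => [kn|nk|->].
  - exact: tm.
  - by [].
  - by rewrite lerDl.
have Ia' k : I (a' k) by rewrite /a'; case: ifP.
rewrite HP// HP// big_ord_recr/=.
have PA : P A \is a fin_num by exact: fin_num_measure.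
rewrite fineM// fineM//= -mulrA; congr (_ * _).
have -> : p (t' n.+1 - t' n) (a' n) (a' n.+1) = p h (a n) c.
  by rewrite /t' /a' ltnn leqnn [t n + h]addrC addrK.
congr (_ * _); apply: eq_bigr => k _.
by rewrite /t' /a' (ltn_ord k) (ltnW (ltn_ord k)).
Qed.

Section Step.
Variables (n : nat) (t a : nat -> R) (h : R).
Hypotheses (t0 : t 0%N = 0) (tm : forall k, t k <= t k.+1) (a0 : a 0%N = x).
Hypotheses (Ia : forall k, I (a k)) (h0 : 0 <= h).
Let C := A `&` passes Z n t a.
Let Z' := Z (t n + h).

Let mC : measurable C.
Proof.
apply: measurableI => //; apply: measurable_passes => k _; apply: mZ.
exact: mono_ge0.
Qed.

Let tnh : 0 <= t n + h. Proof. by rewrite addr_ge0//; exact: mono_ge0. Qed.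

Let mZ' B : measurable (Z' @^-1` B).
Proof.
apply: (@measurable_countable_preimage d T R I Z' B cI) => [w|c]; first exact: ZI.
by rewrite -[X in measurable X]setTI; exact: mZ.
Qed.

Let mfZ' (u : R -> R) : (forall c, `|u c| <= 1) -> bmeas (fun w => u (Z' w)).
Proof.
move=> u1; split; last by exists 1 => w.
by move=> _ B _; rewrite setTI -[_ @^-1` _]/(Z' @^-1` (u @^-1` B)); exact: mZ'.
Qed.

Let m0 : 0 <= Ex \1_C.
Proof. by apply: Ex_ge0 => w; have /andP[] := @indic_range T R C w. Qed.

Lemma chain_jump_le :
  Ex (fun w => \1_C w * \1_(Z' @^-1` [set~ a n]) w) <= b * h * Ex \1_C.
Proof.
have [p tp Hp] := chain_next.
have -> : Ex (fun w => \1_C w * \1_(Z' @^-1` [set~ a n]) w) =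
    Ex \1_C - Ex (fun w => \1_C w * \1_(Z' @^-1` [set a n]) w).
  rewrite -ExB; last 2 first.
  - exact: bmeas_ind.
  - by apply: bmeasM; exact: bmeas_ind.
  apply: eq_Ex => w; rewrite -preimage_setC !indicE in_setC.
  by case: (_ \in _); case: (_ \in _); rewrite ?mulr0 ?mul0r ?mulr1 ?subrr ?subr0.
rewrite Hp//; have := ler_wpM2l m0 (bounded_rates_stay tp bQ h0 (Ia n)).
by rewrite mulrBr mulr1 [b * h * _]mulrC.
Qed.

(** To first order in [h], only one jump of the generator matters: by
    [transition_jump_ge] every such jump has at least its nominal probability,
    while by [transition_stay] the total probability of leaving is at most the
    nominal one; the errors of the individual jumps therefore add up to at most
    the sum of the lower deficits. *)
Lemma chain_step (u : R -> R) : (forall c, `|u c| <= 1) ->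
  `|Ex (fun w => \1_C w * (u (Z' w) - (u (a n) + h * generator I Q Jl u (a n))))| <=
  8 * (size Jl)%:R * b ^+ 2 * h ^+ 2 * Ex \1_C.
Proof.
move=> u1; set y := a n; set m := Ex \1_C.
have [p tp Hp] := chain_next; have Iy : I y by exact: Ia.
pose Pj j := Ex (fun w => \1_C w * \1_(Z' @^-1` [set y + j]) w).
pose r j := jump_rate I Q y j.
pose k := m * (2 * b ^+ 2 * h ^+ 2).
have k0 : 0 <= k.
  by rewrite /k -mulrA mulr_ge0// mulr_ge0// mulr_ge0//; exact: sqr_ge0.
have Pj_ge j : j \in Jl -> m * (h * r j) - k <= Pj j.
  move=> jJ; rewrite /r /jump_rate; case: asboolP => Iyj.
    rewrite /Pj /Z' /C Hp// -/C -/m -mulrBr ler_wpM2l// mulrC.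
    have := transition_jump_ge tp bQ uJ J0 h0 (Ia n) jJ Iyj.
    by rewrite [_ * h]mulrC.
  rewrite mulr0 mulr0 sub0r; apply: (@le_trans _ _ 0).
    by rewrite oppr_le0.
  by apply: Ex_ge0 => w; rewrite mulr_ge0// indicE; case: (_ \in _).
have bC : bmeas (\1_C : T -> R) by exact: bmeas_ind.
have bZ' B : bmeas (\1_(Z' @^-1` B) : T -> R) by exact: bmeas_ind.
pose N := Ex (fun w => \1_C w * \1_(Z' @^-1` [set~ y]) w).
have N_le : N <= m * (h * \sum_(j <- Jl) r j).
  have -> : N = m - Ex (fun w => \1_C w * \1_(Z' @^-1` [set y]) w).
    rewrite -ExB//; last by apply: bmeasM.
    apply: eq_Ex => w; rewrite -preimage_setC !indicE in_setC.
    by case: (_ \in _); case: (_ \in _); rewrite ?mulr0 ?mul0r ?mulr1 ?subrr ?subr0.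
  rewrite Hp// -[X in X - _]mulr1 -mulrBr ler_wpM2l//.
  have := transition_stay tp h0 (Ia n).
  by have [_ -> _] := bQ (Ia n); rewrite opprK.
pose D w := \sum_(j <- Jl) (u (y + j) - u y) * \1_(Z' @^-1` [set y + j]) w.
pose S w : R := \sum_(j <- Jl) \1_(Z' @^-1` [set y + j]) w.
have bD : bmeas D by apply: bmeas_sum => j; exact: bmeasZ.
have bS : bmeas S by exact: bmeas_sum.
have bu : bmeas (fun w => u (Z' w)) by exact: mfZ'.
have ptw w : `|u (Z' w) - u y - D w| <= 2 * (\1_(Z' @^-1` [set~ y]) w - S w).
  have [Zy|Zy] := eqVneq (Z' w) y.
    have z0 j : j \in Jl -> \1_(Z' @^-1` [set y + j]) w = 0 :> R.
      move=> jJ; rewrite indicE memNset//= Zy -{1}[y]addr0 => /addrI j0.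
      by move: J0; rewrite j0 jJ.
    rewrite /D /S big_seq big1; last by move=> j /z0 ->; rewrite mulr0.
    rewrite big_seq big1; last by move=> j /z0.
    by rewrite Zy subrr subrr normr0 subr0 mulr_ge0// indicE.
  have -> : \1_(Z' @^-1` [set~ y]) w = 1 :> R by rewrite indicE mem_set//=; exact/eqP.
  have z0 j : Z' w != y + j -> \1_(Z' @^-1` [set y + j]) w = 0 :> R.
    by move=> Zj; rewrite indicE memNset//=; exact/eqP.
  have [jJ|jJ] := boolP (Z' w - y \in Jl).
    have E j : j != Z' w - y -> \1_(Z' @^-1` [set y + j]) w = 0 :> R.
      by move=> jZ; apply: z0; apply: contraNneq jZ => ->; rewrite addrC addKr.
    have E1 : \1_(Z' @^-1` [set y + (Z' w - y)]) w = 1 :> R.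
      by rewrite indicE mem_set//= addrC subrK.
    have -> : D w = u (Z' w) - u y.
      rewrite /D (bigD1_seq (Z' w - y))//= E1 mulr1 addrCA subrr addr0 big1 ?addr0//.
      by move=> j /E ->; rewrite mulr0.
    have -> : S w = 1.
      by rewrite /S (bigD1_seq (Z' w - y))//= E1 big1 ?addr0// => j /E.
    by rewrite !subrr normr0 mulr0.
  have E j : j \in Jl -> \1_(Z' @^-1` [set y + j]) w = 0 :> R.
    move=> j'; apply: z0; apply: contraNneq jJ => ->.
    by rewrite addrC addKr.
  rewrite /D /S big_seq big1; last by move=> j /E ->; rewrite mulr0.
  rewrite big_seq big1; last by move=> j /E.
  by rewrite !subr0; apply: le_trans (ler_normB _ _) _; have := u1 (Z' w); have := u1 y; lra.
have sumP : \sum_(j <- Jl) Pj j = Ex (fun w => \1_C w * S w).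
  rewrite /S -Ex_sum; last by move=> j; exact: bmeasM.
  by apply: eq_Ex => w; rewrite mulr_sumr.
have E1 : `|Ex (fun w => \1_C w * (u (Z' w) - u y - D w))| <= 2 * (N - \sum_(j <- Jl) Pj j).
  have bb : bmeas (fun w => \1_C w * (u (Z' w) - u y - D w)).
    by apply: bmeasM => //; apply: bmeasB => //; apply: bmeasB => //; exact: bmeas_cst.
  apply: le_trans (abs_Ex P bb) _.
  rewrite sumP -ExB; [|exact: bmeasM|exact: bmeasM].
  rewrite -ExZ; last by apply: bmeasB; exact: bmeasM.
  apply: le_Ex; first exact: bmeas_abs.
    by apply: bmeasZ; apply: bmeasB; exact: bmeasM.
  move=> w; rewrite normrM -mulrBr mulrCA ger0_norm; last by have /andP[] := @indic_range T R C w.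
  by rewrite ler_wpM2l//; have /andP[] := @indic_range T R C w.
have E2 : `|Ex (fun w => \1_C w * (D w - h * generator I Q Jl u y))| <=
    \sum_(j <- Jl) 2 * (Pj j - m * (h * r j) + 2 * k).
  have -> : Ex (fun w => \1_C w * (D w - h * generator I Q Jl u y)) =
      \sum_(j <- Jl) (u (y + j) - u y) * (Pj j - m * (h * r j)).
    under [RHS]eq_bigr => j _.
      rewrite -[m]/(Ex _) [Ex \1_C * _]mulrC -ExZ//= -ExB//; last 2 first.
      - exact: bmeasM.
      - exact: bmeasZ.
      rewrite -ExZ; last by apply: bmeasB; [exact: bmeasM|exact: bmeasZ].
      over.
    rewrite -Ex_sum; last first.
      by move=> j; apply: bmeasZ; apply: bmeasB; [exact: bmeasM|exact: bmeasZ].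
    apply: eq_Ex => w; rewrite /D /generator mulr_sumr -sumrB mulr_sumr.
    by apply: eq_bigr => j _; rewrite -/(r j); ring.
  apply: le_trans (ler_norm_sum _ _ _) _; rewrite big_seq [leRHS]big_seq.
  apply: ler_sum => j jJ; rewrite normrM ler_pM//.
    by apply: le_trans (ler_normB _ _) _; have := u1 (y + j); have := u1 y; lra.
  by have := Pj_ge j jJ; rewrite ler_norml => ?; apply/andP; split; lra.
have -> : Ex (fun w => \1_C w * (u (Z' w) - (u y + h * generator I Q Jl u y))) =
    Ex (fun w => \1_C w * (u (Z' w) - u y - D w)) +
    Ex (fun w => \1_C w * (D w - h * generator I Q Jl u y)).
  rewrite -ExD; last 2 first.
  - by apply: bmeasM => //; apply: bmeasB => //; apply: bmeasB => //; exact: bmeas_cst.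
  - by apply: bmeasM => //; apply: bmeasB => //; exact: bmeas_cst.
  by apply: eq_Ex => w; ring.
apply: le_trans (ler_normD _ _) _; apply: le_trans (lerD E1 E2) _.
rewrite -mulr_sumr -mulrDr big_split/= sumrB big_const_seq count_predT iter_addr addr0.
rewrite -!mulr_sumr in N_le *.
have -> : 8 * (size Jl)%:R * b ^+ 2 * h ^+ 2 * m = 2 * ((2 * k) *+ size Jl).
  by rewrite -mulr_natr /k; ring.
by rewrite ler_pM2l//; lra.
Qed.

End Step.
End Chain.

(** * Conditioning on countably many values, random times *)

Section ExpectationExtra.
Context {d : measure_display} {T : measurableType d} {R : realType}.
Variable P : probability T R.
Local Notation Ex f := (Rintegral P setT f).

Lemma Ex_ind_ae0 (N : set T) : measurable N -> Ex \1_N <= 0 -> {ae P, forall w, ~ N w}.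
Proof.
move=> mN; rewrite Ex_ind// => N0.
have PN : P N = 0%E.
  rewrite -[LHS]fineK ?fin_num_measure//; congr (_%:E).
  by apply/eqP; rewrite eq_le N0 fine_ge0.
by exists N; split=> // w /= /contrapT.
Qed.

Lemma bmeas_countable (I : set R) (V : T -> R) (phi : R -> R) (M : R) : countable I ->
  (forall w, I (V w)) -> measurable_fun setT V -> (forall c, `|phi c| <= M) ->
  bmeas (fun w => phi (V w)).
Proof.
move=> cI IV mV phiM; split; last by exists M => w.
move=> _ B _; rewrite setTI -[_ @^-1` _]/(V @^-1` (phi @^-1` B)).
apply: (@measurable_countable_preimage _ T R I V _ cI) => // a.
by rewrite -[X in measurable X]setTI; exact: mV.
Qed.

Lemma indic_setI (A B : set T) w : \1_(A `&` B) w = \1_A w * \1_B w :> R.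
Proof. by rewrite indicI. Qed.

Lemma indic_ge0 (A : set T) w : 0 <= \1_A w :> R.
Proof. by rewrite indicE ler0n. Qed.

Lemma indic_in (A : set T) w : A w -> \1_A w = 1 :> R.
Proof. by move=> Aw; rewrite indicE mem_set. Qed.

Lemma indic_notin (A : set T) w : ~ A w -> \1_A w = 0 :> R.
Proof. by move=> Aw; rewrite indicE memNset. Qed.

Lemma norm_indicM_le (A : set T) w (r M : R) : 0 <= M -> `|r| <= M -> `|\1_A w * r| <= M.
Proof.
move=> M0 rM; rewrite indicE; case: (_ \in _); rewrite ?mul1r// mul0r normr0.
exact: M0.
Qed.

End ExpectationExtra.

Section DisjointCells.
Context {d : measure_display} {T : measurableType d} {R : realType}.
Variable P : probability T R.
Local Notation Ex f := (Rintegral P setT f).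

(** The same as [le_Ex_partition] for cells that need only cover the points at
    which one of the integrands does not vanish. *)
Lemma le_Ex_disj (S : nat -> set T) (f g : T -> R) :
  (forall v, measurable (S v)) -> (forall u v w, S u w -> S v w -> u = v) ->
  (forall w, f w != 0 \/ g w != 0 -> exists v, S v w) ->
  bmeas f -> bmeas g ->
  (forall v, Ex (fun w => \1_(S v) w * f w) <= Ex (fun w => \1_(S v) w * g w)) ->
  Ex f <= Ex g.
Proof.
move=> mS dS cS bf bg fg.
pose V w := if pselect (exists v, S v w) is left H then (projT1 (cid H)).+1 else 0%N.
have VS v : V @^-1` [set v.+1] = S v.
  apply/seteqP; split=> w; rewrite /= /V; case: pselect => //.
    by move=> H [<-]; exact: projT2 (cid H).
    by move=> H Sv; congr _.+1; apply: (dS _ _ w) => //; exact: projT2 (cid H).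
  by move=> H Sv; case: H; exists v.
have V0 : V @^-1` [set 0%N] = ~` \bigcup_v S v.
  apply/seteqP; split=> w; rewrite /= /V; case: pselect => // H.
    by move=> _ [v _ Sv]; apply: H; exists v.
  by case: H => v Sv; case; exists v.
apply: (@le_Ex_partition _ _ _ P V) => //.
  case=> [|v]; last by rewrite VS.
  by rewrite V0; apply: measurableC; exact: bigcupT_measurable.
case=> [|v]; last by rewrite VS.
rewrite le_eqVlt; apply/orP; left; apply/eqP; apply: eq_Ex => w.
rewrite V0 indicE; case: (boolP (_ \in _)); rewrite ?mul0r// => /set_mem nS.
have z h : (h = f \/ h = g) -> h w = 0.
  move=> hfg; apply/eqP/negPn/negP => h0; apply: nS.
  have [|v Sv] := cS w; last by exists v.
  by case: hfg h0 => ->; [left|right].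
by rewrite (z f) ?(z g) //; [right|left].
Qed.

End DisjointCells.

Section DiscreteFunctionals.
Context {d : measure_display} {T : measurableType d} {R : realType}.
Variables (P : probability T R) (I : set R).
Hypothesis cI : countable I.
Local Notation Ex f := (Rintegral P setT f).

Lemma bmeas_seq (V : nat -> T -> R) m (Psi : seq R -> R) M :
  (forall k w, I (V k w)) -> (forall k, measurable_fun setT (V k)) ->
  (forall s, `|Psi s| <= M) -> bmeas (fun w => Psi [seq V k w | k <- iota 0 m]).
Proof.
move=> IV mV PsiM; split; last by exists M => w.
have [c cc] := elimT (countable_injP _) cI.
pose dec n := if pselect (exists x, I x /\ c x = n) is left H then projT1 (cid H) else 0.
have decK x : I x -> dec (c x) = x.
  move=> Ix; rewrite /dec; case: pselect => [H|]; last by case; exists x.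
  by case: (cid H) => y [/= Iy] /cc; rewrite !inE => ->.
pose code w : nat := pickle [seq c (V k w) | k <- iota 0 m].
pose G n := Psi (map dec (odflt [::] (unpickle n))).
rewrite (_ : (fun w => _) = G \o code); last first.
  apply/funext => w; rewrite -[RHS]/(G (code w)) /G /code pickleK /= -map_comp; congr Psi.
  by apply: eq_map => k /=; rewrite decK.
apply: measurable_nat_comp => v.
have mk k n : measurable [set w | c (V k w) = n].
  apply: (@measurable_code _ T R I c (V k)) => // a.
  by rewrite -[X in measurable X]setTI; exact: mV.
have empty : (forall w, code w <> v) -> measurable (code @^-1` [set v]).
  move=> nv; rewrite (_ : code @^-1` [set v] = set0)// -subset0 => w; exact: nv.
case E : (unpickle v : option (seq nat)) => [l|]; last first.
  by apply: empty => w cv; move: E; rewrite -cv /code pickleK.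
have [vl|vl] := eqVneq (pickle l) v; last first.
  apply: empty => w cv; move/eqP: vl; apply.
  by move: E; rewrite -cv /code pickleK => -[->].
have [sl|sl] := eqVneq (size l) m; last first.
  apply: empty => w cv; move/eqP: sl; apply.
  by move: E; rewrite -cv /code pickleK => -[<-]; rewrite size_map size_iota.
rewrite (_ : _ @^-1` _ = \bigcap_k if (k < m)%N then [set w | c (V k w) = nth 0%N l k] else setT).
  by apply: bigcapT_measurable => k; case: ifP.
apply/seteqP; split=> w.
  move=> cv; have {cv} : code w = v by [].
  rewrite -vl => /(pcan_inj pickleK) <- k _; case: ifP => // km /=.
  by rewrite (nth_map 0%N) ?size_iota// nth_iota.
move=> H; rewrite -[_ w]/(code w = v) -vl; congr pickle; apply: (@eq_from_nth _ 0%N).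
  by rewrite size_map size_iota.
move=> k; rewrite size_map size_iota => km; have := H k Logic.I; rewrite km /= => <-.
by rewrite (nth_map 0%N) ?size_iota// nth_iota.
Qed.

Lemma bmeas_pair (V W : T -> R) (phi : R -> R -> R) M :
  (forall w, I (V w)) -> (forall w, I (W w)) -> measurable_fun setT V -> measurable_fun setT W ->
  (forall x y, `|phi x y| <= M) -> bmeas (fun w => phi (V w) (W w)).
Proof.
move=> IV IW mV mW phiM.
apply: (@bmeas_seq (fun k => if k is 0%N then V else W) 2 (fun s => phi (nth 0 s 0) (nth 0 s 1)) M) => //.
- by case.
- by case.
Qed.

Lemma le_Ex_values (V : T -> R) (f h : T -> R) : (forall w, I (V w)) -> measurable_fun setT V ->
  bmeas f -> bmeas h ->
  (forall a, I a -> Ex (fun w => \1_(V @^-1` [set a]) w * f w) <=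
     Ex (fun w => \1_(V @^-1` [set a]) w * h w)) -> Ex f <= Ex h.
Proof.
move=> IV mV bf bh fh; have [c cc] := elimT (countable_injP _) cI.
have mVa a : measurable (V @^-1` [set a]) by rewrite -[X in measurable X]setTI; exact: mV.
apply: (@le_Ex_partition _ _ _ P (c \o V)) => // [v|v]; first exact: measurable_code cc IV mVa.
have [[a [Ia av]]|na] := pselect (exists a, I a /\ c a = v).
  rewrite (_ : (c \o V) @^-1` [set v] = V @^-1` [set a]); first exact: fh.
  apply/seteqP; split=> w /= => [|->//] cV.
  by apply: cc; rewrite ?inE// av.
rewrite (_ : (c \o V) @^-1` [set v] = set0); last first.
  by rewrite -subset0 => w /= cV; apply: na; exists (V w).
by rewrite le_eqVlt; apply/orP; left; apply/eqP/eq_Ex => w; rewrite !indicE !in_set0 !mul0r.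
Qed.

End DiscreteFunctionals.

Section MeshFloor.
Context {R : realType}.
Implicit Types (t : R) (r : nat).

Definition mesh r : R := r.+1%:R^-1.
Definition mesh_floor r t : R := (Num.truncn (r.+1%:R * t))%:R * mesh r.

Lemma mesh_gt0 r : 0 < mesh r. Proof. by rewrite invr_gt0. Qed.

Lemma meshK r : r.+1%:R * mesh r = 1. Proof. by rewrite divff. Qed.

Lemma mesh_floorP r t : 0 <= t -> mesh_floor r t <= t < mesh_floor r t + mesh r.
Proof.
move=> t0; have /andP[h1 h2] := @truncn_itv R _ (mulr_ge0 (ler0n _ r.+1) t0).
rewrite /mesh_floor -[X in _ + X]mul1r -mulrDl.
by rewrite ler_pdivrMr// ltr_pdivlMr// ![t * _]mulrC h1 natr1 h2.
Qed.

Lemma mesh_cvg0 : mesh r @[r --> \oo] --> 0.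
Proof. exact: cvg_harmonic. Qed.

Lemma mesh_lt (e : R) : 0 < e -> \forall r \near \oo, mesh r < e.
Proof.
move=> e0; have /cvgrPdist_lt /(_ _ e0) := mesh_cvg0.
by apply: filterS => r; rewrite sub0r normrN gtr0_norm// mesh_gt0.
Qed.

Lemma truncn_eqP r t m : 0 <= t -> (Num.truncn (r.+1%:R * t) = m) <->
  (m%:R * mesh r <= t < m.+1%:R * mesh r).
Proof.
move=> t0; have rt0 := mulr_ge0 (ler0n R r.+1) t0.
rewrite ler_pdivrMr// ltr_pdivlMr// ![t * _]mulrC; split=> [<-|H].
  exact: truncn_itv.
by apply/eqP; rewrite truncn_eq.
Qed.

End MeshFloor.

Section RandomTime.
Context {d : measure_display} {T : measurableType d} {R : realType}.
Implicit Types (W : R -> T -> R) (tau : T -> R).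

Lemma measurable_truncn tau r m : measurable_fun setT tau -> (forall w, 0 <= tau w) ->
  measurable [set w | Num.truncn (r.+1%:R * tau w) = m].
Proof.
move=> mt t0.
rewrite (_ : [set w | _] = tau @^-1` `[m%:R * mesh r, m.+1%:R * mesh r[).
  by rewrite -[X in measurable X]setTI; exact: mt.
by apply/seteqP; split=> w /=; rewrite in_itv/= => /truncn_eqP; exact.
Qed.

Lemma measurable_mesh_floor tau r : measurable_fun setT tau -> (forall w, 0 <= tau w) ->
  measurable_fun setT (fun w => mesh_floor r (tau w)).
Proof.
move=> mt t0; apply: (@measurable_nat_comp _ T R (fun w => Num.truncn (r.+1%:R * tau w))
  (fun m => m%:R * mesh r)) => m.
exact: measurable_truncn.
Qed.

(** A right-continuous process evaluated at a measurable time: approximate the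
    time from the right by times with countably many values. *)
Lemma measurable_random_time W tau : (forall s, 0 <= s -> measurable_fun setT (W s)) ->
  (forall w, cadlag (W ^~ w)) -> measurable_fun setT tau -> (forall w, 0 <= tau w) ->
  measurable_fun setT (fun w => W (tau w) w).
Proof.
move=> mW cW mt t0.
pose up r w := mesh_floor r (tau w) + mesh r.
apply: (@measurable_fun_cvg _ _ _ setT (fun r w => W (up r w) w)).
  move=> r _ B mB; rewrite setTI.
  pose S m := [set w | Num.truncn (r.+1%:R * tau w) = m].
  rewrite (_ : _ @^-1` B = \bigcup_m (S m `&` W (m%:R * mesh r + mesh r) @^-1` B)).
    apply: bigcupT_measurable => m; apply: measurableI; first exact: measurable_truncn.
    rewrite -[X in measurable X]setTI; apply: mW => //.
    have /ltW r0 := @mesh_gt0 R r.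
    by rewrite addr_ge0// mulr_ge0.
  apply/seteqP; split=> w /=; first by move=> Bw; exists (Num.truncn (r.+1%:R * tau w)).
  by move=> [m _ [<-]].
move=> w _; apply/cvgrPdist_lt => e e0.
have [n n0 Hn] := cadlag_right (cW w) (t0 w) e0.
apply: filterS (mesh_lt n0) => r rn; rewrite distrC; apply: Hn.
by have /andP[? ?] := mesh_floorP r (t0 w); rewrite /up; apply/andP; split; lra.
Qed.

End RandomTime.

(** * Changes of a Markov chain inside a time window *)

Section ChainWindow.
Context {d : measure_display} {T : measurableType d} {R : realType}.
Variables (P : probability T R) (I : set R) (Q : R -> R -> R) (Jl : seq R) (b : R).
Variables (A : set T) (x : R) (Z : R -> T -> R).
Hypotheses (mZ : forall t : R, 0 <= t -> measurable_fun setT (Z t)).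
Hypotheses (ZI : forall (t : R) w, 0 <= t -> I (Z t w)).
Hypotheses (mA : measurable A) (cI : countable I) (Ix : I x).
Hypothesis chainZ : markov_chain_on P A I Q x Z.
Hypotheses (bQ : bounded_rates I Q Jl b).
Local Notation Ex f := (Rintegral P setT f).

Lemma chain_starts : Ex (fun w => \1_A w * \1_(Z 0 @^-1` [set~ x]) w) = 0.
Proof.
have [p tp HP] := chainZ.
have m0 : measurable (Z 0 @^-1` [set x]).
  by rewrite -[X in measurable X]setTI; exact: mZ.
have := HP 0%N (fun=> 0) (fun=> x) erefl (fun=> lexx _) erefl (fun=> Ix).
rewrite big_ord0 mule1 => HA.
have -> : Ex (fun w => \1_A w * \1_(Z 0 @^-1` [set~ x]) w) =
    Ex \1_A - Ex (fun w => \1_A w * \1_(Z 0 @^-1` [set x]) w).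
  rewrite -ExB; last 2 first.
  - exact: bmeas_ind.
  - by apply: bmeasM; exact: bmeas_ind.
  apply: eq_Ex => w; rewrite -preimage_setC !indicE in_setC.
  by case: (_ \in _); case: (_ \in _); rewrite ?mulr0 ?mul0r ?mulr1 ?subrr ?subr0.
rewrite Ex_indI// Ex_ind// -HA; apply/eqP; rewrite subr_eq0; apply/eqP.
by congr (fine (P (_ `&` _))); apply/seteqP; split=> w //= /(_ 0%N); exact.
Qed.

Lemma chain_two_times (s h : R) : 0 <= s -> 0 <= h ->
  Ex (fun w => \1_A w * \1_[set w | Z s w != Z (s + h) w] w) <= b * h * Ex \1_A.
Proof.
move=> s0 h0; have [c cc] := elimT (countable_injP _) cI.
have mZs t y : 0 <= t -> measurable (Z t @^-1` [set y]).
  by move=> t0; rewrite -[X in measurable X]setTI; exact: mZ.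
have sh0 : 0 <= s + h by rewrite addr_ge0.
have mne : measurable [set w | Z s w != Z (s + h) w].
  rewrite (_ : [set w | _] = ~` [set w | Z s w == Z (s + h) w]); last first.
    by apply/seteqP; split=> w /= /negP.
  apply: measurableC; rewrite -[X in measurable X]setTI.
  by apply: measurable_fun_eqr => //; exact: mZ.
rewrite -ExZ; last exact: bmeas_ind.
apply: (@le_Ex_partition _ _ _ P (c \o Z s)).
- by move=> v; apply: measurable_code cc _ _ => [w|y]; [exact: ZI|exact: mZs].
- by apply: bmeasM; exact: bmeas_ind.
- by apply: bmeasZ; exact: bmeas_ind.
move=> v; have [[y [Iy yv]]|nv] := pselect (exists y, I y /\ c y = v); last first.
  have z w : \1_((c \o Z s) @^-1` [set v]) w = 0 :> R.
    by rewrite indicE memNset//= => cv; apply: nv; exists (Z s w); split=> //; exact: ZI.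
  by apply: le_Ex => [||w]; rewrite ?z ?mul0r//; split; [|by exists 0 => w; rewrite z !mul0r normr0| |by exists 0 => w; rewrite z !mul0r normr0];
    (under eq_fun do rewrite z mul0r); exact: measurable_cst.
have VE : (c \o Z s) @^-1` [set v] = Z s @^-1` [set y].
  apply/seteqP; split=> w /= => [cv|->//].
  by apply: cc; rewrite ?inE ?yv//; exact: ZI.
rewrite VE.
pose t k := if k is 0%N then 0 else s.
pose a k := if k is 0%N then x else y.
have tm k : t k <= t k.+1 by case: k => [|k] /=.
have Ia k : I (a k) by case: k.
have mp : measurable (A `&` passes Z 1 t a).
  by apply: measurableI => //; apply: measurable_passes => -[|k] _; exact: mZ.
have := @chain_jump_le _ _ _ P I Q Jl b A x Z mZ ZI mA cI chainZ bQ 1 t a h erefl tm erefl Ia h0.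
rewrite /= => H.
apply: (@le_trans _ _ (Ex (fun w => \1_A w * \1_(Z 0 @^-1` [set~ x]) w +
   \1_(A `&` passes Z 1 t a) w * \1_(Z (s + h) @^-1` [set~ y]) w))).
  apply: le_Ex.
  - by apply: bmeasM; [|apply: bmeasM]; apply: bmeas_ind => //; exact: mZs.
  - apply: bmeasD; apply: bmeasM; apply: bmeas_ind => //; rewrite -preimage_setC; apply: measurableC; exact: mZs.
  move=> w; rewrite !indicE.
  have [/set_mem wA|_] := boolP (w \in A); last first.
    by rewrite mul0r mulr0 mul0r add0r mulr_ge0.
  have [/set_mem/= wy|_] := boolP (w \in Z s @^-1` [set y]); last first.
    by rewrite mul0r addr_ge0// mulr_ge0.
  have [/set_mem/= wn|_] := boolP (w \in [set w | Z s w != Z (s + h) w]); last first.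
    by rewrite !mulr0 addr_ge0// mulr_ge0.
  have [Z0|Z0] := eqVneq (Z 0 w) x; last first.
    by rewrite [w \in _ @^-1` [set~ x]]mem_set//= ?mulr1 ?mul1r ?lerDl ?mulr_ge0//; exact/eqP.
  rewrite [w \in A `&` _]mem_set; last by split=> // -[|[|k]].
  rewrite [w \in _ @^-1` [set~ y]]mem_set; last by move=> /= E; move: wn; rewrite E wy eqxx.
  by rewrite !mul1r lerDr ler0n.
rewrite ExD ?chain_starts ?add0r; last 2 first.
- by apply: bmeasM; apply: bmeas_ind => //; rewrite -preimage_setC; apply: measurableC; exact: mZs.
- by apply: bmeasM; apply: bmeas_ind => //; rewrite -preimage_setC; apply: measurableC; exact: mZs.
apply: le_trans H _; rewrite -ExZ; last exact: bmeas_ind.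
have b0 : 0 <= b.
  have [r0 _ Sb] := bQ Ix; apply: le_trans Sb; rewrite big_seq; exact: sumr_ge0.
apply: le_Ex => [||w].
- by apply: bmeasZ; exact: bmeas_ind.
- by apply: bmeasM; [|apply: bmeasZ]; apply: bmeas_ind => //; exact: mZs.
rewrite mulrCA; apply: ler_wpM2l; first by rewrite mulr_ge0.
rewrite !indicE; have [/set_mem[wA wp]|] := boolP (w \in A `&` _); last by rewrite mulr_ge0.
by rewrite mem_set ?mem_set ?mulr1//; exact: (wp 1%N).
Qed.

Definition dyadic_pt (s s' : R) (m k : nat) : R := s + k%:R * ((s' - s) / 2 ^+ m).

(** Only dyadic times are inspected, to have a measurable event. *)
Definition varies_at (s s' : R) (m : nat) : set T :=
  [set w | exists k, (k <= 2 ^ m)%N /\ Z (dyadic_pt s s' m k) w <> Z s w].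

Definition varies (s s' : R) : set T := \bigcup_m varies_at s s' m.

Lemma dyadic_pt_ge (s s' : R) m k : s <= s' -> s <= dyadic_pt s s' m k.
Proof. by move=> ss'; rewrite lerDl mulr_ge0// divr_ge0// ?subr_ge0// exprn_ge0. Qed.

Lemma dyadic_ptS (s s' : R) m k : dyadic_pt s s' m k = dyadic_pt s s' m.+1 k.*2.
Proof.
rewrite /dyadic_pt -muln2 natrM exprS; congr (_ + _).
by field; rewrite expf_neq0.
Qed.

Lemma measurable_varies_at (s s' : R) m : 0 <= s -> s <= s' -> measurable (varies_at s s' m).
Proof.
move=> s0 ss'.
rewrite (_ : varies_at s s' m = \bigcup_k if (k <= 2 ^ m)%N then
    ~` [set w | Z (dyadic_pt s s' m k) w == Z s w] else set0).
  apply: bigcupT_measurable => k; case: ifP => // _; apply: measurableC.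
  rewrite -[X in measurable X]setTI; apply: measurable_fun_eqr => //; apply: mZ => //.
  exact: le_trans (dyadic_pt_ge _ _ ss').
apply/seteqP; split=> w /= [k]; first by move=> [km kZ]; exists k; rewrite // km; exact/negP/eqP.
by move=> _; case: ifP => // km /negP/eqP; exists k.
Qed.

Lemma measurable_varies (s s' : R) : 0 <= s -> s <= s' -> measurable (varies s s').
Proof. by move=> s0 ss'; apply: bigcupT_measurable => m; exact: measurable_varies_at. Qed.

Lemma varies_at_nd (s s' : R) m n : (m <= n)%N -> varies_at s s' m `<=` varies_at s s' n.
Proof.
move=> /subnK <-; elim: (n - m)%N => [|k IHk] // w /IHk [l [lk lZ]].
exists l.*2; rewrite addSn -dyadic_ptS; split=> //.
by rewrite expnS mul2n leq_double.
Qed.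

(** At each dyadic level the chain changes between two neighbouring points, with
    probability at most [b] times their distance; summing over the level gives
    a bound that does not depend on it. *)
Lemma chain_varies_le (s s' : R) : 0 <= s -> s <= s' ->
  Ex (fun w => \1_A w * \1_(varies s s') w) <= b * (s' - s) * Ex \1_A.
Proof.
move=> s0 ss'.
have bA : bmeas (\1_A : T -> R) by exact: bmeas_ind.
have bV m : bmeas (\1_(varies_at s s' m) : T -> R) by apply: bmeas_ind; exact: measurable_varies_at.
have c : Ex (fun w => \1_A w * \1_(varies_at s s' m) w) @[m --> \oo] -->
    Ex (fun w => \1_A w * \1_(varies s s') w).
  apply: (@Ex_cvg _ _ _ P _ _ 1).
  - by move=> m; exact: bmeasM.
  - by apply: bmeasM => //; apply: bmeas_ind; exact: measurable_varies.
  - move=> m w; rewrite normrM !indicE.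
    by case: (_ \in _); case: (_ \in _); rewrite ?normr0 ?normr1 ?mulr0 ?mul0r ?mulr1.
  apply: aeW => w; apply: cvg_near_cst.
  have [[n _ Vn]|nV] := pselect (varies s s' w).
    near=> m; congr (_ * _); rewrite !indicE mem_set ?mem_set//; first by exists n.
    apply: varies_at_nd Vn; near: m; exact: nbhs_infty_ge.
  near=> m; congr (_ * _); rewrite !indicE memNset ?memNset// => Vm; apply: nV.
  by exists m.
apply: (ler_cvg_to c (cvg_cst _)); apply: nearW => m.
have dS k : dyadic_pt s s' m k.+1 = dyadic_pt s s' m k + (s' - s) / 2 ^+ m.
  by rewrite /dyadic_pt -natr1; ring.
have h0 : 0 <= (s' - s) / 2 ^+ m by rewrite divr_ge0// ?subr_ge0// exprn_ge0.
have p0 k : 0 <= dyadic_pt s s' m k by exact: le_trans (dyadic_pt_ge _ _ ss').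
pose chg k : set T := [set w | Z (dyadic_pt s s' m k) w != Z (dyadic_pt s s' m k + (s' - s) / 2 ^+ m) w].
have bchg k : bmeas (\1_(chg k) : T -> R).
  apply: bmeas_ind; rewrite (_ : chg k = ~` [set w | Z (dyadic_pt s s' m k) w == Z (dyadic_pt s s' m k + (s' - s) / 2 ^+ m) w]).
    apply: measurableC; rewrite -[X in measurable X]setTI.
    by apply: measurable_fun_eqr => //; apply: mZ => //; rewrite addr_ge0.
  by apply/seteqP; split=> w /= /negP.
apply: (@le_trans _ _ (Ex (fun w => \sum_(k < 2 ^ m) \1_A w * \1_(chg k) w))).
  apply: le_Ex; first exact: bmeasM.
    by apply: bmeas_sum => k; exact: bmeasM.
  move=> w; rewrite -mulr_sumr ler_wpM2l//.
  have [[k [km kZ]]|nV] := pselect (varies_at s s' m w); last first.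
    by rewrite indicE memNset// sumr_ge0// => k _; rewrite indicE.
  rewrite indicE mem_set//; last by exists k.
  have [l lk lc] : exists2 l, (l < k)%N & chg l w.
    apply: contrapT => nl; apply: kZ.
    have : forall j, (j <= k)%N -> Z (dyadic_pt s s' m j) w = Z s w.
      elim=> [|j IHj] jk; first by rewrite /dyadic_pt mul0r addr0.
      rewrite -IHj ?(ltnW jk)// dS; apply/eqP/negPn/negP => ne; apply: nl.
      by exists j => //; rewrite /chg /= eq_sym.
    exact.
  have lm : (l < 2 ^ m)%N by exact: leq_trans km.
  rewrite (bigD1 (Ordinal lm))//= indicE mem_set// lerDl sumr_ge0//.
rewrite Ex_sum; last by move=> k; exact: bmeasM.
apply: (@le_trans _ _ (\sum_(k < 2 ^ m) b * ((s' - s) / 2 ^+ m) * Ex \1_A)).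
  by apply: ler_sum => k _; exact: chain_two_times.
rewrite sumr_const card_ord -[leLHS]mulr_natr natrX le_eqVlt; apply/orP; left; apply/eqP.
by field; rewrite expf_neq0.
Unshelve. all: by end_near. Qed.

Lemma varies_const (s s' : R) w : cadlag (Z ^~ w) -> 0 <= s -> s < s' -> ~ varies s s' w ->
  forall u, s <= u < s' -> Z u w = Z s w.
Proof.
move=> cZ s0 ss' nV u /andP[su us'].
apply: (cadlag_eq_right cZ); first exact: le_trans su.
move=> n n0; have [e [e0 en eu]] : exists e : R, [/\ 0 < e, e <= n & e <= s' - u].
  by exists (Num.min n (s' - u)); rewrite lt_min n0 subr_gt0 us' !ge_min !lexx orbT.
have sp : 0 < s' - s by rewrite subr_gt0.
have [m hm] : exists m, (s' - s) / 2 ^+ m < e.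
  exists (Num.truncn ((s' - s) / e)).
  rewrite ltr_pdivrMr ?exprn_gt0// mulrC -ltr_pdivrMr//.
  have /andP[_ h] := @truncn_itv R _ (ltW (divr_gt0 sp e0)).
  apply: lt_le_trans h _; rewrite -natrX ler_nat; exact: ltn_expl.
set h := _ / _ in hm; have h0 : 0 < h by rewrite divr_gt0// exprn_gt0.
have [k /andP[k1 k2]] : exists k : nat, k%:R * h <= u - s < k.+1%:R * h.
  by apply: grid_floor => //; rewrite subr_ge0.
have kS : k.+1%:R * h = k%:R * h + h by rewrite -natr1 mulrDl mul1r.
exists (dyadic_pt s s' m k.+1).
  by rewrite /dyadic_pt -/h; apply/andP; split; lra.
apply: contrapT => ne; apply: nV; exists m => //; exists k.+1; split=> //.
rewrite -(@ler_nat R) natrX; rewrite -(ler_pM2r h0).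
have -> : 2 ^+ m * h = s' - s by rewrite /h mulrC divfK// expf_neq0.
lra.
Qed.

End ChainWindow.

(** * Jump times of a path with finitely many values *)

Section JumpTimes.
Context {R : realType}.
Variables (E : set R) (y : R -> R) (g : nat -> \bar R).
Hypotheses (finE : finite_set E) (cy : cadlag y) (yE : forall t, 0 <= t -> E (y t)).
Hypothesis jg : jump_times y g.

Lemma jump_ge0 i : (0%:E <= g i)%E.
Proof.
have [g0 gS gy _ _] := jg; elim: i => [|i IHi]; first by rewrite g0.
have [gi|] := boolP (g i < +oo)%E; first exact: le_trans (ltW (gS _ gi)).
by rewrite -leNgt leye_eq => /eqP/gy ->; rewrite leey.
Qed.

Lemma jump_fineK i : (g i < +oo)%E -> (fine (g i))%:E = g i.
Proof.
by move=> gi; rewrite fineK// ge0_fin_numE// jump_ge0.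
Qed.

Lemma jump_fine_ge0 i : 0 <= fine (g i).
Proof. by apply: fine_ge0; exact: jump_ge0. Qed.

Lemma jump_leS i : (g i <= g i.+1)%E.
Proof.
have [g0 gS gy _ _] := jg.
have [gi|] := boolP (g i < +oo)%E; first exact: ltW (gS _ gi).
by rewrite -leNgt leye_eq => /eqP/gy ->; rewrite leey.
Qed.

Lemma jump_le i j : (i <= j)%N -> (g i <= g j)%E.
Proof.
move=> /subnK <-; elim: (j - i)%N => [|k IHk] //.
by rewrite addSn; exact: le_trans (jump_leS _).
Qed.

Lemma finite_separated (s : seq R) :
  exists2 e : R, 0 < e & forall u v, u \in s -> v \in s -> u != v -> e <= `|u - v|.
Proof.
pose l := [seq `|p.1 - p.2| | p <- [seq (u, v) | u <- s, v <- s]].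
have [e e0 He] : exists2 e : R, 0 < e & forall r, r \in l -> 0 < r -> e <= r.
  elim: l => [|r l [e e0 He]]; first by exists 1.
  have [r0|r0] := ltP 0 r.
    exists (Num.min e r); first by rewrite lt_min e0.
    move=> r'; rewrite inE => /predU1P[->|/He H] r'0; first by rewrite ge_min lexx orbT.
    by rewrite ge_min H.
  exists e => // r'; rewrite inE => /predU1P[->|/He //].
  by rewrite ltNge r0.
exists e => // u v us vs uv; apply: He; last by rewrite normr_gt0 subr_eq0.
apply/mapP; exists (u, v) => //; apply/allpairsP; by exists (u, v).
Qed.

(** Jump times accumulating at a finite time would contradict the existence of
    a left limit there, as the distinct values of [y] are separated. *)
Lemma jump_unbounded t : exists i, (t%:E < g i)%E.
Proof.
apply: contrapT => nt.
have gt i : (g i <= t%:E)%E by rewrite leNgt; apply/negP => H; apply: nt; exists i.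
have gfin i : (g i < +oo)%E by exact: le_lt_trans (gt i) (ltry _).
have [g0 gS gy gc gj] := jg.
pose c i := fine (g i).
have cS i : c i < c i.+1 by rewrite -lte_fin !jump_fineK//; exact: gS.
pose S := range c.
have supS : has_sup S.
  split; first by exists (c 0%N); exists 0%N.
  by exists t => _ [i _ <-]; rewrite -lee_fin jump_fineK.
have cs i : c i < sup S.
  by apply: lt_le_trans (cS i) _; apply: ub_le_sup; [exact: supS.2|exists i.+1].
have s0 : 0 < sup S by apply: le_lt_trans (cs 0%N); exact: jump_fine_ge0.
have [s Es] : exists s : seq R, E = [set` s] by apply/finite_seqP.
have [e e0 He] := finite_separated s.
have [n n0 Hn] := cadlag_left cy s0 e0.
have [_ [i _ <-] ni] := sup_adherent n0 supS.
have := Hn (c i) (c i.+1); rewrite ni cs/= => /(_ isT).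
rewrite cs (lt_trans ni (cS i))/= => /(_ isT); rewrite ltNge => /negP; apply.
have yin j : y (c j) \in s.
  by have : E (y (c j)) by [apply: yE; exact: jump_fine_ge0]; rewrite Es.
by apply: He => //; apply/eqP => /esym; exact: gj.
Qed.

Lemma jump_seg t : 0 <= t -> exists i, (g i <= t%:E)%E /\ (t%:E < g i.+1)%E.
Proof.
move=> t0; have ex := jump_unbounded t.
case: (ex_minnP ex) => -[|m] tm Hm; first by move: tm; have [-> _ _ _ _] := jg; rewrite lte_fin ltNge t0.
exists m; split=> //; rewrite leNgt; apply/negP => /Hm; by rewrite ltnn.
Qed.

Lemma jump_seg_uniq i j t : (g i <= t%:E)%E -> (t%:E < g i.+1)%E ->
  (g j <= t%:E)%E -> (t%:E < g j.+1)%E -> i = j.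
Proof.
move=> i1 i2 j1 j2; apply/eqP; rewrite eqn_leq; apply/andP; split.
  rewrite leqNgt; apply/negP => ji; have := jump_le ji.
  by rewrite leNgt (le_lt_trans i1).
rewrite leqNgt; apply/negP => ij; have := jump_le ij.
by rewrite leNgt (le_lt_trans j1).
Qed.

Lemma jump_const i s t : (g i <= s%:E)%E -> (s%:E < g i.+1)%E -> (g i <= t%:E)%E ->
  (t%:E < g i.+1)%E -> y s = y t.
Proof. by have [_ _ _ gc _] := jg => ? ? ? ?; rewrite (gc i s)// (gc i t). Qed.

Lemma jump_rat_between (u v : \bar R) : (0%:E <= u)%E -> (u < v)%E ->
  exists p : rat, (u <= (ratr p)%:E)%E /\ ((ratr p)%:E < v)%E.
Proof.
move=> u0 uv; have uf : u \is a fin_num by rewrite ge0_fin_numE// (lt_le_trans uv)// leey.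
rewrite -(fineK uf) in u0 uv *; case: v uv => [v| |] uv.
- have [|p] := @rat_in_itvoo R (fine u) v; first by rewrite -lte_fin.
  by rewrite in_itv/= => /andP[p1 p2]; exists p; rewrite lee_fin lte_fin p2 ltW.
- have [|p] := @rat_in_itvoo R (fine u) (fine u + 1); first by rewrite ltrDl.
  by rewrite in_itv/= => /andP[p1 p2]; exists p; rewrite lee_fin ltry ltW.
- by [].
Qed.

(** A jump before time [c] shows in the values of the path at two rational
    times: this is what makes the jump times functions of the path. *)
Lemma jumpS_lt (i : nat) (c : R) : (g i.+1 < c%:E)%E <->
  exists p r : rat, [/\ 0 <= ratr p :> R, ratr p < ratr r :> R, ratr r < c,
    (g i <= (ratr p)%:E)%E & y (ratr p) <> y (ratr r)].
Proof.
have [g0 gS gy gc gj] := jg; split=> [gc'|].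
  have gSi : (g i.+1 < +oo)%E by exact: lt_le_trans gc' (leey _).
  have gi : (g i < +oo)%E by exact: le_lt_trans (jump_leS i) gSi.
  have [p [p1 p2]] := jump_rat_between (jump_ge0 i) (gS _ gi).
  have [r [r1]] : exists r : rat, (g i.+1 <= (ratr r)%:E)%E /\ ((ratr r)%:E < mine c%:E (g i.+2))%E.
    by apply: jump_rat_between; rewrite ?jump_ge0// lt_min gc' gS.
  rewrite lt_min => /andP[r2 r3]; exists p, r; split=> //.
  - by rewrite -lee_fin; exact: le_trans (jump_ge0 i) p1.
  - by rewrite -lte_fin; exact: lt_le_trans p2 r1.
  - by rewrite (gc i _ p1 p2) (gc i.+1 _ r1 r3) => /esym; exact: gj.
move=> [p [r [p0 pr rc gp ne]]]; rewrite ltNge; apply/negP => cg; apply: ne.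
apply: (@jump_const i) => //.
- by apply: lt_le_trans cg; rewrite lte_fin (lt_trans pr).
- by apply: le_trans gp _; rewrite lee_fin ltW.
- by apply: lt_le_trans cg; rewrite lte_fin.
Qed.

End JumpTimes.

(** * Moves of a switching process, given its past *)

Section History.
Context {d : measure_display} {T : measurableType d} {R : realType}.
Variables (P : probability T R) (E I : set R) (q : R -> R -> R -> R) (Jl : seq R) (b x0 : R).
Variables (Y : R -> {RV P >-> R}) (X : R -> T -> R).
Variables (g : nat -> T -> \bar R) (Z : nat -> R -> {RV P >-> R}).
Hypotheses (cI : countable I) (finE : finite_set E).
Hypotheses (cadY : cadlag_process E Y).
Hypothesis jumpY : forall w, jump_times (Y ^~ w) (g ^~ w).
Hypothesis cadZ : forall i, cadlag_process I (Z i).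
Hypothesis XZ : forall i w t, (g i w <= t%:E)%E -> (t%:E < g i.+1 w)%E ->
  X t w = Z i (t - fine (g i w)) w.

Definition history_gen i : set (set T) :=
  [set A | exists t (B : set R), [/\ 0 <= t, measurable B & A = Y t @^-1` B \/
     exists k, (k < i)%N /\ A = Z k t @^-1` B]].

(** The history as a measurable space, so that being determined by the history
    is measurability of a function on [htype i]. *)
Definition htype i := g_sigma_algebraType (history_gen i).

Lemma history_measurable i (A : set T) : measurable (A : set (htype i)) -> measurable A.
Proof.
apply: smallest_sub; first exact: sigma_algebra_measurable.
move=> _ [t [B [t0 mB [->|[k [_ ->]]]]]]; rewrite -[X in measurable X]setTI.
  exact: measurable_funPT.
exact: measurable_funPT.
Qed.

Lemma history_le i j (A : set T) : (i <= j)%N -> measurable (A : set (htype i)) ->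
  measurable (A : set (htype j)).
Proof.
move=> ij; apply: sub_sigma_algebra2 => A' [t [B [t0 mB H]]]; exists t, B; split=> //.
case: H => [->|[k [ki ->]]]; [by left|right].
by exists k; rewrite (leq_trans ki).
Qed.

Lemma history_fun i (f : T -> R) : measurable_fun setT (f : htype i -> R) ->
  measurable_fun setT f.
Proof. by move=> mf _ B mB; apply: history_measurable; exact: mf. Qed.

Lemma history_Y i t : 0 <= t -> measurable_fun setT (Y t : htype i -> R).
Proof.
move=> t0 _ B mB; rewrite setTI; apply: sub_sigma_algebra.
by exists t, B; split=> //; left.
Qed.

Lemma history_Z i k t : (k < i)%N -> 0 <= t -> measurable_fun setT (Z k t : htype i -> R).
Proof.
move=> ki t0 _ B mB; rewrite setTI; apply: sub_sigma_algebra.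
by exists t, B; split=> //; right; exists k.
Qed.

Lemma history_g i k : measurable_fun setT (g k : htype i -> \bar R).
Proof.
elim: k => [|k IHk].
  apply: eq_measurable_fun (measurable_cst 0%:E) => w _.
  by have [->] := jumpY w.
apply: (measurability _ (@ErealGenInftyO.measurableE R)).
move=> _ [_ [c ->]] <-; rewrite setTI.
rewrite (_ : _ @^-1` _ = \bigcup_(p : rat) \bigcup_(r : rat)
   if [&& 0 <= ratr p :> R, ratr p < ratr r :> R & ratr r < c] then
     [set w : htype i | (g k w <= (ratr p)%:E)%E] `&`
       ~` [set w : htype i | Y (ratr p) w == Y (ratr r) w] else set0).
  apply: bigcupT_measurable_rat => p; apply: bigcupT_measurable_rat => r.
  case: ifPn => // /and3P[p0 pr _]; apply: measurableI.
    rewrite (_ : [set w | _] = g k @^-1` `]-oo, (ratr p)%:E]); last first.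
      by apply/seteqP; split=> w /=; rewrite in_itv.
    by rewrite -[X in measurable X]setTI; apply: IHk => //; exact: emeasurable_itv.
  apply: measurableC; rewrite -[X in measurable X]setTI.
  by apply: measurable_fun_eqr => //; apply: history_Y => //; rewrite (le_trans p0)// ltW.
apply/seteqP; split=> w /=; rewrite in_itv/=.
  move=> /(jumpS_lt (jumpY w)) [p [r [p0 pr rc gp ne]]].
  by exists p => //; exists r => //; rewrite p0 pr rc; split=> //; exact/negP/eqP.
move=> [p _ [r _]]; case: ifPn => // /and3P[p0 pr rc] [gp /negP/eqP ne].
by apply/(jumpS_lt (jumpY w)); exists p, r.
Qed.

Lemma history_g_le i k t : measurable ([set w | (g k w <= t%:E)%E] : set (htype i)).
Proof.
rewrite (_ : [set w | _] = g k @^-1` `]-oo, t%:E]); last first.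
  by apply/seteqP; split=> w /=; rewrite in_itv.
by rewrite -[X in measurable X]setTI; apply: history_g => //; exact: emeasurable_itv.
Qed.

Lemma history_g_gt i k t : measurable ([set w | (t%:E < g k w)%E] : set (htype i)).
Proof.
rewrite (_ : [set w | _] = ~` [set w | (g k w <= t%:E)%E]); last first.
  by apply/seteqP; split=> w /=; rewrite ltNge => /negP.
by apply: measurableC; exact: history_g_le.
Qed.

Lemma history_gy i k : measurable ([set w | (g k w < +oo)%E] : set (htype i)).
Proof.
rewrite (_ : [set w | _] = ~` (g k @^-1` [set +oo%E])); last first.
  by apply/seteqP; split=> w /=; rewrite ltey => /eqP.
apply: measurableC; rewrite -[X in measurable X]setTI; apply: history_g => //.
Qed.

Definition gtime k w : R := fine (g k w).

Lemma gtime_ge0 k w : 0 <= gtime k w.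
Proof. exact: jump_fine_ge0 (jumpY w) _. Qed.

Lemma gtimeE k w t : (g k w <= t%:E)%E -> (gtime k w)%:E = g k w.
Proof. by move=> gt; apply: (jump_fineK (jumpY w)); exact: le_lt_trans gt (ltry _). Qed.

Lemma gtime_le k w t : (g k w <= t%:E)%E -> gtime k w <= t.
Proof. by move=> gt; rewrite -lee_fin (gtimeE gt). Qed.

Lemma history_gtime i k : measurable_fun setT (gtime k : htype i -> R).
Proof. by apply: measurableT_comp => //; exact: history_g. Qed.

Definition stage i t : set T := [set w | (g i w <= t%:E)%E /\ (t%:E < g i.+1 w)%E].

Lemma history_stage i k t : measurable (stage k t : set (htype i)).
Proof. by apply: measurableI; [exact: history_g_le|exact: history_g_gt]. Qed.

Lemma stage_ex t w : 0 <= t -> exists i, stage i t w.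
Proof. exact: (jump_seg finE (cadY w).1 (cadY w).2 (jumpY w)). Qed.

Lemma stage_uniq i j t w : stage i t w -> stage j t w -> i = j.
Proof. by move=> [? ?] [? ?]; exact: (jump_seg_uniq (jumpY w) (t := t)). Qed.

Definition env k w : R := Y (gtime k w) w.

Lemma history_env i k : measurable_fun setT (env k : htype i -> R).
Proof.
apply: (@measurable_random_time _ (htype i) R (fun s w => Y s w)).
- exact: history_Y.
- by move=> w; exact: (cadY w).1.
- exact: history_gtime.
- by move=> w; exact: gtime_ge0.
Qed.

Lemma envE k w : E (env k w).
Proof. by have [_] := cadY w; apply; exact: gtime_ge0. Qed.

(** Truncated at [0], to evaluate the chain at its age before it starts too. *)
Definition age k (t : R) w : R := Num.max (t - gtime k w) 0.

Lemma age_ge0 k t w : 0 <= age k t w. Proof. by rewrite le_max lexx orbT. Qed.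

Lemma history_age i k t : measurable_fun setT (age k t : htype i -> R).
Proof.
apply: measurable_maxr; last exact: measurable_cst.
by apply: measurable_funB; [exact: measurable_cst|exact: history_gtime].
Qed.

Lemma history_Z_time i k (tau : htype i -> R) : (k < i)%N -> measurable_fun setT tau ->
  (forall w, 0 <= tau w) -> measurable_fun setT (fun w : htype i => Z k (tau w) w).
Proof.
move=> ki mt t0; apply: (@measurable_random_time _ (htype i) R (fun s w => Z k s w)) => //.
- by move=> s; exact: history_Z.
- by move=> w; exact: (cadZ k w).1.
Qed.

Lemma X_age k w t : stage k t w -> X t w = Z k (age k t w) w.
Proof.
move=> [g1 g2]; rewrite (XZ g1 g2) /age max_l// subr_ge0.
exact: gtime_le g1.
Qed.

Lemma X_in t w : 0 <= t -> I (X t w).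
Proof.
move=> t0; have [i si] := stage_ex w t0; rewrite (X_age si).
by have [_] := cadZ i w; apply; exact: age_ge0.
Qed.

Lemma history_X i t (a : R) : 0 <= t ->
  measurable ([set w | (t%:E < g i w)%E /\ X t w = a] : set (htype i)).
Proof.
move=> t0; rewrite (_ : [set w | _] = \bigcup_k if (k < i)%N then
    stage k t `&` ((fun w => Z k (age k t w) w) @^-1` [set a]) else set0).
  apply: bigcupT_measurable => k; case: ifPn => // ki; apply: measurableI.
    exact: history_stage.
  rewrite -[X in measurable X]setTI.
  apply: (@history_Z_time i k (age k t)) => //; first exact: history_age.
  by move=> w; exact: age_ge0.
apply/seteqP; split=> w /=.
  move=> [ti Xa]; have [k sk] := stage_ex w t0.
  exists k => //; rewrite ifT; first by split=> //=; rewrite -X_age.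
  rewrite ltnNge; apply/negP => ik; have := jump_le (jumpY w) ik.
  by rewrite leNgt (le_lt_trans sk.1).
move=> [k _]; case: ifPn => // ki [sk /= Za]; rewrite (X_age sk); split=> //.
by apply: lt_le_trans sk.2 _; exact: jump_le (jumpY w) _ _ ki.
Qed.

Lemma measurable_X t : 0 <= t -> measurable_fun setT (X t).
Proof.
move=> t0 _ B _; rewrite setTI.
apply: (@measurable_countable_preimage _ T R I (X t) B cI) => [w|a].
  exact: X_in.
rewrite (_ : _ @^-1` _ = \bigcup_i [set w | (t%:E < g i w)%E /\ X t w = a]).
  by apply: bigcupT_measurable => i; apply: (@history_measurable i); exact: history_X.
apply/seteqP; split=> w /=; last by move=> [i _ []].
by have [i si] := stage_ex w t0 => Xa; exists i.+1 => //; split=> //; exact: si.2.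
Qed.

Definition start i w : R := chain_start x0 g (fun k t => Z k t) i w.

Lemma start_in i w : I x0 -> (g i w < +oo)%E -> I (start i w).
Proof.
case: i => [|k] // _ gk; have [_] := cadZ k w; apply.
rewrite subr_ge0; apply: fine_le; rewrite ?ge0_fin_numE ?(jump_ge0 (jumpY w))//.
  exact: le_lt_trans (jump_leS (jumpY w) k) gk.
exact: jump_leS (jumpY w) k.
Qed.

Lemma history_start i (x : R) :
  measurable ([set w | (g i w < +oo)%E /\ start i w = x] : set (htype i)).
Proof.
case: i => [|k].
  have [<-|ne] := eqVneq x0 x.
    rewrite (_ : [set w | _] = [set w | (g 0%N w < +oo)%E]); first exact: history_gy.
    by apply/seteqP; split=> w //= [].
  rewrite (_ : [set w | _] = set0)// -subset0 => w [_ /=].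
  by rewrite /start /= => /eqP; rewrite (negbTE ne).
rewrite (_ : [set w | _] = [set w | (g k.+1 w < +oo)%E] `&`
   ((fun w => Z k (age k (gtime k.+1 w) w) w) @^-1` [set x])).
  apply: measurableI; first exact: history_gy.
  rewrite -[X in measurable X]setTI; apply: (@history_Z_time k.+1 k (fun w => age k (gtime k.+1 w) w)) => //.
  - apply: measurable_maxr; last exact: measurable_cst.
    by apply: measurable_funB; exact: history_gtime.
  - by move=> w; exact: age_ge0.
apply/seteqP; split=> w [/= gk]; rewrite /start /= /age max_l//; rewrite subr_ge0;
  apply: fine_le; rewrite ?ge0_fin_numE ?(jump_ge0 (jumpY w))//;
  do ?[exact: le_lt_trans (jump_leS (jumpY w) k) gk|exact: jump_leS (jumpY w) k].
Qed.

(** On the subsets of these events that belong to the history, the [i]-th chain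
    is a Markov chain with known rates and starting state. *)
Definition cell i (x y : R) : set T :=
  [set w | [/\ (g i w < +oo)%E, env i w = y & start i w = x]].

Lemma history_cell i x y : measurable (cell i x y : set (htype i)).
Proof.
rewrite (_ : cell i x y = [set w | (g i w < +oo)%E /\ start i w = x] `&` (env i @^-1` [set y])).
  apply: measurableI; first exact: history_start.
  by rewrite -[X in measurable X]setTI; exact: history_env.
by apply/seteqP; split=> w [] => [? ? ?|[? ?] ?]; do ?split.
Qed.

Hypotheses (Ix0 : I x0) (b0 : 0 <= b).
Hypothesis chainZ : forall i x y A, I x -> E y -> history Y (fun k t => Z k t) i A ->
  (forall w, A w -> [/\ (g i w < +oo)%E, Y (fine (g i w)) w = y &
     chain_start x0 g (fun k t => Z k t) i w = x]) ->
  markov_chain_on P A I (q y) x (Z i).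
Hypothesis bQ : forall y, E y -> bounded_rates I (q y) Jl b.
Hypotheses (uJ : uniq Jl) (J0 : 0 \notin Jl).
Local Notation Ex f := (Rintegral P setT f).

Lemma cell_chain i x y (A : set T) : I x -> E y -> measurable (A : set (htype i)) ->
  A `<=` cell i x y -> markov_chain_on P A I (q y) x (Z i).
Proof. by move=> Ix Ey mA sA; apply: chainZ => // w /sA []. Qed.

Lemma measurable_Z i t : measurable_fun setT (Z i t).
Proof. exact: measurable_funPT. Qed.

Lemma Z_in i t w : 0 <= t -> I (Z i t w).
Proof. by have [_] := cadZ i w; apply. Qed.

Lemma measurable_cell i x y : measurable (cell i x y).
Proof. by apply: (@history_measurable i); exact: history_cell. Qed.

(** Conditioning on the pair formed by the starting state and the environment of
    the [i]-th chain: it takes countably many values. *)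
Lemma le_Ex_cells i (A : set T) (f h : T -> R) : measurable A ->
  A `<=` [set w | (g i w < +oo)%E] -> bmeas f -> bmeas h ->
  (forall x y, I x -> E y ->
    Ex (fun w => \1_(A `&` cell i x y) w * f w) <=
    Ex (fun w => \1_(A `&` cell i x y) w * h w)) ->
  Ex (fun w => \1_A w * f w) <= Ex (fun w => \1_A w * h w).
Proof.
move=> mA Ag bf bh fh.
have [c cc] := elimT (countable_injP _) cI.
have [c' cc'] := elimT (countable_injP _) (finite_set_countable finE).
pose code (xy : R * R) : nat := pickle (c xy.1, c' xy.2).
pose ok v (xy : R * R) := [/\ I xy.1, E xy.2 & code xy = v].
pose S v := if pselect (exists xy, ok v xy) is left H then
  A `&` cell i (projT1 (cid H)).1 (projT1 (cid H)).2 else set0.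
have bA : bmeas (\1_A : T -> R) by exact: bmeas_ind.
apply: (@le_Ex_disj _ _ _ P S).
- move=> v; rewrite /S; case: pselect => // H; apply: measurableI => //.
  exact: measurable_cell.
- move=> u v w; rewrite /S; case: pselect => // H; case: pselect => // H'.
  case: (cid H) => -[x y] ok1; case: (cid H') => -[x' y'] ok2 /=.
  move: ok1 ok2 => [_ _ <-] [_ _ <-].
  by move=> [_ [_ <- <-]] [_ [_ <- <-]].
- move=> w nz; have wA : A w.
    by apply: contrapT => nA; case: nz; rewrite indic_notin// mul0r eqxx.
  have gw := Ag w wA.
  exists (code (start i w, env i w)); rewrite /S; case: pselect => [H|].
    split=> //; case: (cid H) => -[x y] [/= Ix Ey] /(pcan_inj pickleK) [e1 e2].
    split=> //.
      by apply: cc' => //; rewrite ?inE//; exact: envE.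
    by apply: cc => //; rewrite ?inE//; exact: start_in.
  by case; exists (start i w, env i w); split=> //; [exact: start_in|exact: envE].
- exact: bmeasM.
- exact: bmeasM.
move=> v; rewrite /S; case: pselect => H; last first.
  by apply: le_Ex => [||w]; [| |by rewrite indic_notin// !mul0r];
    apply: bmeasM; do ?exact: bmeasM; exact: bmeas_ind.
have [Ix Ey _] := projT2 (cid H); have := fh _ _ Ix Ey.
set C := A `&` _; have E' (u : T -> R) : (fun w => \1_C w * (\1_A w * u w)) = (fun w => \1_C w * u w).
  apply/funext => w; rewrite mulrA -indic_setI (_ : C `&` A = C)// /C.
  by rewrite setIAC setIid.
by rewrite !E'.
Qed.

(** On each cell [Z i] starts almost surely at the prescribed state, and there
    are countably many cells. *)
Lemma chain_start_ae i : {ae P, forall w, (g i w < +oo)%E -> Z i 0 w = start i w}.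
Proof.
pose G : set T := [set w | (g i w < +oo)%E].
have mG : measurable G by apply: (@history_measurable i); exact: history_gy.
have mst : measurable (\bigcup_(x in I) ([set w | (g i w < +oo)%E /\ start i w = x] `&` Z i 0 @^-1` [set x])).
  have [c cc] := elimT (countable_injP _) cI.
  rewrite (_ : \bigcup_(x in I) _ = \bigcup_n \bigcup_(x in [set x | I x /\ c x = n])
     ([set w | (g i w < +oo)%E /\ start i w = x] `&` Z i 0 @^-1` [set x])); last first.
    apply/seteqP; split=> w.
      by move=> [x Ix H]; exists (c x) => //; exists x.
    by move=> [n _ [x [Ix _] H]]; exists x.
  apply: bigcupT_measurable => n.
  have [[x [Ix xn]]|nx] := pselect (exists x, I x /\ c x = n); last first.
    rewrite (_ : [set x | _] = set0) ?bigcup_set0// -subset0 => x Hx.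
    by apply: nx; exists x.
  rewrite (_ : [set x | _] = [set x]); last first.
    apply/seteqP; split=> x' /= => [[Ix' x'n]|->//].
    by apply: cc; rewrite ?inE// xn.
  rewrite bigcup_set1; apply: measurableI.
    by apply: (@history_measurable i); exact: history_start.
  by rewrite -[X in measurable X]setTI; exact: measurable_Z.
set S := \bigcup_(x in I) _ in mst.
have SE w : G w -> S w <-> Z i 0 w = start i w.
  move=> Gw; split=> [[x _ [[_ <-] ->]] //|Zw].
  by exists (start i w); [exact: start_in|split].
have mN : measurable (G `&` ~` S) by apply: measurableI => //; exact: measurableC.
suff : Ex \1_(G `&` ~` S) <= 0.
  move=> /(Ex_ind_ae0 mN); apply: filterS => w nN Gw.
  by apply/(SE w Gw); apply: contrapT => nS; apply: nN.
have bS : bmeas (\1_(~` S) : T -> R) by apply: bmeas_ind; exact: measurableC.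
have -> : Ex \1_(G `&` ~` S) = Ex (fun w => \1_G w * \1_(~` S) w).
  by apply: eq_Ex => w; rewrite indic_setI.
apply: (@le_trans _ _ (Ex (fun w => \1_G w * 0))); last first.
  by under eq_Ex do rewrite mulr0; rewrite Ex_cst.
apply: (@le_Ex_cells i) => //; first exact: bmeas_cst.
move=> x y Ix Ey.
have mC : measurable (G `&` cell i x y) by apply: measurableI => //; exact: measurable_cell.
have hC : measurable (G `&` cell i x y : set (htype i)).
  by apply: measurableI; [exact: history_gy|exact: history_cell].
have cC := cell_chain Ix Ey hC (@subIsetr _ _ _).
have := @chain_starts _ _ _ P I (q y) _ x (Z i) (fun t _ => measurable_Z i t) mC Ix cC.
under [X in _ -> _ <= X]eq_Ex do rewrite mulr0.
rewrite Ex_cst => <-; apply: le_Ex.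
- by apply: bmeasM => //; exact: bmeas_ind.
- apply: bmeasM; apply: bmeas_ind => //; rewrite -preimage_setC; apply: measurableC.
  by rewrite -[X in measurable X]setTI; exact: measurable_Z.
move=> w; have [Cw|nC] := pselect ((G `&` cell i x y) w); last by rewrite indic_notin// !mul0r.
have [Gw [_ _ sw]] := Cw; rewrite (indic_in Cw) !mul1r.
have [Sw|nS] := pselect (S w); first by rewrite indic_notin ?indic_ge0//; apply/not_notP.
rewrite [leRHS]indic_in /=; last by move=> Zx; apply: nS; apply/(SE w Gw); rewrite Zx.
by rewrite indicE lern1 leq_b1.
Qed.

(** The jumps of a chain avoid every time that is determined by its history:
    knowing in which window of length [3 * mesh r] this time lies, the chain
    jumps in that window with probability at most [3 * b * mesh r]. *)
Lemma chain_near i (tau : T -> R) : measurable_fun setT (tau : htype i -> R) ->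
  (forall w, 0 <= tau w) ->
  {ae P, forall w, (g i w < +oo)%E -> exists2 e : R, 0 < e &
     forall s, 0 <= s -> `|s - tau w| < e -> Z i s w = Z i (tau w) w}.
Proof.
move=> mt t0.
pose S r m : set T := [set w | Num.truncn (r.+1%:R * tau w) = m].
pose lo r m : R := m.-1%:R * mesh r; pose hi r m : R := (m.+2)%:R * mesh r.
pose G : set T := [set w | (g i w < +oo)%E].
have mG : measurable G by apply: (@history_measurable i); exact: history_gy.
have hS r m : measurable (S r m : set (htype i)) by exact: (@measurable_truncn _ (htype i)).
have mS r m : measurable (S r m) by apply: (@history_measurable i); exact: hS.
have lo0 r m : 0 <= lo r m by rewrite mulr_ge0// ltW// mesh_gt0.
have lohi r m : lo r m <= hi r m.
  by rewrite ler_pM2r ?mesh_gt0// ler_nat; case: m => // m; rewrite /= !leqW.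
have mV r m : measurable (varies (Z i) (lo r m) (hi r m)).
  by apply: measurable_varies => // t _; exact: measurable_Z.
pose bad r := \bigcup_m (S r m `&` (G `&` varies (Z i) (lo r m) (hi r m))).
have mbad r : measurable (bad r).
  by apply: bigcupT_measurable => m; do 2 apply: measurableI => //.
have Sdisj r u v w : S r u w -> S r v w -> u = v by move=> <- <-.
have badP r : Ex \1_(bad r) <= b * (3 * mesh r).
  rewrite -(Ex_cst P (b * (3 * mesh r))).
  have bbad : bmeas (\1_(bad r) : T -> R) by exact: bmeas_ind.
  apply: (@le_Ex_disj _ _ _ P (S r) _ _ (mS r) (Sdisj r)) => //.
  - by move=> w _; exists (Num.truncn (r.+1%:R * tau w)).
  - exact: bmeas_cst.
  move=> m.
  have -> : Ex (fun w => \1_(S r m) w * \1_(bad r) w) =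
      Ex (fun w => \1_(S r m `&` G) w * \1_(varies (Z i) (lo r m) (hi r m)) w).
    apply: eq_Ex => w; rewrite -!indic_setI; congr (\1_ _ w); apply/seteqP; split=> {}w.
      move=> [Sw [m' _ [Sw' [Gw Vw]]]].
      have E' : m = m' by exact: (Sdisj r m m' w).
      by rewrite -E' in Vw; split; first split.
    by move=> [[Sw Gw] Vw]; split=> //; exists m.
  apply: (@le_trans _ _ (Ex (fun w => \1_(S r m `&` G) w * (b * (3 * mesh r))))).
    have mSG : measurable (S r m `&` G) by exact: measurableI.
    apply: (@le_Ex_cells i) => //.
    - exact: bmeas_ind.
    - exact: bmeas_cst.
    move=> x y Ix Ey.
    have mC : measurable (S r m `&` G `&` cell i x y) by apply: measurableI => //; exact: measurable_cell.
    have hC : measurable (S r m `&` G `&` cell i x y : set (htype i)).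
      by apply: measurableI; [apply: measurableI => //; exact: history_gy|exact: history_cell].
    have cC := cell_chain Ix Ey hC (@subIsetr _ _ _).
    apply: le_trans (chain_varies_le (fun t _ => measurable_Z i t) (Z_in i) mC cI Ix cC (bQ Ey) (lo0 r m) (lohi r m)) _.
    under [leRHS]eq_Ex do rewrite mulrC.
    rewrite ExZ; last exact: bmeas_ind.
    apply: ler_wpM2r; first by apply: Ex_ge0 => w; exact: indic_ge0.
    apply: ler_wpM2l => //; rewrite /hi /lo -mulrBl ler_pM2r ?mesh_gt0//.
    by rewrite lerBlDr -natrD ler_nat; case: m {mSG mC hC cC} => // m /=; rewrite addnC.
  apply: le_Ex.
  - by apply: bmeasM; [exact: bmeas_ind (measurableI _ _ _ _)|exact: bmeas_cst].
  - by apply: bmeasM; [exact: bmeas_ind|exact: bmeas_cst].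
  move=> w; apply: ler_wpM2r; first by rewrite !mulr_ge0// ltW// mesh_gt0.
  by rewrite indic_setI ler_piMr ?indic_ge0// indicE lern1 leq_b1.
pose N := \bigcap_r bad r.
have mN : measurable N by exact: bigcapT_measurable.
have N0 : Ex \1_N <= 0.
  have c : b * (3 * mesh r) @[r --> \oo] --> b * (3 * 0).
    by do 2 apply: cvgMl_tmp; exact: mesh_cvg0.
  rewrite !mulr0 in c.
  apply: (ler_cvg_to (cvg_cst (Ex \1_N)) c); apply: nearW => r.
  apply: le_trans (badP r); apply: le_Ex; [exact: bmeas_ind|exact: bmeas_ind|move=> w].
  have [Nw|nN] := pselect (N w); last by rewrite indic_notin// indic_ge0.
  by rewrite !indic_in//; exact: Nw.
have := Ex_ind_ae0 mN N0; apply: filterS => w nN Gw.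
have [r nb] : exists r, ~ bad r w.
  by apply: contrapT => H; apply: nN => r _; apply: contrapT => nb; apply: H; exists r.
pose m := Num.truncn (r.+1%:R * tau w).
have nV : ~ varies (Z i) (lo r m) (hi r m) w by move=> V; apply: nb; exists m.
have /andP[t1 t2] : m%:R * mesh r <= tau w < m.+1%:R * mesh r by apply/truncn_eqP.
have r0 := @mesh_gt0 R r.
have hiE : hi r m = m%:R * mesh r + 2 * mesh r by rewrite /hi -addn2 natrD mulrDl.
have loE : m%:R * mesh r - mesh r <= lo r m.
  rewrite /lo; case: (m) => [|m'] /=; first by rewrite !mul0r sub0r oppr_le0 ltW.
  by rewrite -natr1 mulrDl mul1r addrK.
have loE' s : 0 <= s -> m%:R * mesh r - mesh r <= s -> lo r m <= s.
  rewrite /lo; case: (m) => [|m'] /= s0; first by rewrite mul0r.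
  by rewrite -natr1 mulrDl mul1r addrK.
have mS1 : m.+1%:R * mesh r = m%:R * mesh r + mesh r :> R by rewrite -natr1 mulrDl mul1r.
have lohi' : lo r m < hi r m.
  have : lo r m <= tau w by apply: loE' => //; lra.
  lra.
have Zc := varies_const ((cadZ i w).1) (lo0 r m) lohi' nV.
exists (mesh r) => // s s0; rewrite ltr_norml => /andP[s1 s2].
rewrite !Zc//; apply/andP; split; do ?[by lra|by apply: loE' => //; lra].
Qed.

(** A one-step estimate for a chain in the environment [y] that has just been
    seen in the state [c], uniform in its past. It is stated for a general test
    function [phi] in order to be carried over to [X] once, in
    [switching_step], for all the functions needed. *)
Definition one_step_le (y h kap c : R) (phi : R -> R) : Prop :=
  forall i (A : set T) x n t a, measurable A -> I x -> markov_chain_on P A I (q y) x (Z i) ->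
    t 0%N = 0 -> (forall k, t k <= t k.+1) -> a 0%N = x -> (forall k, I (a k)) -> a n = c ->
    Ex (fun w => \1_(A `&` passes (Z i) n t a) w * phi (Z i (t n + h) w)) <=
    kap * Ex \1_(A `&` passes (Z i) n t a).

Lemma one_step_stay y h c : E y -> 0 <= h ->
  one_step_le y h (b * h) c (fun z => (z != c)%:R).
Proof.
move=> Ey h0 i A x n t a mA Ix chA t0 tm a0 Ia an.
have := chain_jump_le (fun t _ => measurable_Z i t) (Z_in i) mA cI chA (bQ Ey) n t0 tm a0 Ia h0.
apply: le_trans; rewrite le_eqVlt; apply/orP; left; apply/eqP; apply: eq_Ex => w.
congr (_ * _); apply/esym/indic_eq; rewrite an /=; split=> [/eqP //|/eqP].
exact.
Qed.

Lemma one_step_abs y h c u : E y -> 0 <= h -> (forall z, `|u z| <= 1) ->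
  let phi z := u z - (u c + h * generator I (q y) Jl u c) in
  let kap := 8 * (size Jl)%:R * b ^+ 2 * h ^+ 2 in
  one_step_le y h kap c phi /\ one_step_le y h kap c (fun z => - phi z).
Proof.
move=> Ey h0 u1 phi kap; split=> i A x n t a mA Ix chA t0 tm a0 Ia an;
  have := chain_step (fun t _ => measurable_Z i t) (Z_in i) mA cI chA (bQ Ey) uJ J0 n t0 tm a0 Ia h0 u1;
  rewrite an -/kap; apply: le_trans; first exact: ler_norm.
rewrite -normrN -[X in _ <= `|X|]mulN1r -ExZ; last first.
  apply: bmeasM.
    apply: bmeas_ind; apply: measurableI => //; apply: measurable_passes => k _.
    exact: measurable_Z.
  apply: bmeasB; last exact: bmeas_cst.
  have tn0 : 0 <= t n by exact: mono_ge0.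
  by apply: (bmeas_countable cI _ (measurable_Z i _) u1) => w; apply: Z_in; rewrite addr_ge0.
apply: le_trans (ler_norm _); rewrite le_eqVlt; apply/orP; left; apply/eqP.
by apply: eq_Ex => w; rewrite mulN1r mulrN.
Qed.

(** The age computed from a starting time rounded down to the mesh. *)
Definition age_r r i (t : R) w : R := Num.max (t - mesh_floor r (gtime i w)) 0.

Lemma age_r_ge0 r i t w : 0 <= age_r r i t w. Proof. by rewrite le_max lexx orbT. Qed.

Lemma age_r_near r i t w : `|age_r r i t w - age i t w| < mesh r.
Proof.
have /andP[h1 h2] := mesh_floorP r (gtime_ge0 i w); have h3 := @mesh_gt0 R r.
rewrite /age_r /age ltr_norml; apply/andP.
by case: (lerP (t - mesh_floor r (gtime i w)) 0) => ?;
  case: (lerP (t - gtime i w) 0) => ?; split; lra.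
Qed.

Lemma measurable_age i t : measurable_fun setT (age i t).
Proof. apply: (@history_fun i); exact: history_age. Qed.

Lemma measurable_age_r r i t : measurable_fun setT (age_r r i t).
Proof.
apply: measurable_maxr; last exact: measurable_cst.
apply: measurable_funB; first exact: measurable_cst.
apply: measurable_mesh_floor; last exact: gtime_ge0.
apply: (@history_fun i); exact: history_gtime.
Qed.

Lemma measurable_Z_time i (tau : T -> R) : measurable_fun setT tau -> (forall w, 0 <= tau w) ->
  measurable_fun setT (fun w => Z i (tau w) w).
Proof.
move=> mt t0; apply: (@measurable_random_time _ T R (fun s w => Z i s w)) => //.
by move=> w; exact: (cadZ i w).1.
Qed.

Let Zage i t w := Z i (age i t w) w.
Let Zage_r r i t w := Z i (age_r r i t w) w.

Lemma measurable_Zage i t : measurable_fun setT (Zage i t).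
Proof. by apply: measurable_Z_time; [exact: measurable_age|move=> w; exact: age_ge0]. Qed.

Lemma measurable_Zage_r r i t : measurable_fun setT (Zage_r r i t).
Proof. by apply: measurable_Z_time; [exact: measurable_age_r|move=> w; exact: age_r_ge0]. Qed.

(** The age of a chain is random, but it is determined by the environment: up to
    a rounding of the birth time it is constant on countably many events of the
    history, and [chain_near] makes the rounding harmless. *)
Lemma shifted_chain i x y (S : set T) n (t a : nat -> R) h phi kap M :
  I x -> E y -> measurable (S : set (htype i)) -> S `<=` cell i x y ->
  (forall k, t k <= t k.+1) -> (forall w, S w -> gtime i w <= t 0%N) ->
  (forall k, I (a k)) -> 0 <= h -> (forall z, `|phi z| <= M) ->
  one_step_le y h kap (a n) phi ->
  Ex (fun w => \1_(S `&` passes (Zage i) n t a) w * phi (Zage i (t n + h) w)) <=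
  kap * Ex \1_(S `&` passes (Zage i) n t a).
Proof.
move=> Ix Ey hS Scell tm St Ia h0 phiM step.
have mS : measurable S by exact: (@history_measurable i _ hS).
have M0 : 0 <= M by apply: le_trans (phiM 0).
have tmono k : t 0%N <= t k.
  by elim: k => // k IHk; exact: le_trans IHk (tm k).
have mP r : measurable (S `&` passes (Zage_r r i) n t a).
  by apply: measurableI => //; apply: measurable_passes => k _; exact: measurable_Zage_r.
have mPl : measurable (S `&` passes (Zage i) n t a).
  by apply: measurableI => //; apply: measurable_passes => k _; exact: measurable_Zage.
have bphi r : bmeas (fun w => phi (Zage_r r i (t n + h) w)).
  apply: (bmeas_countable cI _ (measurable_Zage_r _ _ _) phiM) => w.
  by apply: Z_in; exact: age_r_ge0.
have bphil : bmeas (fun w => phi (Zage i (t n + h) w)).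
  apply: (bmeas_countable cI _ (measurable_Zage _ _) phiM) => w.
  by apply: Z_in; exact: age_ge0.
have near_ae : {ae P, forall w, forall k, (g i w < +oo)%E -> exists2 e : R, 0 < e &
     forall s, 0 <= s -> `|s - age i (if (k <= n)%N then t k else t n + h) w| < e ->
     Z i s w = Zage i (if (k <= n)%N then t k else t n + h) w}.
  apply/ae_foralln => k; apply: chain_near; first exact: history_age.
  by move=> w; exact: age_ge0.
have level r : Ex (fun w => \1_(S `&` passes (Zage_r r i) n t a) w * phi (Zage_r r i (t n + h) w)) <=
  kap * Ex \1_(S `&` passes (Zage_r r i) n t a).
  rewrite -ExZ; last exact: bmeas_ind.
  pose U m : set T := [set w | Num.truncn (r.+1%:R * gtime i w) = m].
  have hU m : measurable (U m : set (htype i)).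
    by apply: (@measurable_truncn _ (htype i)); [exact: history_gtime|move=> w; exact: gtime_ge0].
  have mU m : measurable (U m) by apply: (@history_measurable i); exact: hU.
  apply: (@le_Ex_disj _ _ _ P U _ _ mU).
  - by move=> u v w; rewrite /U /= => <- <-.
  - by move=> w _; exists (Num.truncn (r.+1%:R * gtime i w)).
  - by apply: bmeasM => //; exact: bmeas_ind.
  - by apply: bmeasZ; exact: bmeas_ind.
  move=> m; pose c : R := m%:R * mesh r.
  pose t' k := if k is k'.+1 then Num.max (t k' - c) 0 else 0.
  pose a' k := if k is k'.+1 then a k' else x.
  have t'm k : t' k <= t' k.+1.
    case: k => [|k] /=; first by rewrite le_max lexx orbT.
    by rewrite ge_max !le_max lexx orbT andbT lerD2r tm.
  have Ia' k : I (a' k) by case: k.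
  have mSU : measurable (S `&` U m) by exact: measurableI.
  have hSU : measurable (S `&` U m : set (htype i)) by exact: measurableI.
  have SUcell : S `&` U m `<=` cell i x y by move=> w [/Scell].
  have chSU := cell_chain Ix Ey hSU SUcell.
  have := step i (S `&` U m) x n.+1 t' a' mSU Ix chSU erefl t'm erefl Ia' erefl.
  have eqset w : Z i 0 w = x -> S w -> U m w ->
      passes (Zage_r r i) n t a w <-> passes (Z i) n.+1 t' a' w.
    move=> Z0 Sw Uw; have Er k : age_r r i (t k) w = t' k.+1.
      by rewrite /age_r /mesh_floor; move: Uw; rewrite /U /= => ->.
    split=> H; first by case=> [|k] kn //=; rewrite -[X in Z i X]/(t' k.+1) -Er; exact: H.
    by move=> k kn; rewrite /Zage_r Er; exact: (H k.+1 kn).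
  have Eh w : S w -> U m w -> age_r r i (t n + h) w = t' n.+1 + h.
    move=> Sw Uw; rewrite /age_r /mesh_floor; move: (Uw); rewrite /U /= => ->; rewrite -/c.
    have cg : c <= t n.
      apply: le_trans (tmono n); apply: le_trans (St _ Sw).
      have /andP[+ _] := mesh_floorP r (gtime_ge0 i w).
      by rewrite /mesh_floor; move: Uw; rewrite /U /= => ->.
    by rewrite !max_l; [ring|rewrite subr_ge0|rewrite addrAC addr_ge0// subr_ge0].
  have mP' : measurable (S `&` U m `&` passes (Z i) n.+1 t' a').
    by apply: measurableI => //; apply: measurable_passes => k _; exact: measurable_Z.
  have ae1 : {ae P, forall w, \1_(U m) w * \1_(S `&` passes (Zage_r r i) n t a) w =
      \1_(S `&` U m `&` passes (Z i) n.+1 t' a') w :> R}.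
    apply: filterS (chain_start_ae i) => w Zs.
    rewrite !indic_setI [\1_S w * \1_(U m) w]mulrC -mulrA.
    have [Uw|nU] := pselect (U m w); last by rewrite indic_notin// !mul0r.
    have [Sw|nS] := pselect (S w); last by rewrite [\1_S w]indic_notin// !mul0r.
    congr (_ * (_ * _)); have [gw _ sw] := Scell w Sw.
    have {}eqset := eqset w (etrans (Zs gw) sw) Sw Uw.
    have [H|nH] := pselect (passes (Zage_r r i) n t a w).
      by rewrite !indic_in//; exact/eqset.
    by rewrite !indic_notin// => /eqset.
  have tn0 : 0 <= t' n.+1 + h by rewrite addr_ge0//= le_max lexx orbT.
  have bphi' : bmeas (fun w => phi (Z i (t' n.+1 + h) w)).
    by apply: (bmeas_countable cI _ (measurable_Z i _) phiM) => w; exact: Z_in.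
  rewrite -ExZ; last exact: bmeas_ind.
  congr (_ <= _); apply: ae_eq_Ex.
  - by apply: bmeasM => //; exact: bmeas_ind.
  - by apply: bmeasM => //; [|apply: bmeasM => //]; exact: bmeas_ind.
  - apply: filterS ae1 => w <-; rewrite mulrA.
    have [Uw|nU] := pselect (U m w); last by rewrite (indic_notin nU) !mul0r.
    have [Sw|nS] := pselect (S w); last by rewrite indic_setI (indic_notin nS) mul0r mulr0 !mul0r.
    by rewrite -(Eh w Sw Uw).
  - by apply: bmeasZ; exact: bmeas_ind.
  - by apply: bmeasM => //; [|apply: bmeasZ]; exact: bmeas_ind.
  - by apply: filterS ae1 => w <-; rewrite mulrCA.
have pass_ae : {ae P, forall w, \forall r \near \oo,
    \1_(S `&` passes (Zage_r r i) n t a) w = \1_(S `&` passes (Zage i) n t a) w :> R /\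
    (S w -> Zage_r r i (t n + h) w = Zage i (t n + h) w)}.
  apply: filterS near_ae => w H.
  have [Sw|nS] := pselect (S w); last first.
    by apply: nearW => r; split=> //; rewrite !indic_setI (indic_notin nS) !mul0r.
  have [gw _ _] := Scell w Sw.
  have close k : \forall r \near \oo,
     Zage_r r i (if (k <= n)%N then t k else t n + h) w =
     Zage i (if (k <= n)%N then t k else t n + h) w.
    have [e e0 He] := H k gw; apply: filterS (mesh_lt e0) => r re.
    by apply: He; [exact: age_r_ge0|exact: lt_trans (age_r_near _ _ _ _) re].
  have all_close : \forall r \near \oo, forall k, (k < n.+2)%N ->
     Zage_r r i (if (k <= n)%N then t k else t n + h) w =
     Zage i (if (k <= n)%N then t k else t n + h) w.
    elim: (n.+2) => [|l IHl]; first exact: nearW.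
    apply: filterS2 (close l) IHl => r h1 h2 k.
    by rewrite ltnS leq_eqVlt => /predU1P[-> //|]; exact: h2.
  apply: filterS all_close => r Hr; split; last first.
    by move=> _; have := Hr n.+1 (ltnSn _); rewrite ltnn.
  have E' k : (k <= n)%N -> Zage_r r i (t k) w = Zage i (t k) w.
    by move=> kn; have := Hr k; rewrite kn; apply; rewrite ltnS ltnW.
  rewrite !indic_setI; congr (_ * _).
  have [Hp|nHp] := pselect (passes (Zage i) n t a w).
    by rewrite !indic_in// => k kn; rewrite E'//; exact: Hp.
  by rewrite !indic_notin// => Hp; apply: nHp => k kn; rewrite -E'//; exact: Hp.
have c1 : Ex (fun w => \1_(S `&` passes (Zage_r r i) n t a) w * phi (Zage_r r i (t n + h) w))
    @[r --> \oo] --> Ex (fun w => \1_(S `&` passes (Zage i) n t a) w * phi (Zage i (t n + h) w)).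
  apply: (@Ex_cvg _ _ _ P _ _ M).
  - by move=> r; apply: bmeasM => //; exact: bmeas_ind.
  - by apply: bmeasM => //; exact: bmeas_ind.
  - by move=> r w; exact: norm_indicM_le.
  apply: filterS pass_ae => w Hw; apply: cvg_near_cst; apply: filterS Hw => r [-> HS].
  have [Sw|nS] := pselect (S w); first by rewrite HS.
  by rewrite !indic_setI (indic_notin nS) !mul0r.
have c2 : kap * Ex \1_(S `&` passes (Zage_r r i) n t a)
    @[r --> \oo] --> kap * Ex \1_(S `&` passes (Zage i) n t a).
  apply: cvgMl_tmp; apply: (@Ex_cvg _ _ _ P _ _ 1).
  - by move=> r; exact: bmeas_ind.
  - exact: bmeas_ind.
  - by move=> r w; rewrite ger0_norm ?indic_ge0// indicE lern1 leq_b1.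
  by apply: filterS pass_ae => w Hw; apply: cvg_near_cst; apply: filterS Hw => r [->].
by apply: (ler_cvg_to c1 c2); exact: nearW.
Qed.

(** The next move of the switching process, when the environment stays at [y]
    while the move is observed. The observations made before the start of the
    chain alive at time [t n] belong to the history of this chain; the later
    ones are observations of that chain alone, to which [shifted_chain]
    applies. *)
Lemma switching_step n (t a : nat -> R) h phi kap M y (B : set T) :
  (forall k, t k <= t k.+1) -> 0 <= t 0%N -> (forall k, I (a k)) -> 0 <= h ->
  (forall z, `|phi z| <= M) -> E y -> one_step_le y h kap (a n) phi ->
  measurable (B : set (htype 0)) ->
  (forall w, B w -> Y (t n) w = y /\
     exists i, (g i w <= (t n)%:E)%E /\ ((t n + h)%:E < g i.+1 w)%E) ->
  Ex (fun w => \1_(B `&` passes X n t a) w * phi (X (t n + h) w)) <=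
  kap * Ex \1_(B `&` passes X n t a).
Proof.
move=> tm t00 Ia h0 phiM Ey step hB HB.
have M0 : 0 <= M by apply: le_trans (phiM 0).
have tk0 k : 0 <= t k by elim: k => // k IHk; exact: le_trans IHk (tm k).
have mB : measurable B by exact: (@history_measurable 0 _ hB).
have mP : measurable (B `&` passes X n t a).
  by apply: measurableI => //; apply: measurable_passes => k _; exact: measurable_X.
have bphi : bmeas (fun w => phi (X (t n + h) w)).
  have tnh : 0 <= t n + h by rewrite addr_ge0.
  by apply: (bmeas_countable cI _ (measurable_X tnh) phiM) => w; exact: X_in.
have bP : bmeas (\1_(B `&` passes X n t a) : T -> R) by exact: bmeas_ind.
have bf : bmeas (fun w => \1_(B `&` passes X n t a) w * phi (X (t n + h) w)) by exact: bmeasM.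
rewrite -ExZ//; have bh := bmeasZ kap bP.
have stage0 i : measurable (stage i (t n)).
  by apply: (@history_measurable 0); exact: history_stage.
have nz w : \1_(B `&` passes X n t a) w * phi (X (t n + h) w) != 0 \/
    kap * \1_(B `&` passes X n t a) w != 0 -> (B `&` passes X n t a) w.
  by move=> H; apply: contrapT => nP; case: H; rewrite (indic_notin nP) ?mul0r ?mulr0 eqxx.
apply: (@le_Ex_disj _ _ _ P (fun i => stage i (t n)) _ _ stage0) => //.
- by move=> u v w; exact: stage_uniq.
- by move=> w _; exact: stage_ex.
move=> i.
(* on [pre k], [k] is the first observation made after the start of chain [i] *)
pose pre k : set T := [set w | (k <= n)%N /\ ((forall l, (l < k)%N -> ((t l)%:E < g i w)%E /\ X (t l) w = a l) /\
  (g i w <= (t k)%:E)%E)].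
have hpre k : measurable (pre k : set (htype i)).
  rewrite /pre; case: (leqP k n) => kn; last first.
    by rewrite (_ : [set w | _] = set0)// -subset0 => w [].
  rewrite (_ : [set w | _] = (\bigcap_l if (l < k)%N then [set w | ((t l)%:E < g i w)%E /\ X (t l) w = a l] else setT)
      `&` [set w | (g i w <= (t k)%:E)%E]).
    apply: measurableI; last exact: history_g_le.
    apply: bigcapT_measurable => l; case: ifP => _; last exact: measurableT.
    exact: history_X.
  apply/seteqP; split=> w /=.
    by move=> [_ [H ?]]; split=> // l _; case: ifP => // /H.
  by move=> [H ?]; split=> //; split=> // l lk; have := H l Logic.I; rewrite lk.
have mpre k : measurable (pre k) by exact: (@history_measurable i _ (hpre k)).
have bst : bmeas (\1_(stage i (t n)) : T -> R) by exact: bmeas_ind.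
apply: (@le_Ex_disj _ _ _ P pre _ _ mpre).
- move=> u v w [_ [H1 H2]] [_ [H3 H4]].
  apply/eqP; rewrite eqn_leq; apply/andP; split; rewrite leqNgt; apply/negP.
    by move=> /H1 []; rewrite ltNge H4.
  by move=> /H3 []; rewrite ltNge H2.
- move=> w H.
  have [sw [Bw Pw]] : stage i (t n) w /\ (B `&` passes X n t a) w.
    split; last by apply: nz; case: H => H; [left|right]; apply: contraNneq H => ->; rewrite mulr0.
    by apply: contrapT => ns; case: H; rewrite (indic_notin ns) mul0r eqxx.
  have ex : exists k, (g i w <= (t k)%:E)%E by exists n; exact: sw.1.
  case: (ex_minnP ex) => k gk mink; exists k; split; first by apply: mink; exact: sw.1.
  split=> // l lk; split; last by apply: Pw; apply: leq_trans (ltnW lk) _; apply: mink; exact: sw.1.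
  by rewrite ltNge; apply/negP => /mink; rewrite leqNgt lk.
- exact: bmeasM.
- exact: bmeasM.
move=> k.
have [kn|nk] := leqP k n; last first.
  have p0 w : \1_(pre k) w = 0 :> R by apply: indic_notin => -[]; rewrite leqNgt nk.
  by apply: le_Ex => [||w]; [| |by rewrite p0 !mul0r]; (apply: bmeasM; [exact: bmeas_ind|exact: bmeasM]).
pose A : set T := B `&` stage i (t n) `&` pre k.
have hA : measurable (A : set (htype i)).
  apply: measurableI => //; apply: measurableI; last exact: history_stage.
  exact: (history_le (leq0n i) hB).
have mA : measurable A by exact: (@history_measurable i _ hA).
have Ag : A `<=` [set w | (g i w < +oo)%E].
  by move=> w [[_ [H _]] _] /=; exact: le_lt_trans H (ltry _).
pose t' l := t (k + l)%N; pose a' l := a (k + l)%N.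
have t'n : t' (n - k)%N = t n by rewrite /t' subnKC.
have a'n : a' (n - k)%N = a n by rewrite /a' subnKC.
have mP' : measurable (passes (Zage i) (n - k) t' a').
  by apply: measurable_passes => l _; exact: measurable_Zage.
have bphil : bmeas (fun w => phi (Zage i (t n + h) w)).
  apply: (bmeas_countable cI _ (measurable_Zage _ _) phiM) => w.
  by apply: Z_in; exact: age_ge0.
have stg w l : A w -> (k <= l)%N -> (l <= n)%N -> stage i (t l) w.
  move=> [[_ [_ s2]] [_ [_ gk]]] kl ln.
  have mono u v : (u <= v)%N -> t u <= t v.
    by move=> /subnK <-; elim: (v - u)%N => // m IHm; rewrite addSn; exact: le_trans (tm _).
  split; first by apply: le_trans gk _; rewrite lee_fin mono.
  by apply: le_lt_trans s2; rewrite lee_fin mono.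
have passE w : A w -> passes X n t a w <-> passes (Zage i) (n - k) t' a' w.
  move=> Aw; split=> H l ln.
    have kln : (k + l <= n)%N by rewrite -(subnKC kn) leq_add2l.
    rewrite /Zage /t' -X_age; first exact: H.
    by apply: stg => //; exact: leq_addr.
  have [lk|kl] := ltnP l k; first by have [_ [_ [/(_ l lk) []]]] := Aw.
  rewrite (X_age (stg _ _ Aw kl ln)); have := H (l - k)%N.
  by rewrite /t' /a' subnKC//; apply; exact: leq_sub2r.
have lastE w : A w -> X (t n + h) w = Zage i (t n + h) w.
  move=> Aw; apply: X_age; have [[Bw sw] _] := Aw.
  have [_ [j [j1 j2]]] := HB w Bw.
  have -> : i = j.
    apply: (stage_uniq sw); split=> //; apply: le_lt_trans j2.
    by rewrite lee_fin lerDl.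
  by split=> //; apply: le_trans j1 _; rewrite lee_fin lerDl.
have -> : Ex (fun w => \1_(pre k) w * (\1_(stage i (t n)) w * (\1_(B `&` passes X n t a) w * phi (X (t n + h) w)))) =
    Ex (fun w => \1_A w * (\1_(passes (Zage i) (n - k) t' a') w * phi (Zage i (t n + h) w))).
  apply: eq_Ex => w; have [Aw|nA] := pselect (A w).
    rewrite -(lastE w Aw) !mulrA; congr (_ * _); rewrite -!indic_setI.
    have [H|nH] := pselect (passes X n t a w).
      rewrite [LHS]indic_in; last by have [[? ?] ?] := Aw.
      by rewrite [RHS]indic_in//; split=> //; exact/(passE w Aw).
    rewrite [LHS]indic_notin; last by move=> [_ []].
    by rewrite [RHS]indic_notin// => -[_ /(passE w Aw)].
  rewrite (indic_notin nA) mul0r !mulrA; apply/eqP; rewrite mulf_eq0; apply/orP; left; apply/eqP.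
  by rewrite -!indic_setI indic_notin// => -[[? ?] [? _]]; apply: nA.
have -> : Ex (fun w => \1_(pre k) w * (\1_(stage i (t n)) w * (kap * \1_(B `&` passes X n t a) w))) =
    Ex (fun w => \1_A w * (kap * \1_(passes (Zage i) (n - k) t' a') w)).
  apply: eq_Ex => w; have [Aw|nA] := pselect (A w).
    transitivity (kap * (\1_(pre k) w * (\1_(stage i (t n)) w * \1_(B `&` passes X n t a) w))).
      by ring.
    transitivity (kap * (\1_A w * \1_(passes (Zage i) (n - k) t' a') w)); last by ring.
    congr (kap * _); rewrite -!indic_setI.
    have [H|nH] := pselect (passes X n t a w).
      rewrite [LHS]indic_in; last by have [[? ?] ?] := Aw.
      by rewrite [RHS]indic_in//; split=> //; exact/(passE w Aw).
    rewrite [LHS]indic_notin; last by move=> [? [? []]].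
    by rewrite [RHS]indic_notin// => -[_ /(passE w Aw)].
  transitivity (kap * (\1_(pre k) w * (\1_(stage i (t n)) w * \1_(B `&` passes X n t a) w))).
    by ring.
  rewrite (indic_notin nA) mul0r; apply/eqP; rewrite mulf_eq0; apply/orP; right; apply/eqP.
  by rewrite -!indic_setI indic_notin// => -[? [? [? _]]]; apply: nA.
have bP' : bmeas (\1_(passes (Zage i) (n - k) t' a') : T -> R) by exact: bmeas_ind.
apply: (le_Ex_cells mA Ag); [exact: bmeasM|exact: bmeasZ|].
move=> x y' Ix Ey'.
have mC : measurable (A `&` cell i x y') by apply: measurableI => //; exact: measurable_cell.
have hC : measurable (A `&` cell i x y' : set (htype i)) by apply: measurableI => //; exact: history_cell.
have [yy|yy] := eqVneq y' y; last first.
  have A0 w : \1_(A `&` cell i x y') w = 0 :> R.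
    apply: indic_notin => -[[[Bw sw] _] [_ ey _]]; move/eqP: yy; apply.
    have [<- _] := HB w Bw; rewrite -ey /env; apply/esym.
    have [_ _ _ gc _] := jumpY w; exact: (gc i _ sw.1 sw.2).
  by apply: le_Ex => [||w]; [| |by rewrite A0 !mul0r]; (apply: bmeasM; [exact: bmeas_ind|]);
    [exact: bmeasM|exact: bmeasZ].
rewrite yy in mC hC *.
have sC : A `&` cell i x y `<=` cell i x y by exact: subIsetr.
have t'm l : t' l <= t' l.+1 by rewrite /t' addnS.
have St w : (A `&` cell i x y) w -> gtime i w <= t' 0%N.
  by move=> [[_ [_ [_ gk]]] _]; rewrite /t' addn0; exact: gtime_le gk.
have := @shifted_chain i x y _ (n - k)%N t' a' h phi kap M Ix Ey hC sC t'm St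
  (fun l => Ia _) h0 phiM.
rewrite a'n t'n => /(_ step).
rewrite -ExZ; last by apply: bmeas_ind; exact: measurableI.
congr (_ <= _); apply: eq_Ex => w; first by rewrite indic_setI mulrA.
by rewrite indic_setI mulrCA.
Qed.

Definition steady (s s' : R) : set T :=
  [set w | exists i, (g i w <= s%:E)%E /\ (s'%:E < g i.+1 w)%E].

Lemma history_steady i s s' : measurable (steady s s' : set (htype i)).
Proof.
rewrite (_ : steady s s' = \bigcup_k ([set w | (g k w <= s%:E)%E] `&` [set w | (s'%:E < g k.+1 w)%E])).
  by apply: bigcupT_measurable => k; apply: measurableI; [exact: history_g_le|exact: history_g_gt].
by apply/seteqP; split=> w [k]; [exists k|move=> _; exists k].
Qed.

Lemma measurable_steady s s' : measurable (steady s s').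
Proof. by apply: (@history_measurable 0); exact: history_steady. Qed.

Lemma not_steady (s s' : R) w : 0 <= s -> ~ steady s s' w ->
  exists j, (s%:E < g j.+1 w)%E /\ (g j.+1 w <= s'%:E)%E.
Proof.
move=> s0 ns; have [i [i1 i2]] := stage_ex w s0; exists i; split=> //.
by rewrite leNgt; apply/negP => H; apply: ns; exists i.
Qed.

Lemma bmeas_X2 (phi : R -> R -> R) M s s' : 0 <= s -> 0 <= s' ->
  (forall x z, `|phi x z| <= M) -> bmeas (fun w => phi (X s w) (X s' w)).
Proof.
move=> s0 s'0 phiM; apply: (bmeas_pair cI _ _ _ _ phiM) => [w|w||].
- exact: X_in.
- exact: X_in.
- exact: measurable_X.
- exact: measurable_X.
Qed.

Lemma measurable_atom n (t a : nat -> R) (B : set T) : (forall k, 0 <= t k) ->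
  measurable B -> measurable (B `&` passes X n t a).
Proof.
by move=> t0 mB; apply: measurableI => //; apply: measurable_passes => k _; exact: measurable_X.
Qed.

Section Substep.
Variables (n : nat) (t a : nat -> R) (B : set T) (s del : R).
Hypotheses (tm : forall k, t k <= t k.+1) (t00 : 0 <= t 0%N) (Ia : forall k, I (a k)).
Hypotheses (hB : measurable (B : set (htype 0))) (ts : t n <= s) (del0 : 0 <= del).
Let A := B `&` passes X n t a.

Let tk0 k : 0 <= t k. Proof. by elim: k => // k IHk; exact: le_trans IHk (tm k). Qed.
Let s0 : 0 <= s. Proof. exact: le_trans ts. Qed.
Let sd0 : 0 <= s + del. Proof. by rewrite addr_ge0. Qed.
Let mB : measurable B. Proof. exact: (@history_measurable 0 _ hB). Qed.
Let mA : measurable A. Proof. exact: measurable_atom. Qed.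

(** The state at time [s] is added to the observed past, and [switching_step] is
    summed over its values. *)
Lemma substep (phi : R -> R -> R) kap y M :
  (forall x z, `|phi x z| <= M) -> E y ->
  (forall c, I c -> one_step_le y del kap c (phi c)) ->
  Ex (fun w => \1_(Y s @^-1` [set y]) w * (\1_A w * (\1_(steady s (s + del)) w * phi (X s w) (X (s + del) w)))) <=
  Ex (fun w => \1_(Y s @^-1` [set y]) w * (kap * (\1_A w * \1_(steady s (s + del)) w))).
Proof.
move=> phiM Ey step.
have mYs : measurable (Y s @^-1` [set y]) by rewrite -[X in measurable X]setTI; exact: measurable_funPT.
have bYs : bmeas (\1_(Y s @^-1` [set y]) : T -> R) by exact: bmeas_ind.
have bA : bmeas (\1_A : T -> R) by exact: bmeas_ind.
have bSt : bmeas (\1_(steady s (s + del)) : T -> R) by apply: bmeas_ind; exact: measurable_steady.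
have bph : bmeas (fun w => phi (X s w) (X (s + del) w)) by exact: bmeas_X2 phiM.
apply: (le_Ex_values cI (V := X s)) => //.
- by move=> w; exact: X_in.
- exact: measurable_X.
- by do 3 apply: bmeasM => //.
- by apply: bmeasM => //; apply: bmeasZ; exact: bmeasM.
move=> c Ic.
pose t' l := if (l <= n)%N then t l else s; pose a' l := if (l <= n)%N then a l else c.
have t'm k : t' k <= t' k.+1.
  rewrite /t'; case: (ltngtP k n) => [kn|nk|->] //.
have Ia' k : I (a' k) by rewrite /a'; case: ifP.
have t'n : t' n.+1 = s by rewrite /t' ltnn.
have a'n : a' n.+1 = c by rewrite /a' ltnn.
pose B' := B `&` steady s (s + del) `&` Y s @^-1` [set y].
have hB' : measurable (B' : set (htype 0)).
  apply: measurableI; first by apply: measurableI => //; exact: history_steady.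
  by rewrite -[X in measurable X]setTI; exact: history_Y.
have HB' w : B' w -> Y (t' n.+1) w = y /\
     exists i, (g i w <= (t' n.+1)%:E)%E /\ ((t' n.+1 + del)%:E < g i.+1 w)%E.
  by move=> [[_ st] Yy]; rewrite t'n.
have step' : one_step_le y del kap (a' n.+1) (phi c) by rewrite a'n; exact: step.
have := @switching_step n.+1 t' a' del (phi c) kap M y B' t'm (tk0 0) Ia' del0 (phiM c) Ey step' hB' HB'.
rewrite t'n -ExZ; last first.
  apply: bmeas_ind; apply: measurable_atom; last exact: (@history_measurable 0 _ hB').
  by move=> k; rewrite /t'; case: ifP.
have eqset w : (B' `&` passes X n.+1 t' a') w <->
   [/\ X s w = c, Y s w = y, A w & steady s (s + del) w].
  split.
    move=> [[[Bw stw] Yw] pw]; split=> //; first by have := pw n.+1 (leqnn _); rewrite t'n a'n.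
    by split=> // k kn; have := pw k (leqW kn); rewrite /t' /a' kn.
  move=> [Xs Yw [Bw pw] stw]; split=> // k; rewrite leq_eqVlt ltnS => /predU1P[->|kn].
    by rewrite t'n a'n.
  by rewrite /t' /a' kn; exact: pw.
have indE w : \1_(B' `&` passes X n.+1 t' a') w =
   \1_(X s @^-1` [set c]) w * (\1_(Y s @^-1` [set y]) w * (\1_A w * \1_(steady s (s + del)) w)) :> R.
  rewrite -!indic_setI; congr (\1_ _ w); apply/seteqP; split=> v.
    by move=> /eqset [].
  by move=> [? [? [? ?]]]; apply/eqset.
congr (_ <= _); apply: eq_Ex => w; rewrite indE; last by ring.
have [Xc|nX] := pselect ((X s @^-1` [set c]) w); last by rewrite (indic_notin nX) !mul0r.
by rewrite -[X s w]/(X s w) (Xc : X s w = c); ring.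
Qed.

Lemma substep_stay :
  Ex (fun w => \1_A w * (\1_(steady s (s + del)) w * (X s w != X (s + del) w)%:R)) <=
  b * del * Ex (fun w => \1_A w * \1_(steady s (s + del)) w).
Proof.
have n1 (x z : R) : `|(x != z)%:R| <= 1 :> R by case: (_ != _); rewrite ?normr1 ?normr0.
have bA : bmeas (\1_A : T -> R) by exact: bmeas_ind.
have bSt : bmeas (\1_(steady s (s + del)) : T -> R) by apply: bmeas_ind; exact: measurable_steady.
have bph : bmeas (fun w => (X s w != X (s + del) w)%:R : R).
  exact: (@bmeas_X2 (fun x z => (x != z)%:R) 1).
rewrite -ExZ; last exact: bmeasM.
apply: (le_Ex_values (finite_set_countable finE) (V := Y s)).
- by move=> w; have [_] := cadY w; apply.
- exact: measurable_funPT.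
- by do 2 apply: bmeasM => //.
- by apply: bmeasZ; exact: bmeasM.
move=> y Ey; apply: (@substep (fun x z => (x != z)%:R) _ y 1) => // c Ic i A' x n' t' a' *.
have := @one_step_stay y del c Ey del0 i A' x n' t' a'.
under [X in _ -> X <= _]eq_Ex do rewrite eq_sym.
exact.
Qed.

End Substep.

(** The chain alive before a jump of the environment and the one started at it
    are both constant near that time, by [chain_near]. *)
Lemma X_near_jump : {ae P, forall w, forall j, (g j.+1 w < +oo)%E -> exists2 e : R, 0 < e &
  forall s, 0 <= s -> `|s - gtime j.+1 w| < e -> X s w = X (gtime j.+1 w) w}.
Proof.
apply/ae_foralln => j.
have h1 := @chain_near j (fun w => age j (gtime j.+1 w) w).
have {}h1 : {ae P, forall w, (g j w < +oo)%E -> exists2 e : R, 0 < e &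
     forall s, 0 <= s -> `|s - age j (gtime j.+1 w) w| < e -> Z j s w = Z j (age j (gtime j.+1 w) w) w}.
  apply: h1 => [|w]; last exact: age_ge0.
  apply: measurable_maxr; last exact: measurable_cst.
  by apply: measurable_funB; exact: history_gtime.
have h2 := @chain_near j.+1 (fun=> 0) (measurable_cst _) (fun=> lexx _).
have h3 := chain_start_ae j.+1.
apply: filterS3 h1 h2 h3 => w H1 H2 H3 gj1.
have gj : (g j w < +oo)%E by exact: le_lt_trans (jump_leS (jumpY w) j) gj1.
have glt : gtime j w < gtime j.+1 w.
  by rewrite -lte_fin !(jump_fineK (jumpY w))//; have [_ gS _ _ _] := jumpY w; exact: gS.
have gE : (gtime j w)%:E = g j w by exact: (jump_fineK (jumpY w)).
have gE1 : (gtime j.+1 w)%:E = g j.+1 w by exact: (jump_fineK (jumpY w)).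
have [e1 e10 He1] := H1 gj; have [e2 e20 He2] := H2 gj1.
have [e3 e30 He3] : exists2 e3 : R, 0 < e3 & forall s, s < gtime j.+1 w + e3 -> (s%:E < g j.+2 w)%E.
  have [gj2|] := boolP (g j.+2 w < +oo)%E.
    have gE2 : (gtime j.+2 w)%:E = g j.+2 w by exact: (jump_fineK (jumpY w)).
    exists (gtime j.+2 w - gtime j.+1 w).
      by rewrite subr_gt0 -lte_fin gE1 gE2; have [_ gS _ _ _] := jumpY w; exact: gS.
    by move=> s; rewrite addrC subrK -gE2 lte_fin.
  by rewrite -leNgt leye_eq => /eqP ->; exists 1 => // s _; exact: ltry.
have startE : start j.+1 w = Z j (age j (gtime j.+1 w) w) w.
  by rewrite /start /= /age max_l// subr_ge0 ltW.
have Xg s : 0 <= s -> `|s - gtime j.+1 w| < Num.min (Num.min e1 e2) (Num.min e3 (gtime j.+1 w - gtime j w)) ->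
    X s w = start j.+1 w.
  move=> s0; rewrite !lt_min => /andP[/andP[s1 s2] /andP[s3 s4]].
  move: s3 s4; rewrite !ltr_norml => /andP[s3 s3'] /andP[s4 s4'].
  have [sg|gs] := ltP s (gtime j.+1 w).
    have st : stage j s w.
      by split; [rewrite -gE lee_fin; lra|rewrite -gE1 lte_fin].
    rewrite (X_age st) startE; apply: He1; first exact: age_ge0.
    rewrite /age !max_l ?subr_ge0 ?ltW//; last by lra.
    by rewrite (_ : _ - _ = s - gtime j.+1 w)//; ring.
  have st : stage j.+1 s w by split; [rewrite -gE1 lee_fin|apply: He3; lra].
  rewrite (X_age st) -H3//; apply: He2; first exact: age_ge0.
  by rewrite /age max_l ?subr_ge0// subr0.
exists (Num.min (Num.min e1 e2) (Num.min e3 (gtime j.+1 w - gtime j w))).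
  by rewrite !lt_min e10 e20 e30 subr_gt0.
move=> s s0 sg; rewrite !Xg//; first exact: gtime_ge0.
by rewrite subrr normr0 !lt_min e10 e20 e30 subr_gt0.
Qed.

(** Cutting the interval into many pieces, the pieces during which the
    environment is steady are dealt with by [substep_stay]; in the remaining
    ones the process does not move at all, by [X_near_jump]. *)
Lemma switching_stay n (t a : nat -> R) (B : set T) h :
  (forall k, t k <= t k.+1) -> 0 <= t 0%N -> (forall k, I (a k)) ->
  measurable (B : set (htype 0)) -> 0 <= h ->
  Ex (fun w => \1_(B `&` passes X n t a) w * (X (t n) w != X (t n + h) w)%:R) <=
  b * h * Ex \1_(B `&` passes X n t a).
Proof.
move=> tm t00 Ia hB h0; set A := B `&` _.
have tk0 k : 0 <= t k by elim: k => // k IHk; exact: le_trans IHk (tm k).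
have mA : measurable A by apply: measurable_atom => //; exact: (@history_measurable 0 _ hB).
have bA : bmeas (\1_A : T -> R) by exact: bmeas_ind.
pose neq s s' w : R := (X s w != X s' w)%:R.
have bneq s s' : 0 <= s -> 0 <= s' -> bmeas (neq s s').
  move=> s0 s'0; apply: (@bmeas_X2 (fun x z => (x != z)%:R) 1) => // x z.
  by case: (_ != _); rewrite ?normr1 ?normr0.
pose del N := h * mesh N.
have del0 N : 0 <= del N by rewrite mulr_ge0// ltW// mesh_gt0.
pose s_ N k := t n + k%:R * del N.
have s_0 N k : 0 <= s_ N k by rewrite addr_ge0// mulr_ge0.
have s_S N k : s_ N k.+1 = s_ N k + del N by rewrite /s_ -natr1 mulrDl mul1r addrA.
have s_N N : s_ N N.+1 = t n + h by rewrite /s_ /del mulrCA meshK mulr1.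
have s_le N k : t n <= s_ N k by rewrite lerDl mulr_ge0.
pose St N k := steady (s_ N k) (s_ N k + del N).
have mSt N k : measurable (St N k) by exact: measurable_steady.
pose H N := \bigcup_k if (k < N.+1)%N then
   ~` St N k `&` [set w | X (s_ N k) w != X (s_ N k + del N) w] else set0.
have mne s s' : 0 <= s -> 0 <= s' -> measurable [set w | X s w != X s' w].
  move=> s0 s'0; rewrite (_ : [set w | _] = ~` [set w | X s w == X s' w]); last first.
    by apply/seteqP; split=> w /= /negP.
  apply: measurableC; rewrite -[X in measurable X]setTI.
  by apply: measurable_fun_eqr => //; exact: measurable_X.
have mH N : measurable (H N).
  apply: bigcupT_measurable => k; case: ifP => // _; apply: measurableI.
    exact: measurableC.
  by apply: mne => //; rewrite addr_ge0.
have bound N : Ex (fun w => \1_A w * neq (t n) (t n + h) w) <= b * h * Ex \1_A + Ex \1_(H N).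
  apply: (@le_trans _ _ (Ex (fun w => \sum_(k < N.+1) (\1_A w * (\1_(St N k) w * neq (s_ N k) (s_ N k + del N) w)) + \1_(H N) w))).
    have bn k : bmeas (neq (s_ N k) (s_ N k + del N)) by apply: bneq => //; rewrite addr_ge0.
    apply: le_Ex.
    - by apply: bmeasM => //; apply: bneq => //; rewrite addr_ge0.
    - apply: bmeasD; last exact: bmeas_ind.
      by apply: bmeas_sum => k; do 2 apply: bmeasM => //; exact: bmeas_ind.
    move=> w; have sum0 : 0 <= \sum_(k < N.+1) (\1_A w * (\1_(St N k) w * neq (s_ N k) (s_ N k + del N) w)).
      by apply: sumr_ge0 => k _; rewrite !mulr_ge0// indic_ge0.
    have [Hw|nH] := pselect (H N w).
      rewrite [\1_(H N) w]indic_in// -[leLHS]add0r; apply: lerD => //.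
      by rewrite indicE /neq; case: (_ \in _); case: (_ != _); rewrite ?mulr0 ?mul0r ?mulr1.
    rewrite [\1_(H N) w]indic_notin// addr0.
    have [/eqP eq|ne] := boolP (X (t n) w == X (t n + h) w).
      by rewrite /neq eq eqxx mulr0.
    have [k kN ck] : exists2 k, (k < N.+1)%N & X (s_ N k) w != X (s_ N k + del N) w.
      apply: contrapT => nk; move/eqP: ne; apply; apply/esym.
      have all k : (k <= N.+1)%N -> X (s_ N k) w = X (t n) w.
        elim: k => [|k IHk] kN; first by rewrite /s_ mul0r addr0.
        rewrite -IHk ?(ltnW kN)// s_S; apply/esym/eqP/negPn/negP => ne; apply: nk.
        by exists k.
      by rewrite -(s_N N) all.
    have Sk : St N k w.
      by apply: contrapT => nS; apply: nH; exists k => //; rewrite kN.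
    rewrite (bigD1 (Ordinal kN))//= [\1_(St N k) w]indic_in// mul1r /neq ne ck lerDl.
    by apply: sumr_ge0 => l _; rewrite !mulr_ge0// indic_ge0.
  have bn k : bmeas (neq (s_ N k) (s_ N k + del N)) by apply: bneq => //; rewrite addr_ge0.
  have bSt k : bmeas (\1_(St N k) : T -> R) by exact: bmeas_ind.
  rewrite ExD; last 2 first.
  - by apply: bmeas_sum => k; do 2 apply: bmeasM => //.
  - exact: bmeas_ind.
  rewrite lerD2r Ex_sum; last by move=> k; do 2 apply: bmeasM => //.
  apply: (@le_trans _ _ (\sum_(k < N.+1) b * del N * Ex \1_A)).
    apply: ler_sum => k _.
    apply: le_trans (@substep_stay n t a B (s_ N k) (del N) tm t00 Ia hB (s_le N k) (del0 N)) _.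
    apply: ler_wpM2l; first by rewrite mulr_ge0.
    apply: le_Ex => [||w]; [exact: (bmeasM bA (bSt k))|exact: bA|].
    by rewrite ler_piMr ?indic_ge0// indicE lern1 leq_b1.
  rewrite sumr_const card_ord -[leLHS]mulr_natr /del le_eqVlt; apply/orP; left; apply/eqP.
  rewrite (_ : b * (h * mesh N) * Ex \1_A * N.+1%:R = b * h * Ex \1_A * (N.+1%:R * mesh N)).
    by rewrite meshK mulr1.
  by ring.
have cH : Ex \1_(H N) @[N --> \oo] --> Ex (fun=> 0).
  apply: (@Ex_cvg _ _ _ P _ _ 1).
  - by move=> N; exact: bmeas_ind.
  - exact: bmeas_cst.
  - by move=> N w; rewrite ger0_norm ?indic_ge0// indicE lern1 leq_b1.
  apply: filterS X_near_jump => w Hw; apply: cvg_near_cst.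
  have [m gm] := jump_unbounded finE (cadY w).1 (cadY w).2 (jumpY w) (t n + h).
  have [e e0 He] : exists2 e : R, 0 < e & forall j, (j < m)%N -> (g j.+1 w < +oo)%E ->
      forall s, 0 <= s -> `|s - gtime j.+1 w| < e -> X s w = X (gtime j.+1 w) w.
    elim: m {gm} => [|m [e e0 IHm]]; first by exists 1.
    have [gm1|gm1] := boolP (g m.+1 w < +oo)%E; last first.
      by exists e => // j; rewrite ltnS leq_eqVlt => /predU1P[-> /(negP gm1)//|jm]; exact: IHm.
    have [e' e'0 He'] := Hw m gm1; exists (Num.min e e'); first by rewrite lt_min e0.
    move=> j; rewrite ltnS leq_eqVlt => /predU1P[-> _|jm gj] s s0; rewrite lt_min => /andP[s1 s2].
      exact: He'.
    exact: IHm jm gj s s0 s1.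
  have h1 : 0 < h + 1 by rewrite ltr_wpDl.
  have eh : 0 < e / (h + 1) by rewrite divr_gt0.
  apply: filterS (mesh_lt eh) => N Ne; apply: indic_notin => -[k _].
  case: ifP => // kN [nS /= ne].
  have [j [j1 j2]] := not_steady (s_0 N k) nS.
  have gfin : (g j.+1 w < +oo)%E by exact: le_lt_trans j2 (ltry _).
  have jm : (j.+1 < m)%N.
    rewrite ltnNge; apply/negP => mj; have := jump_le (jumpY w) mj.
    rewrite leNgt => /negP; apply; apply: le_lt_trans gm.
    apply: le_trans j2 _; rewrite lee_fin -s_S -(s_N N) lerD2l ler_wpM2r// ler_nat.
    exact: kN.
  have del_e : del N < e.
    rewrite /del; apply: (@le_lt_trans _ _ ((h + 1) * mesh N)).
      by rewrite ler_pM2r ?mesh_gt0// lerDl.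
    by rewrite mulrC -ltr_pdivlMr.
  have gE := jump_fineK (jumpY w) gfin.
  move: j1 j2; rewrite -gE lte_fin lee_fin -/(gtime j.+1 w) => j1 j2.
  move/eqP: ne; apply.
  have E1 : X (s_ N k) w = X (gtime j.+1 w) w.
    by apply: (He j (ltnW jm) gfin) => //; rewrite ltr_norml; apply/andP; split; lra.
  have sd0 : 0 <= s_ N k + del N by rewrite addr_ge0.
  have E2 : X (s_ N k + del N) w = X (gtime j.+1 w) w.
    by apply: (He j (ltnW jm) gfin) => //; rewrite ltr_norml; apply/andP; split; lra.
  by rewrite E1 E2.
rewrite Ex_cst in cH.
have c2 : b * h * Ex \1_A + Ex \1_(H N) @[N --> \oo] --> b * h * Ex \1_A + 0.
  by apply: cvgD => //; exact: cvg_cst.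
rewrite addr0 in c2.
by apply: (ler_cvg_to (cvg_cst _) c2); exact: nearW.
Qed.

Lemma atom_setT n (t a : nat -> R) : passes X n t a = setT `&` passes X n t a.
Proof. by rewrite setTI. Qed.

Lemma atom_stay n (t a : nat -> R) h :
  (forall k, t k <= t k.+1) -> 0 <= t 0%N -> (forall k, I (a k)) -> 0 <= h ->
  Ex (fun w => \1_(passes X n t a) w * (X (t n) w != X (t n + h) w)%:R) <=
  b * h * Ex \1_(passes X n t a).
Proof.
by move=> tm t00 Ia h0; rewrite atom_setT; apply: switching_stay => //; exact: measurableT.
Qed.

Section AtomSubstep.
Variables (n : nat) (t a : nat -> R) (s del : R).
Hypotheses (tm : forall k, t k <= t k.+1) (t00 : 0 <= t 0%N) (Ia : forall k, I (a k)).
Hypotheses (ts : t n <= s) (del0 : 0 <= del).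
Let A := passes X n t a.
Let St := steady s (s + del).

Let tk0 k : 0 <= t k. Proof. by elim: k => // k IHk; exact: le_trans IHk (tm k). Qed.
Let s0 : 0 <= s. Proof. exact: le_trans ts. Qed.
Let sd0 : 0 <= s + del. Proof. by rewrite addr_ge0. Qed.

Let bA : bmeas (\1_A : T -> R).
Proof. by apply: bmeas_ind; apply: measurable_passes => k _; exact: measurable_X. Qed.

Let bSt : bmeas (\1_(~` St) : T -> R).
Proof. by apply: bmeas_ind; apply: measurableC; exact: measurable_steady. Qed.

(** The unsteadiness of the environment is an event to which [switching_stay]
    applies, once the state at time [s] is added to the observed past. *)
Lemma atom_unsteady :
  Ex (fun w => \1_A w * (\1_(~` St) w * (X s w != X (s + del) w)%:R)) <=
  b * del * Ex (fun w => \1_A w * \1_(~` St) w).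
Proof.
have bph : bmeas (fun w => (X s w != X (s + del) w)%:R : R).
  apply: (@bmeas_X2 (fun x z => (x != z)%:R) 1) => // x z.
  by case: (_ != _); rewrite ?normr1 ?normr0.
rewrite -ExZ; last exact: bmeasM.
apply: (le_Ex_values cI (V := X s)) => //.
- by move=> w; exact: X_in.
- exact: measurable_X.
- by do 2 apply: bmeasM => //.
- by apply: bmeasZ; exact: bmeasM.
move=> c Ic.
pose t' l := if (l <= n)%N then t l else s; pose a' l := if (l <= n)%N then a l else c.
have t'm k : t' k <= t' k.+1 by rewrite /t'; case: (ltngtP k n) => [kn|nk|->] //.
have Ia' k : I (a' k) by rewrite /a'; case: ifP.
have t'n : t' n.+1 = s by rewrite /t' ltnn.
have hB : measurable (~` St : set (htype 0)) by apply: measurableC; exact: history_steady.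
have := @switching_stay n.+1 t' a' (~` St) del t'm (tk0 0) Ia' hB del0.
rewrite t'n -ExZ; last first.
  apply: bmeas_ind; apply: measurable_atom; last exact: (@history_measurable 0 _ hB).
  by move=> k; rewrite /t'; case: ifP.
have indE w : \1_(~` St `&` passes X n.+1 t' a') w =
   \1_(X s @^-1` [set c]) w * (\1_A w * \1_(~` St) w) :> R.
  rewrite -!indic_setI; congr (\1_ _ w); apply/seteqP; split=> {}w.
    move=> [stw pw]; split; first by have := pw n.+1 (leqnn _); rewrite t'n /a' ltnn.
    by split=> // k kn; have := pw k (leqW kn); rewrite /t' /a' kn.
  move=> [Xs [pw stw]]; split=> // k; rewrite leq_eqVlt ltnS => /predU1P[->|kn].
    by rewrite t'n /a' ltnn.
  by rewrite /t' /a' kn; exact: pw.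
by congr (_ <= _); apply: eq_Ex => w; rewrite indE; ring.
Qed.

Lemma atom_steady y u : E y -> (forall z, `|u z| <= 1) ->
  `|Ex (fun w => \1_(Y s @^-1` [set y]) w * (\1_A w * (\1_St w *
      (u (X (s + del) w) - (u (X s w) + del * generator I (q y) Jl u (X s w))))))| <=
  8 * (size Jl)%:R * b ^+ 2 * del ^+ 2 * Ex (fun w => \1_(Y s @^-1` [set y]) w * (\1_A w * \1_St w)).
Proof.
move=> Ey u1; set kap := 8 * _ * _ * _.
(* outside of the state space the generator is replaced by 0 to keep it bounded *)
pose L c := if `[< I c >] then generator I (q y) Jl u c else 0.
pose phi c z := u z - (u c + del * L c).
have Lb c : `|L c| <= 2 * b.
  rewrite /L; case: asboolP => Ic; first exact: generator_bound (bQ Ey) Ic u1.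
  by rewrite normr0 mulr_ge0.
have phiM c z : `|phi c z| <= 2 + del * (2 * b).
  rewrite /phi opprD addrA; apply: le_trans (ler_normB _ _) _; apply: lerD.
    by apply: le_trans (ler_normB _ _) _; have := u1 z; have := u1 c; lra.
  by rewrite normrM ger0_norm// ler_wpM2l.
have phiM' c z : `|- phi c z| <= 2 + del * (2 * b) by rewrite normrN.
have phiE w : u (X (s + del) w) - (u (X s w) + del * generator I (q y) Jl u (X s w)) =
    phi (X s w) (X (s + del) w).
  by rewrite /phi /L; case: asboolP => // nI; case: nI; exact: X_in.
under eq_Ex do rewrite phiE.
have bStT : bmeas (\1_St : T -> R) by apply: bmeas_ind; exact: measurable_steady.
have mYs : measurable (Y s @^-1` [set y]) by rewrite -[X in measurable X]setTI; exact: measurable_funPT.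
have bYs : bmeas (\1_(Y s @^-1` [set y]) : T -> R) by exact: bmeas_ind.
have bph : bmeas (fun w => phi (X s w) (X (s + del) w)) by exact: bmeas_X2 phiM.
have step c : I c -> one_step_le y del kap c (phi c) /\ one_step_le y del kap c (fun z => - phi c z).
  move=> Ic; have := one_step_abs c Ey del0 u1.
  by rewrite -/kap /phi /L asboolT.
have hT : measurable (setT : set (htype 0)) by exact: measurableT.
have := @substep n t a setT s del tm t00 Ia hT ts del0 phi kap y _ phiM Ey (fun c Ic => (step c Ic).1).
have := @substep n t a setT s del tm t00 Ia hT ts del0 (fun c z => - phi c z) kap y _ phiM' Ey (fun c Ic => (step c Ic).2).
rewrite -atom_setT -/A -/St.
have -> : Ex (fun w => \1_(Y s @^-1` [set y]) w * (kap * (\1_A w * \1_St w))) =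
   kap * Ex (fun w => \1_(Y s @^-1` [set y]) w * (\1_A w * \1_St w)).
  rewrite -ExZ; last by do 2 apply: bmeasM => //.
  by apply: eq_Ex => w; rewrite mulrCA.
have -> : Ex (fun w => \1_(Y s @^-1` [set y]) w * (\1_A w * (\1_St w * - phi (X s w) (X (s + del) w)))) =
   - Ex (fun w => \1_(Y s @^-1` [set y]) w * (\1_A w * (\1_St w * phi (X s w) (X (s + del) w)))).
  rewrite -ExN; last by do 3 apply: bmeasM => //.
  by apply: eq_Ex => w; rewrite !mulrN.
by move=> h1 h2; rewrite ler_norml h2 lerNl h1.
Qed.

End AtomSubstep.

End History.

(** * Averaging the environment over a block of time *)

Lemma cvg_sum_seq {R : realType} {K : eqType} (s : seq K) (f : K -> nat -> R) (l : K -> R) :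
  (forall y, y \in s -> f y N @[N --> \oo] --> l y) ->
  \sum_(y <- s) f y N @[N --> \oo] --> \sum_(y <- s) l y.
Proof.
elim: s => [|y s IHs] H.
  by rewrite big_nil; under eq_fun do rewrite big_nil; exact: cvg_cst.
rewrite big_cons; under eq_fun do rewrite big_cons.
apply: cvgD; first by apply: H; rewrite mem_head.
by apply: IHs => z zs; apply: H; rewrite inE zs orbT.
Qed.

Section Block.
Context {d : measure_display} {T : measurableType d} {R : realType}.
Variables (P : probability T R) (I : set R) (Es : seq R) (q : R -> R -> R -> R) (Jl : seq R).
Variables (b K : R) (pi : R -> R) (Y X : R -> T -> R) (St : R -> R -> set T).
Local Notation Ex f := (Rintegral P setT f).
Local Notation L := (fun y u c => generator I (q y) Jl u c).
Hypotheses (cI : countable I) (uEs : uniq Es) (b0 : 0 <= b) (K0 : 0 <= K).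
Hypothesis bQ : forall y, y \in Es -> bounded_rates I (q y) Jl b.
Hypotheses (YE : forall (t : R) w, 0 <= t -> Y t w \in Es).
Hypotheses (mY : forall t : R, 0 <= t -> measurable_fun setT (Y t)).
Hypotheses (XI : forall (t : R) w, 0 <= t -> I (X t w)).
Hypotheses (mX : forall t : R, 0 <= t -> measurable_fun setT (X t)).
Hypothesis mSt : forall s s', measurable (St s s').
Hypothesis stay : forall n (t a : nat -> R) (h : R),
  (forall k, t k <= t k.+1) -> 0 <= t 0%N -> (forall k, I (a k)) -> 0 <= h ->
  Ex (fun w => \1_(passes X n t a) w * (X (t n) w != X (t n + h) w)%:R) <=
  b * h * Ex \1_(passes X n t a).
Hypothesis unsteady : forall n (t a : nat -> R) (s del : R),
  (forall k, t k <= t k.+1) -> 0 <= t 0%N -> (forall k, I (a k)) -> t n <= s -> 0 <= del ->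
  Ex (fun w => \1_(passes X n t a) w * (\1_(~` St s (s + del)) w * (X s w != X (s + del) w)%:R)) <=
  b * del * Ex (fun w => \1_(passes X n t a) w * \1_(~` St s (s + del)) w).
Hypothesis steady_step : forall n (t a : nat -> R) (s del y : R) (u : R -> R),
  (forall k, t k <= t k.+1) -> 0 <= t 0%N -> (forall k, I (a k)) -> t n <= s -> 0 <= del ->
  y \in Es -> (forall z, `|u z| <= 1) ->
  `|Ex (fun w => \1_(Y s @^-1` [set y]) w * (\1_(passes X n t a) w * (\1_(St s (s + del)) w *
      (u (X (s + del) w) - (u (X s w) + del * L y u (X s w))))))| <=
  K * del ^+ 2 * Ex (fun w => \1_(Y s @^-1` [set y]) w * (\1_(passes X n t a) w * \1_(St s (s + del)) w)).

Variables (n : nat) (t a : nat -> R) (u : R -> R) (del : R).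
Hypotheses (tm : forall k, t k <= t k.+1) (t00 : 0 <= t 0%N) (Ia : forall k, I (a k)).
Hypotheses (u1 : forall z, `|u z| <= 1) (del0 : 0 <= del).
Let A := passes X n t a.
Let tau := t n.
Let c := a n.

Let tau0 : 0 <= tau.
Proof. by rewrite /tau; elim: n => // k IHk; exact: le_trans IHk (tm k). Qed.

Let mA : measurable A.
Proof.
apply: measurable_passes => k _; apply: mX.
by elim: k => // k IHk; exact: le_trans IHk (tm k).
Qed.

Let bA : bmeas (\1_A : T -> R). Proof. exact: bmeas_ind. Qed.

Let bX2 (phi : R -> R -> R) M s s' : 0 <= s -> 0 <= s' ->
  (forall x z, `|phi x z| <= M) -> bmeas (fun w => phi (X s w) (X s' w)).
Proof.
by move=> s0 s'0 phiM; apply: (bmeas_pair cI _ _ _ _ phiM) => [w|w||]; [exact: XI|exact: XI|exact: mX|exact: mX].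
Qed.

Let nq s s' w : R := (X s w != X s' w)%:R.
Let bnq s s' : 0 <= s -> 0 <= s' -> bmeas (nq s s').
Proof.
move=> s0 s'0; apply: (@bX2 (fun x z => (x != z)%:R) 1) => // x z.
by case: (_ != _); rewrite ?normr1 ?normr0.
Qed.

Let L0 y z := if `[< I z >] then L y u z else 0.
Let L0E y z : I z -> L y u z = L0 y z. Proof. by move=> Iz; rewrite /L0 asboolT. Qed.
Let L0b y z : y \in Es -> `|L0 y z| <= 2 * b.
Proof.
move=> yE; rewrite /L0; case: asboolP => Iz; first exact: generator_bound (bQ yE) Iz u1.
by rewrite normr0 mulr_ge0.
Qed.

Let Yi y s w : R := \1_(Y s @^-1` [set y]) w.
Let bYi y s : 0 <= s -> bmeas (Yi y s).
Proof. by move=> s0; apply: bmeas_ind; rewrite -[X in measurable X]setTI; exact: mY. Qed.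

Let YiE y s w : Yi y s w = (Y s w == y)%:R.
Proof. by apply: indic_eq; split=> /eqP. Qed.

Let sumYi_mul s w (F : R -> R) : 0 <= s -> \sum_(y <- Es) Yi y s w * F y = F (Y s w).
Proof.
move=> s0; rewrite (bigD1_seq (Y s w))//=; last exact: YE.
rewrite YiE eqxx mul1r big1 ?addr0// => y yY.
by rewrite YiE eq_sym (negbTE yY) mul0r.
Qed.

Let bu s : 0 <= s -> bmeas (fun w => u (X s w)).
Proof. by move=> s0; exact: (@bX2 (fun x _ => u x) 1 s s). Qed.

Section Piece.
Variables (s h : R).
Hypotheses (ts : tau <= s) (sd : s - tau <= del) (h0 : 0 <= h).
Let s0 : 0 <= s. Proof. exact: le_trans ts. Qed.
Let sh0 : 0 <= s + h. Proof. by rewrite addr_ge0. Qed.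
Let S := St s (s + h).
Let Lam w := h * \sum_(y <- Es) Yi y s w * L0 y c.

Let bS : bmeas (\1_S : T -> R). Proof. by apply: bmeas_ind; exact: mSt. Qed.
Let bSc : bmeas (\1_(~` S) : T -> R). Proof. by apply: bmeas_ind; apply: measurableC; exact: mSt. Qed.
Let bLam : bmeas Lam.
Proof.
by apply: bmeasZ; apply: bmeas_sum => y; apply: bmeasM; [exact: bYi|exact: bmeas_cst].
Qed.

Let Lam_le w : `|Lam w| <= h * (2 * b).
Proof.
rewrite /Lam (@sumYi_mul s w (fun y => L0 y c))// normrM ger0_norm// ler_wpM2l//.
by apply: L0b; exact: YE.
Qed.

Let indC w : \1_(~` S) w = 1 - \1_S w :> R.
Proof. by rewrite !indicE in_setC; case: (_ \in _); rewrite ?subrr ?subr0. Qed.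

(** The rates may be evaluated at the state [c] occupied when the block starts:
    the process has left it with probability at most [b * del]. If the
    environment jumps during the piece, both the increment and its prediction
    are bounded separately. *)
Lemma block_piece :
  `|Ex (fun w => \1_A w * (u (X (s + h) w) - u (X s w) - Lam w))| <=
  (K * h ^+ 2 + 4 * b ^+ 2 * del * h) * Ex \1_A + 4 * b * h * Ex (fun w => \1_A w * \1_(~` S) w).
Proof.
pose ph y w := u (X (s + h) w) - (u (X s w) + h * L0 y (X s w)).
have bph y : y \in Es -> bmeas (ph y).
  move=> yE; apply: (@bX2 (fun x z => u z - (u x + h * L0 y x)) (2 + h * (2 * b)))=> // x z.
  rewrite opprD addrA; apply: le_trans (ler_normB _ _) _; apply: lerD.
    by apply: le_trans (ler_normB _ _) _; have := u1 z; have := u1 x; lra.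
  by rewrite normrM ger0_norm// ler_wpM2l// L0b.
pose ph' y w := if y \in Es then ph y w else 0.
have bph' y : bmeas (ph' y).
  by rewrite /ph'; case yE : (y \in Es); [exact: bph|exact: bmeas_cst].
pose F1 w := \sum_(y <- Es) Yi y s w * (\1_A w * (\1_S w * ph' y w)).
pose G w := \sum_(y <- Es) Yi y s w * (L0 y (X s w) - L0 y c).
have GE w : G w = L0 (Y s w) (X s w) - L0 (Y s w) c.
  exact: (@sumYi_mul s w (fun y => L0 y (X s w) - L0 y c)).
have bL y : bmeas (fun w => Yi y s w * (L0 y (X s w) - L0 y c)).
  have [yE|nyE] := boolP (y \in Es).
    apply: bmeasM; first exact: bYi.
    apply: (@bX2 (fun x _ => L0 y x - L0 y c) (2 * b + 2 * b) s s) => // x _.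
    by apply: le_trans (ler_normB _ _) _; apply: lerD; exact: L0b.
  rewrite (_ : (fun w => _) = fun=> 0); first exact: bmeas_cst.
  apply/funext => w; rewrite YiE; case: eqP => [yE|]; rewrite ?mul0r//.
  by move: nyE; rewrite -yE YE.
have bG : bmeas G by exact: bmeas_sum.
have bF1k y : bmeas (fun w => Yi y s w * (\1_A w * (\1_S w * ph' y w))).
  by apply: bmeasM; [exact: bYi|do 2 apply: bmeasM => //].
have bF1 : bmeas F1 by exact: bmeas_sum.
have split3 w : \1_A w * (u (X (s + h) w) - u (X s w) - Lam w) =
    F1 w + \1_A w * (\1_S w * (h * G w)) +
    \1_A w * (\1_(~` S) w * (u (X (s + h) w) - u (X s w) - Lam w)).
  have -> : F1 w = \1_A w * (\1_S w * (u (X (s + h) w) - (u (X s w) + h * L0 (Y s w) (X s w)))).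
    rewrite /F1 (@sumYi_mul s w (fun y => \1_A w * (\1_S w * ph' y w)))//.
    by rewrite /ph' YE.
  rewrite GE /Lam (@sumYi_mul s w (fun y => L0 y c))// indC; ring.
have bdu : bmeas (fun w => u (X (s + h) w) - u (X s w) - Lam w).
  by apply: bmeasB => //; apply: bmeasB; exact: bu.
rewrite (eq_Ex P split3) ExD; last 2 first.
- by apply: bmeasD => //; do 2 apply: bmeasM => //; exact: bmeasZ.
- by do 2 apply: bmeasM => //.
rewrite ExD//; last by do 2 apply: bmeasM => //; exact: bmeasZ.
have i1 w : 0 <= \1_A w :> R by exact: indic_ge0.
have i2 w : 0 <= (\1_S w : R) <= 1.
  by rewrite indicE; case: (_ \in _); rewrite /= lexx ler01.
have E1 : `|Ex F1| <= K * h ^+ 2 * Ex \1_A.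
  rewrite /F1 Ex_sum//; apply: le_trans (ler_norm_sum _ _ _) _.
  have bAS y : bmeas (fun w => Yi y s w * (\1_A w * \1_S w)).
    by apply: bmeasM; [exact: bYi|exact: bmeasM].
  apply: (@le_trans _ _ (\sum_(y <- Es) K * h ^+ 2 * Ex (fun w => Yi y s w * (\1_A w * \1_S w)))).
    rewrite big_seq [leRHS]big_seq; apply: ler_sum => y yE.
    have := @steady_step n t a s h y u tm t00 Ia ts h0 yE u1.
    apply: le_trans; rewrite le_eqVlt; apply/orP; left; apply/eqP; congr (`|_|).
    by apply: eq_Ex => w; rewrite /ph' yE /ph L0E//; exact: XI.
  rewrite -mulr_sumr -Ex_sum//; apply: ler_wpM2l; first by rewrite mulr_ge0// sqr_ge0.
  apply: le_Ex => // [|w]; first exact: bmeas_sum.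
  rewrite (@sumYi_mul s w (fun=> \1_A w * \1_S w))//.
  by rewrite ler_piMr//; have /andP[] := i2 w.
have E2 : `|Ex (fun w => \1_A w * (\1_S w * (h * G w)))| <= 4 * b ^+ 2 * del * h * Ex \1_A.
  have b2 : bmeas (fun w => \1_A w * (\1_S w * (h * G w))).
    by do 2 apply: bmeasM => //; exact: bmeasZ.
  apply: le_trans (abs_Ex P b2) _.
  apply: (@le_trans _ _ (Ex (fun w => h * (4 * b) * (\1_A w * nq tau s w)))).
    apply: le_Ex.
    - exact: bmeas_abs.
    - by apply: bmeasZ; apply: bmeasM => //; exact: bnq.
    move=> w; rewrite !normrM (ger0_norm (i1 w)) (ger0_norm h0).
    have /andP[S0 S1] := i2 w; rewrite (ger0_norm S0).
    have [Aw|nA] := pselect (A w); last by rewrite (indic_notin nA) !mul0r mulr0.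
    have Xc : X tau w = c by exact: (Aw n (leqnn _)).
    rewrite (indic_in Aw) !mul1r /nq Xc GE.
    have [->|ne] := eqVneq c (X s w).
      by rewrite subrr normr0 !mulr0.
    rewrite mulr1; apply: (@le_trans _ _ (1 * (h * (4 * b)))); last by rewrite mul1r.
    apply: ler_pM => //; first by rewrite mulr_ge0.
    rewrite ler_wpM2l//; apply: le_trans (ler_normB _ _) _.
    have YEs := YE w s0; have := L0b (X s w) YEs; have := L0b c YEs; lra.
  rewrite ExZ; last by apply: bmeasM => //; exact: bnq.
  have := @stay n t a (s - tau) tm t00 Ia; rewrite -/tau subr_ge0 => /(_ ts).
  rewrite (addrC tau) subrK => H.
  apply: (@le_trans _ _ (h * (4 * b) * (b * (s - tau) * Ex \1_A))).
    by apply: ler_wpM2l => //; rewrite !mulr_ge0.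
  have EA : 0 <= Ex \1_A by exact: Ex_ge0.
  apply: (@le_trans _ _ (h * (4 * b) * (b * del * Ex \1_A))).
    by apply: ler_wpM2l; [rewrite !mulr_ge0|apply: ler_wpM2r => //; exact: ler_wpM2l].
  by rewrite le_eqVlt; apply/orP; left; apply/eqP; ring.
have E3 : `|Ex (fun w => \1_A w * (\1_(~` S) w * (u (X (s + h) w) - u (X s w) - Lam w)))| <=
    4 * b * h * Ex (fun w => \1_A w * \1_(~` S) w).
  have b3 : bmeas (fun w => \1_A w * (\1_(~` S) w * (u (X (s + h) w) - u (X s w) - Lam w))).
    by do 2 apply: bmeasM => //.
  apply: le_trans (abs_Ex P b3) _.
  apply: (@le_trans _ _ (Ex (fun w => 2 * (\1_A w * (\1_(~` S) w * nq s (s + h) w)) +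
      h * (2 * b) * (\1_A w * \1_(~` S) w)))).
    have bn : bmeas (nq s (s + h)) by exact: bnq.
    apply: le_Ex.
    - exact: bmeas_abs.
    - by apply: bmeasD; apply: bmeasZ; do ?apply: bmeasM => //.
    move=> w; rewrite !normrM (ger0_norm (i1 w)) (ger0_norm (indic_ge0 _ _)).
    have -> : 2 * (\1_A w * (\1_(~` S) w * nq s (s + h) w)) + h * (2 * b) * (\1_A w * \1_(~` S) w) =
       \1_A w * (\1_(~` S) w * (2 * nq s (s + h) w + h * (2 * b))) by ring.
    do 2 (apply: ler_wpM2l; first exact: indic_ge0).
    apply: le_trans (ler_normB _ _) _; apply: lerD; last exact: Lam_le.
    rewrite /nq; have [->|ne] := eqVneq (X s w) (X (s + h) w).
      by rewrite subrr normr0 mulr0.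
    by rewrite mulr1; apply: le_trans (ler_normB _ _) _; have := u1 (X s w); have := u1 (X (s + h) w); lra.
  have bn : bmeas (nq s (s + h)) by exact: bnq.
  rewrite ExD; last 2 first.
  - by apply: bmeasZ; do 2 apply: bmeasM => //.
  - by apply: bmeasZ; apply: bmeasM => //.
  rewrite (@ExZ _ _ _ P 2); last by do 2 apply: bmeasM => //.
  rewrite (@ExZ _ _ _ P (h * (2 * b))); last exact: bmeasM.
  have := @unsteady n t a s h tm t00 Ia ts h0; rewrite -/S -/A.
  set e1 := Ex _; set e2 := Ex (fun w => \1_A w * \1_(~` S) w).
  by move=> H; lra.
apply: le_trans (ler_normD _ _) _; apply: le_trans (lerD (ler_normD _ _) (lexx _)) _.
by rewrite mulrDl; apply: lerD => //; exact: lerD.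
Qed.

End Piece.

(** Averaging over one block: the environment oscillates during the block while
    [X] hardly moves, so that only the occupation times of the environment
    enter, through their deviations [D y] from the expected ones. *)
Lemma block_step (D : R -> T -> R) :
  (forall y, y \in Es -> measurable_fun setT (D y)) ->
  (forall y w, y \in Es -> \sum_(k < N.+1) del * mesh N * ((Y (tau + k%:R * (del * mesh N)) w == y)%:R - pi y)
      @[N --> \oo] --> D y w) ->
  (forall w, del * mesh N * \sum_(k < N.+1)
      \1_(~` St (tau + k%:R * (del * mesh N)) (tau + k%:R * (del * mesh N) + del * mesh N)) w
      @[N --> \oo] --> (0 : R)) ->
  `|Ex (fun w => \1_A w * (u (X (tau + del) w) - (u c + del * \sum_(y <- Es) pi y * L y u c)))| <=
  4 * b ^+ 2 * del ^+ 2 * Ex \1_A + 2 * b * \sum_(y <- Es) Ex (fun w => \1_A w * `|D y w|).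
Proof.
move=> mD cD cSt.
pose h N := del * mesh N.
have h0 N : 0 <= h N by rewrite mulr_ge0// ltW// mesh_gt0.
have hN N : N.+1%:R * h N = del by rewrite /h mulrCA meshK mulr1.
pose s_ N k := tau + k%:R * h N.
have ts N k : tau <= s_ N k by rewrite lerDl mulr_ge0.
have s0 N k : 0 <= s_ N k by exact: le_trans (ts N k).
have s_S N k : s_ N k.+1 = s_ N k + h N by rewrite /s_ -natr1 mulrDl mul1r addrA.
have sd N k : (k < N.+1)%N -> s_ N k - tau <= del.
  by move=> kN; rewrite /s_ addrC addKr -(hN N) ler_wpM2r// ler_nat ltnW.
pose Sc N k : T -> R := \1_(~` St (s_ N k) (s_ N k + h N)).
have bSc N k : bmeas (Sc N k) by apply: bmeas_ind; apply: measurableC; exact: mSt.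
pose DN N y w : R := \sum_(k < N.+1) h N * (Yi y (s_ N k) w - pi y).
have bDN N y : bmeas (DN N y).
  by apply: bmeas_sum => k; apply: bmeasZ; apply: bmeasB; [exact: bYi|exact: bmeas_cst].
have DNb N y w : `|DN N y w| <= del * (1 + `|pi y|).
  apply: le_trans (ler_norm_sum _ _ _) _.
  apply: (@le_trans _ _ (\sum_(k < N.+1) h N * (1 + `|pi y|))).
    apply: ler_sum => k _; rewrite normrM (ger0_norm (h0 N)) ler_wpM2l//.
    apply: le_trans (ler_normB _ _) _; rewrite lerD2r YiE.
    by case: (_ == _); rewrite ?normr1 ?normr0.
  by rewrite sumr_const card_ord -[leLHS]mulr_natl mulrA hN.
have cDN y w : y \in Es -> DN N y w @[N --> \oo] --> D y w.
  move=> yE; have := cD y w yE; apply: cvg_trans; apply: near_eq_cvg; apply: nearW => N.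
  by rewrite /DN; apply: eq_bigr => k _; rewrite YiE.
have Db y w : y \in Es -> `|D y w| <= del * (1 + `|pi y|).
  move=> yE; have /cvg_norm c1 := cDN y w yE.
  by apply: (ler_cvg_to c1 (cvg_cst _)); apply: nearW.
have bD y : y \in Es -> bmeas (D y).
  by move=> yE; split; [exact: mD|exists (del * (1 + `|pi y|)) => w; exact: Db].
have bSS N : bmeas (fun w => \sum_(k < N.+1) Sc N k w) by exact: bmeas_sum.
have i1 w : 0 <= \1_A w :> R by exact: indic_ge0.
pose tgt w := \1_A w * (u (X (tau + del) w) - (u c + del * \sum_(y <- Es) pi y * L y u c)).
have td0 : 0 <= tau + del by rewrite addr_ge0.
have btgt : bmeas tgt.
  by apply: bmeasM => //; apply: bmeasB; [exact: bu|exact: bmeas_cst].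
have bound N : `|Ex tgt| <= (K * (del * h N) + 4 * b ^+ 2 * del ^+ 2) * Ex \1_A +
    4 * b * Ex (fun w => \1_A w * (h N * \sum_(k < N.+1) Sc N k w)) +
    2 * b * \sum_(y <- Es) Ex (fun w => \1_A w * `|DN N y w|).
  pose Lam k w := h N * \sum_(y <- Es) Yi y (s_ N k) w * L0 y c.
  have bLam k : bmeas (Lam k).
    by apply: bmeasZ; apply: bmeas_sum => y; apply: bmeasM; [exact: bYi|exact: bmeas_cst].
  pose pc k w := \1_A w * (u (X (s_ N k + h N) w) - u (X (s_ N k) w) - Lam k w).
  have bpc k : bmeas (pc k).
    apply: bmeasM => //; apply: bmeasB => //; apply: bmeasB; apply: bu => //.
    by rewrite addr_ge0.
  pose rst w := \sum_(y <- Es) L0 y c * (\1_A w * DN N y w).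
  have brst : bmeas rst.
    by apply: bmeas_sum => y; apply: bmeasZ; exact: bmeasM.
  have tE w : tgt w = \sum_(k < N.+1) pc k w + rst w.
    rewrite /tgt; have [Aw|nA] := pselect (A w); last first.
      rewrite (indic_notin nA) mul0r /pc (indic_notin nA) big1 ?add0r; last by move=> k _; rewrite mul0r.
      by rewrite /rst big1// => y _; rewrite (indic_notin nA) mul0r mulr0.
    have -> : rst w = \sum_(y <- Es) L0 y c * DN N y w.
      by apply: eq_bigr => y _; rewrite (indic_in Aw) mul1r.
    have -> : \sum_(k < N.+1) pc k w =
        \sum_(k < N.+1) (u (X (s_ N k + h N) w) - u (X (s_ N k) w)) - \sum_(k < N.+1) Lam k w.
      by rewrite -sumrB; apply: eq_bigr => k _; rewrite /pc (indic_in Aw) mul1r.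
    rewrite (indic_in Aw) mul1r.
    have -> : \sum_(k < N.+1) (u (X (s_ N k + h N) w) - u (X (s_ N k) w)) = u (X (tau + del) w) - u c.
      under eq_bigr do rewrite -s_S.
      rewrite -(big_mkord xpredT (fun k => u (X (s_ N k.+1) w) - u (X (s_ N k) w))).
      rewrite telescope_sumr// /s_ hN mul0r addr0.
      by rewrite (Aw n (leqnn _) : X tau w = c).
    have -> : \sum_(k < N.+1) Lam k w = \sum_(y <- Es) L0 y c * DN N y w + del * \sum_(y <- Es) pi y * L y u c.
      rewrite /Lam -mulr_sumr exchange_big/= !mulr_sumr -big_split/=; apply: eq_bigr => y _.
      have -> : del * (pi y * L y u c) = L0 y c * (del * pi y).
        by rewrite L0E; [ring|exact: Ia].
      rewrite -mulrDr /DN -mulr_suml -mulr_sumr sumrB sumr_const card_ord -[pi y *+ _]mulr_natl.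
      rewrite -(hN N); ring.
    by ring.
  rewrite (eq_Ex P tE) ExD//; last exact: bmeas_sum.
  rewrite Ex_sum//.
  have R1 : `|\sum_(k < N.+1) Ex (pc k)| <= (K * (del * h N) + 4 * b ^+ 2 * del ^+ 2) * Ex \1_A +
      4 * b * Ex (fun w => \1_A w * (h N * \sum_(k < N.+1) Sc N k w)).
    apply: le_trans (ler_norm_sum _ _ _) _.
    apply: (@le_trans _ _ (\sum_(k < N.+1) ((K * h N ^+ 2 + 4 * b ^+ 2 * del * h N) * Ex \1_A +
        4 * b * h N * Ex (fun w => \1_A w * Sc N k w)))).
      apply: ler_sum => k _.
      exact: (@block_piece (s_ N k) (h N) (ts N k) (sd N k (ltn_ord k)) (h0 N)).
    rewrite big_split/= sumr_const card_ord -[X in X + _ <= _]mulr_natl -mulr_sumr.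
    have -> : Ex (fun w => \1_A w * (h N * \sum_(k < N.+1) Sc N k w)) =
        h N * \sum_(k < N.+1) Ex (fun w => \1_A w * Sc N k w).
      rewrite -Ex_sum; last by move=> k; exact: bmeasM.
      rewrite -ExZ; last by apply: bmeas_sum => k; exact: bmeasM.
      by apply: eq_Ex => w; rewrite mulrCA mulr_sumr.
    rewrite le_eqVlt; apply/orP; left; apply/eqP.
    by rewrite -(hN N); ring.
  have R2 : `|Ex rst| <= 2 * b * \sum_(y <- Es) Ex (fun w => \1_A w * `|DN N y w|).
    rewrite /rst Ex_sum; last by move=> y; apply: bmeasZ; exact: bmeasM.
    apply: le_trans (ler_norm_sum _ _ _) _; rewrite mulr_sumr big_seq [leRHS]big_seq.
    apply: ler_sum => y yE; rewrite ExZ; last exact: bmeasM.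
    rewrite normrM; apply: ler_pM => //; first exact: L0b.
    have bb : bmeas (fun w => \1_A w * DN N y w) by exact: bmeasM.
    apply: le_trans (abs_Ex P bb) _; apply: le_Ex; first exact: bmeas_abs.
      by apply: bmeasM => //; exact: bmeas_abs.
    by move=> w; rewrite normrM (ger0_norm (i1 w)).
  by apply: le_trans (ler_normD _ _) _; exact: lerD.
have c1 : (K * (del * h N) + 4 * b ^+ 2 * del ^+ 2) * Ex \1_A @[N --> \oo] -->
    (K * (del * (del * 0)) + 4 * b ^+ 2 * del ^+ 2) * Ex \1_A.
  apply: cvgMr_tmp; apply: cvgD; last exact: cvg_cst.
  by do 3 apply: cvgMl_tmp; exact: mesh_cvg0.
have c2 : 4 * b * Ex (fun w => \1_A w * (h N * \sum_(k < N.+1) Sc N k w)) @[N --> \oo] -->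
    4 * b * Ex (fun=> 0).
  apply: cvgMl_tmp; apply: (@Ex_cvg _ _ _ P _ _ del).
  - by move=> N; apply: bmeasM => //; exact: bmeasZ.
  - exact: bmeas_cst.
  - move=> N w; apply: norm_indicM_le => //.
    have S0 : 0 <= \sum_(k < N.+1) Sc N k w by apply: sumr_ge0 => k _; exact: indic_ge0.
    rewrite ger0_norm; last by rewrite mulr_ge0.
    rewrite -[leRHS](hN N) [leLHS]mulrC ler_wpM2r//.
    apply: (@le_trans _ _ (\sum_(k < N.+1) 1)); last by rewrite sumr_const card_ord.
    by apply: ler_sum => k _; rewrite /Sc indicE lern1 leq_b1.
  apply: aeW => w.
  have c0 : \1_A w * (h N * \sum_(k < N.+1) Sc N k w) @[N --> \oo] --> (\1_A w * 0 : R).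
    by apply: cvgMl_tmp; exact: cSt.
  by rewrite mulr0 in c0.
have c3 : 2 * b * \sum_(y <- Es) Ex (fun w => \1_A w * `|DN N y w|) @[N --> \oo] -->
    2 * b * \sum_(y <- Es) Ex (fun w => \1_A w * `|D y w|).
  apply: cvgMl_tmp; apply: cvg_sum_seq => y yE; apply: (@Ex_cvg _ _ _ P _ _ (del * (1 + `|pi y|))).
  - by move=> N; apply: bmeasM => //; exact: bmeas_abs.
  - by apply: bmeasM => //; apply: bmeas_abs; exact: bD.
  - move=> N w; apply: norm_indicM_le; last by rewrite normr_id.
    by rewrite mulr_ge0// addr_ge0.
  by apply: aeW => w; apply: cvgMl_tmp; apply: cvg_norm; exact: cDN.
rewrite Ex_cst in c2.
rewrite !mulr0 add0r in c1; rewrite mulr0 in c2.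
have c4 : (K * (del * h N) + 4 * b ^+ 2 * del ^+ 2) * Ex \1_A +
    4 * b * Ex (fun w => \1_A w * (h N * \sum_(k < N.+1) Sc N k w)) +
    2 * b * \sum_(y <- Es) Ex (fun w => \1_A w * `|DN N y w|) @[N --> \oo] -->
    4 * b ^+ 2 * del ^+ 2 * Ex \1_A + 0 + 2 * b * \sum_(y <- Es) Ex (fun w => \1_A w * `|D y w|).
  by apply: cvgD => //; exact: cvgD.
rewrite addr0 in c4.
by apply: (ler_cvg_to (cvg_cst _) c4); exact: nearW.
Qed.

End Block.

(** * Comparison with an Euler scheme *)

Section Atoms.
Context {d : measure_display} {T : measurableType d} {R : realType}.
Variables (P : probability T R) (I : set R) (W : R -> T -> R).
Hypotheses (cI : countable I) (WI : forall (t : R) w, 0 <= t -> I (W t w)).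
Hypotheses (mW : forall t : R, 0 <= t -> measurable_fun setT (W t)).
Local Notation Ex f := (Rintegral P setT f).

Lemma le_Ex_atoms n (t : nat -> R) (f h : T -> R) : (forall k, 0 <= t k) ->
  bmeas f -> bmeas h ->
  (forall a, (forall k, I (a k)) ->
    Ex (fun w => \1_(passes W n t a) w * f w) <= Ex (fun w => \1_(passes W n t a) w * h w)) ->
  Ex f <= Ex h.
Proof.
move=> t0 bf bh fh; have [c cc] := elimT (countable_injP _) cI.
pose V w : nat := pickle [seq c (W (t k) w) | k <- iota 0 n.+1].
have VE w0 : V @^-1` [set V w0] = passes W n t (fun k => W (t k) w0).
  apply/seteqP; split=> w.
    move=> /(pcan_inj pickleK) /eq_in_map H k kn.
    have : k \in iota 0 n.+1 by rewrite mem_iota.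
    by move=> /H /cc; apply; rewrite inE; exact: WI.
  move=> H; congr pickle; apply/eq_in_map => k; rewrite mem_iota /= add0n => kn.
  by rewrite (H k kn).
have [/= ne|ne] := pselect (exists w : T, True); last first.
  rewrite le_eqVlt; apply/orP; left; apply/eqP/eq_Ex => w.
  by case: ne; exists w.
have fiber v : (exists w0, V w0 = v) \/ (V @^-1` [set v] = set0).
  have [H|H] := pselect (exists w0, V w0 = v); [by left|right].
  by rewrite -subset0 => w Vw; apply: H; exists w.
apply: (@le_Ex_partition _ _ _ P V) => // v.
  have [[w0 <-]|->] := fiber v; last exact: measurable0.
  by rewrite VE; apply: measurable_passes => k _; exact: mW.
have [[w0 <-]|->] := fiber v.
  by rewrite VE; apply: fh => k; exact: WI.
by rewrite le_eqVlt; apply/orP; left; apply/eqP/eq_Ex => w; rewrite !indicE !in_set0 !mul0r.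
Qed.

Lemma abs_Ex_atoms n (t : nat -> R) (f h : T -> R) : (forall k, 0 <= t k) ->
  bmeas f -> bmeas h ->
  (forall a, (forall k, I (a k)) ->
    `|Ex (fun w => \1_(passes W n t a) w * f w)| <= Ex (fun w => \1_(passes W n t a) w * h w)) ->
  `|Ex f| <= Ex h.
Proof.
move=> t0 bf bh fh; rewrite ler_norml lerNl -ExN//.
apply/andP; split; apply: (le_Ex_atoms t0) => //.
- exact: bmeasN.
- move=> a Ia; apply: le_trans (fh a Ia); rewrite -normrN -ExN.
    by apply: le_trans (ler_norm _); rewrite le_eqVlt; apply/orP; left; apply/eqP/eq_Ex => w; rewrite mulrN.
  by apply: bmeasM => //; apply: bmeas_ind; apply: measurable_passes => k _; exact: mW.
- by move=> a Ia; apply: le_trans (fh a Ia); rewrite ler_norm.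
Qed.

End Atoms.

Section Euler.
Context {R : realType}.
Variables (I : set R) (Es : seq R) (q : R -> R -> R -> R) (Jl : seq R) (b : R) (pi : R -> R).
Hypothesis bQ : forall y, y \in Es -> bounded_rates I (q y) Jl b.
Hypotheses (pi0 : forall y, y \in Es -> 0 <= pi y) (pi1 : \sum_(y <- Es) pi y = 1).

Definition mean_generator (u : R -> R) (c : R) : R :=
  \sum_(y <- Es) pi y * generator I (q y) Jl u c.

(** One step of the explicit Euler scheme for the averaged dynamics, acting on
    functionals of the list of the states visited so far; the value [0] outside
    the state space keeps it bounded. *)
Definition euler (del : R) (Psi : seq R -> R) (s : seq R) : R :=
  if `[< I (last 0 s) >] then
    Psi (rcons s (last 0 s)) + del * mean_generator (fun z => Psi (rcons s z)) (last 0 s)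
  else 0.

(** For [del * b <= 1] a step of the scheme averages over the next state with
    nonnegative weights of total mass [1]. *)
Lemma euler_bound (del : R) Psi : 0 <= del -> del * b <= 1 -> (forall s, `|Psi s| <= 1) ->
  forall s, `|euler del Psi s| <= 1.
Proof.
move=> del0 delb Psi1 s; rewrite /euler; case: asboolP => Ic; last by rewrite normr0.
set c := last 0 s in Ic *; pose u z := Psi (rcons s z).
pose r y : R := \sum_(j <- Jl) jump_rate I (q y) c j.
have r0 y j : y \in Es -> j \in Jl -> 0 <= jump_rate I (q y) c j.
  by move=> yE jJ; have [H _ _] := bQ yE Ic; exact: H.
have rb y : y \in Es -> r y <= b by move=> yE; have [_ _ H] := bQ yE Ic.
have genE : mean_generator u c =
    \sum_(y <- Es) pi y * (\sum_(j <- Jl) jump_rate I (q y) c j * u (c + j)) - (\sum_(y <- Es) pi y * r y) * u c.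
  rewrite mulr_suml -sumrB; apply: eq_bigr => y _.
  rewrite -mulrA -mulrBr /r mulr_suml -sumrB; congr (_ * _).
  by apply: eq_bigr => j _; rewrite mulrBr.
set rho := \sum_(y <- Es) pi y * r y in genE.
have rho0 : 0 <= rho.
  rewrite /rho big_seq; apply: sumr_ge0 => y yE; apply: mulr_ge0; first exact: pi0.
  by rewrite /r big_seq; apply: sumr_ge0 => j jJ; exact: r0.
have rhob : rho <= b.
  rewrite -[leRHS]mul1r -pi1 mulr_suml /rho big_seq [leRHS]big_seq.
  by apply: ler_sum => y yE; apply: ler_wpM2l; [exact: pi0|exact: rb].
set V := \sum_(y <- Es) pi y * _ in genE.
have Vr : `|V| <= rho.
  apply: le_trans (ler_norm_sum _ _ _) _; rewrite /rho big_seq [leRHS]big_seq.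
  apply: ler_sum => y yE; rewrite normrM ger0_norm ?pi0// ler_wpM2l ?pi0//.
  apply: le_trans (ler_norm_sum _ _ _) _; rewrite /r big_seq [leRHS]big_seq.
  apply: ler_sum => j jJ; rewrite normrM ger0_norm ?r0//.
  by rewrite ler_piMr ?r0//; exact: Psi1.
have delrho : del * rho <= 1 by apply: le_trans delb; exact: ler_wpM2l.
rewrite -/(u c) genE (_ : u c + del * (V - rho * u c) = (1 - del * rho) * u c + del * V); last by ring.
apply: le_trans (ler_normD _ _) _; rewrite !normrM (ger0_norm del0) ger0_norm; last by rewrite subr_ge0.
have h1 : (1 - del * rho) * `|u c| <= 1 - del * rho by rewrite ler_piMr ?subr_ge0//; exact: Psi1.
have h2 : del * `|V| <= del * rho by exact: ler_wpM2l.
lra.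
Qed.

End Euler.

Section EulerProcess.
Context {d : measure_display} {T : measurableType d} {R : realType}.
Variables (P : probability T R) (I : set R) (W : R -> T -> R).
Variables (Es : seq R) (q : R -> R -> R -> R) (Jl : seq R) (b : R) (pi : R -> R).
Hypothesis bQ : forall y, y \in Es -> bounded_rates I (q y) Jl b.
Hypotheses (pi0 : forall y, y \in Es -> 0 <= pi y) (pi1 : \sum_(y <- Es) pi y = 1).
Hypotheses (cI : countable I) (WI : forall (t : R) w, 0 <= t -> I (W t w)).
Hypotheses (mW : forall t : R, 0 <= t -> measurable_fun setT (W t)).
Local Notation Ex f := (Rintegral P setT f).
Variables (del : R) (err : nat -> T -> R).
Hypotheses (del0 : 0 <= del) (delb : del * b <= 1) (berr : forall m, bmeas (err m)).
Let tt (k : nat) : R := k%:R * del.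
Local Notation L := (mean_generator I Es q Jl pi).

Definition grid_path m w : seq R := [seq W (k%:R * del) w | k <- iota 0 m.+1].

Hypothesis step : forall m a (u : R -> R), (forall k, I (a k)) -> (forall z, `|u z| <= 1) ->
  `|Ex (fun w => \1_(passes W m tt a) w * (u (W (tt m.+1) w) - (u (a m) + del * L u (a m))))| <=
  Ex (fun w => \1_(passes W m tt a) w * err m w).

Let tt0 k : 0 <= tt k. Proof. by rewrite mulr_ge0. Qed.

Lemma grid_pathS m w : grid_path m.+1 w = rcons (grid_path m w) (W (tt m.+1) w).
Proof. by rewrite /grid_path -[in LHS]addn1 iotaD map_cat /= add0n cats1. Qed.

Lemma bmeas_grid_path m (Psi : seq R -> R) : (forall s, `|Psi s| <= 1) ->
  bmeas (fun w => Psi (grid_path m w)).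
Proof.
move=> Psi1; apply: (@bmeas_seq _ _ _ I cI (fun k => W (tt k)) m.+1 Psi 1) => //.
- by move=> k w; exact: WI.
- by move=> k; exact: mW.
Qed.

Lemma euler_step m (Psi : seq R -> R) : (forall s, `|Psi s| <= 1) ->
  `|Ex (fun w => Psi (grid_path m.+1 w)) - Ex (fun w => euler I Es q Jl pi del Psi (grid_path m w))| <=
  Ex (err m).
Proof.
move=> Psi1; have eb := euler_bound bQ pi0 pi1 del0 delb Psi1.
have b1 : bmeas (fun w => Psi (grid_path m.+1 w)) by exact: bmeas_grid_path.
have b2 : bmeas (fun w => euler I Es q Jl pi del Psi (grid_path m w)) by exact: bmeas_grid_path eb.
rewrite -ExB//; apply: (abs_Ex_atoms cI WI mW (n := m) tt0) => //; first exact: bmeasB.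
move=> a Ia; pose s := [seq a k | k <- iota 0 m.+1].
have sl : last 0 s = a m.
  by rewrite /s -addn1 iotaD map_cat /= add0n last_cat.
have := @step m a (fun z => Psi (rcons s z)) Ia (fun z => Psi1 _).
apply: le_trans; rewrite le_eqVlt; apply/orP; left; apply/eqP; congr `|_|; apply: eq_Ex => w.
have [Aw|nA] := pselect (passes W m tt a w); last by rewrite (indic_notin nA) !mul0r.
have gs : grid_path m w = s.
  by apply/eq_in_map => k; rewrite mem_iota /= add0n => km; exact: Aw.
by rewrite grid_pathS gs /euler sl asboolT.
Qed.

(** The moves of the process are replaced by steps of the scheme from the last
    one backwards; the errors just add up because, by [euler_bound], the scheme
    does not increase bounds. *)
Lemma euler_iter m (Psi : seq R -> R) : (forall s, `|Psi s| <= 1) ->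
  `|Ex (fun w => Psi (grid_path m w)) - Ex (fun w => iter m (euler I Es q Jl pi del) Psi (grid_path 0 w))| <=
  \sum_(k < m) Ex (err k).
Proof.
elim: m Psi => [|m IHm] Psi Psi1; first by rewrite subrr normr0 big_ord0.
have eb := euler_bound bQ pi0 pi1 del0 delb Psi1.
have h1 := IHm _ eb; have h2 := euler_step m Psi1.
rewrite (iterSr m (euler I Es q Jl pi del) Psi) big_ord_recr [leRHS]addrC.
exact: le_trans (ler_distD _ _ _) (lerD h2 h1).
Qed.

Lemma euler_iter_start m (Psi : seq R -> R) x0 : (forall s, `|Psi s| <= 1) ->
  {ae P, forall w, W 0 w = x0} ->
  `|Ex (fun w => Psi (grid_path m w)) - iter m (euler I Es q Jl pi del) Psi [:: x0]| <=
  \sum_(k < m) Ex (err k).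
Proof.
move=> Psi1 W0; apply: le_trans (euler_iter m Psi1); rewrite le_eqVlt; apply/orP; left; apply/eqP.
have ib : forall s, `|iter m (euler I Es q Jl pi del) Psi s| <= 1.
  by elim: m => [|m IHm] //=; apply: (euler_bound bQ pi0 pi1 del0 delb).
congr (`|_ - _|); rewrite -(Ex_cst P (iter m _ _ _)); apply: ae_eq_Ex.
- exact: bmeas_cst.
- exact: bmeas_grid_path.
by apply: filterS W0 => w W0; rewrite /grid_path /= mul0r W0.
Qed.

End EulerProcess.

(** * Two changes inside one mesh are unlikely *)

Lemma first_change {R : realType} (f : nat -> R) i j : (i <= j)%N -> f i <> f j ->
  exists2 l, (i <= l < j)%N & f l != f l.+1.
Proof.
move=> ij ne; apply: contrapT => nl; apply: ne.
elim: j ij nl => [|j IHj]; first by rewrite leqn0 => /eqP->.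
rewrite leq_eqVlt => /predU1P[->//|]; rewrite ltnS => ij nl.
rewrite IHj//; first last.
  by move=> [l /andP[il lj] ne]; apply: nl; exists l; rewrite // il leqW.
by apply/eqP/negPn/negP => ne; apply: nl; exists j; rewrite // ij/=.
Qed.

Section Goodness.
Context {d : measure_display} {T : measurableType d} {R : realType}.
Variables (P : probability T R) (I : set R) (X : R -> T -> R) (b : R).
Local Notation Ex f := (Rintegral P setT f).
Hypotheses (cI : countable I) (b0 : 0 <= b).
Hypotheses (XI : forall (t : R) w, 0 <= t -> I (X t w)).
Hypotheses (mX : forall t : R, 0 <= t -> measurable_fun setT (X t)).
Hypothesis stay : forall n (t a : nat -> R) (h : R),
  (forall k, t k <= t k.+1) -> 0 <= t 0%N -> (forall k, I (a k)) -> 0 <= h ->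
  Ex (fun w => \1_(passes X n t a) w * (X (t n) w != X (t n + h) w)%:R) <=
  b * h * Ex \1_(passes X n t a).

Let bmeas_neq (s s' : R) : 0 <= s -> 0 <= s' -> bmeas (fun w => (X s w != X s' w)%:R : R).
Proof.
move=> s0 s'0; apply: (@bmeas_pair _ _ _ I cI _ _ (fun x z => (x != z)%:R) 1) => //.
- by move=> w; exact: XI.
- by move=> w; exact: XI.
- exact: mX.
- exact: mX.
- by move=> x z; case: (_ != _); rewrite ?normr1 ?normr0.
Qed.

Lemma stay_once (s h : R) : 0 <= s -> 0 <= h -> Ex (fun w => (X s w != X (s + h) w)%:R) <= b * h.
Proof.
move=> s0 h0; rewrite -(Ex_cst P (b * h)).
have sh0 : 0 <= s + h by rewrite addr_ge0.
apply: (le_Ex_atoms cI XI mX (n := 0) (t := fun=> s)) => //.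
- exact: bmeas_neq.
- exact: bmeas_cst.
move=> a Ia; have H := @stay 0 (fun=> s) a h (fun=> lexx _) s0 Ia h0; apply: le_trans H _.
rewrite -ExZ; last by apply: bmeas_ind; apply: measurable_passes => k _; exact: mX.
by rewrite le_eqVlt; apply/orP; left; apply/eqP/eq_Ex => w; rewrite mulrC.
Qed.

(** Whatever happened before, the second change has conditional probability at
    most [b * h']. *)
Lemma stay_twice (s h u h' : R) : 0 <= s -> 0 <= h -> s + h <= u -> 0 <= h' ->
  Ex (fun w => (X s w != X (s + h) w)%:R * (X u w != X (u + h') w)%:R) <= b * h * (b * h').
Proof.
move=> s0 h0 su h'0.
have sh0 : 0 <= s + h by rewrite addr_ge0.
have u0 : 0 <= u by exact: le_trans su.
have uh0 : 0 <= u + h' by rewrite addr_ge0.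
have bs := bmeas_neq s0 sh0; have bu := bmeas_neq u0 uh0.
apply: (@le_trans _ _ (b * h' * Ex (fun w => (X s w != X (s + h) w)%:R))); last first.
  by rewrite mulrC ler_wpM2r ?mulr_ge0//; exact: stay_once.
rewrite -ExZ//.
pose t k := if k is k'.+1 then if k' is _.+1 then u else s + h else s.
have t0 k : 0 <= t k by case: k => [|[|]].
apply: (le_Ex_atoms cI XI mX (n := 2) t0); [exact: bmeasM|exact: bmeasZ|].
move=> a Ia; pose A := passes X 2 t a; rewrite -/A.
have bA : bmeas (\1_A : T -> R) by apply: bmeas_ind; apply: measurable_passes => k _; exact: mX.
have AE w : \1_A w * (X s w != X (s + h) w)%:R = \1_A w * (a 0%N != a 1%N)%:R :> R.
  have [Aw|nA] := pselect (A w); last by rewrite (indic_notin nA) !mul0r.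
  by have /= -> := Aw 0%N isT; have /= -> := Aw 1%N isT.
rewrite (@eq_Ex _ _ _ P _ (fun w => (a 0%N != a 1%N)%:R * (\1_A w * (X u w != X (u + h') w)%:R))); last first.
  by move=> w; rewrite (mulrA (\1_A w)) AE (mulrC (\1_A w)) -mulrA.
rewrite (@eq_Ex _ _ _ P (fun w => \1_A w * (b * h' * _)) (fun w => (a 0%N != a 1%N)%:R * (b * h') * \1_A w)); last first.
  by move=> w; rewrite mulrCA AE mulrA [LHS]mulrC mulrC; ring.
rewrite !ExZ//; last exact: bmeasM.
rewrite -(mulrA (_ != _)%:R); case: (a 0%N != _); last by rewrite !mul0r.
rewrite !mul1r; apply: (@stay 2 t) => //.
by move=> [|[|k]] //=; rewrite lerDl.
Qed.

(** Two grid points at one dyadic level, the earlier one witnessing that the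
    initial value has been left and the later one that the final value is not
    yet reached. *)
Definition bad_cell_at (s s' : R) m : set T :=
  [set w | exists i j, [/\ (i <= j <= 2 ^ m)%N, X (dyadic_pt s s' m i) w <> X s w &
     X (dyadic_pt s s' m j) w <> X s' w]].

Definition bad_cell s s' : set T := \bigcup_m bad_cell_at s s' m.

Lemma measurable_neq (s s' : R) : 0 <= s -> 0 <= s' -> measurable [set w | X s w <> X s' w].
Proof.
move=> s0 s'0; rewrite (_ : [set w | _] = ~` [set w | X s w == X s' w]).
  apply: measurableC; rewrite -[X in measurable X]setTI.
  by apply: measurable_fun_eqr => //; exact: mX.
apply/seteqP; split=> w /=.
  by move=> ne /eqP.
by move=> /negP/eqP.
Qed.

Lemma measurable_bad_cell_at s s' m : 0 <= s -> s <= s' -> measurable (bad_cell_at s s' m).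
Proof.
move=> s0 ss'; have p0 k : 0 <= dyadic_pt s s' m k by exact: le_trans (dyadic_pt_ge _ _ ss').
have s'0 := le_trans s0 ss'.
rewrite (_ : bad_cell_at s s' m = \bigcup_i \bigcup_j if (i <= j <= 2 ^ m)%N then
    [set w | X (dyadic_pt s s' m i) w <> X s w] `&` [set w | X (dyadic_pt s s' m j) w <> X s' w]
    else set0).
  apply: bigcupT_measurable => i; apply: bigcupT_measurable => j; case: ifP => // _.
  by apply: measurableI; exact: measurable_neq.
apply/seteqP; split=> w /=; first by move=> [i [j [H ? ?]]]; exists i => //; exists j; rewrite // H.
by move=> [i _ [j _]]; case: ifP => // H [? ?]; exists i, j.
Qed.

Lemma measurable_bad_cell s s' : 0 <= s -> s <= s' -> measurable (bad_cell s s').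
Proof. by move=> s0 ss'; apply: bigcupT_measurable => m; exact: measurable_bad_cell_at. Qed.

Lemma bad_cell_at_nd s s' m n : (m <= n)%N -> bad_cell_at s s' m `<=` bad_cell_at s s' n.
Proof.
move=> /subnK <-; elim: (n - m)%N => [|k IHk] // w /IHk [i [j [/andP[ij jk] iZ jZ]]].
exists i.*2, j.*2; rewrite addSn -!dyadic_ptS; split=> //.
by rewrite expnS mul2n !leq_double ij.
Qed.

(** Two distinct steps of the level see a change. There are fewer than [4 ^ m]
    pairs of steps, and each pair has probability at most
    [(b * (s' - s) / 2 ^ m) ^ 2], so that the bound does not depend on [m]. *)
Lemma bad_cell_at_le s s' m : 0 <= s -> s <= s' ->
  Ex \1_(bad_cell_at s s' m) <= b ^+ 2 * (s' - s) ^+ 2.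
Proof.
move=> s0 ss'; set h := (s' - s) / 2 ^+ m.
have dS k : dyadic_pt s s' m k.+1 = dyadic_pt s s' m k + h.
  by rewrite /dyadic_pt -natr1 /h; ring.
have h0 : 0 <= h by rewrite divr_ge0// ?subr_ge0// exprn_ge0.
have p0 k : 0 <= dyadic_pt s s' m k by exact: le_trans (dyadic_pt_ge _ _ ss').
have ple i j : (i <= j)%N -> dyadic_pt s s' m i <= dyadic_pt s s' m j.
  by move=> ij; rewrite lerD2l ler_wpM2r// ler_nat.
pose ch k w : R := (X (dyadic_pt s s' m k) w != X (dyadic_pt s s' m k + h) w)%:R.
have ch0 k w : 0 <= ch k w by [].
have bch k : bmeas (ch k) by apply: bmeas_neq => //; rewrite -dS.
pose pr (i j : 'I_(2 ^ m)) w := if (i < j)%N then ch i w * ch j w else 0.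
have bpr i j : bmeas (pr i j) by rewrite /pr; case: (i < j)%N; [exact: bmeasM|exact: bmeas_cst].
have pr0 i j w : 0 <= pr i j w by rewrite /pr; case: ifP => // _; rewrite mulr_ge0.
apply: (@le_trans _ _ (Ex (fun w => \sum_(i < 2 ^ m) \sum_(j < 2 ^ m) pr i j w))).
  apply: le_Ex.
  - by apply: bmeas_ind; exact: measurable_bad_cell_at.
  - by apply: bmeas_sum => i; exact: bmeas_sum.
  move=> w; have [Bw|nB] := pselect (bad_cell_at s s' m w); last first.
    by rewrite (indic_notin nB); apply: sumr_ge0 => i _; exact: sumr_ge0.
  rewrite (indic_in Bw); case: Bw => i [j [/andP[ij jm] iX jX]].
  pose f k := X (dyadic_pt s s' m k) w.
  have f0 : f 0%N = X s w by rewrite /f /dyadic_pt mul0r addr0.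
  have f1 : f (2 ^ m)%N = X s' w.
    by rewrite /f /dyadic_pt natrX mulrC divfK ?expf_neq0// addrC subrK.
  have [i' /andP[_ i'i] ci] : exists2 l, (0 <= l < i)%N & f l != f l.+1.
    by apply: first_change => //; rewrite f0 => /esym.
  have [j' /andP[jj' j'm] cj] : exists2 l, (j <= l < 2 ^ m)%N & f l != f l.+1.
    by apply: first_change => //; rewrite f1.
  have i'j' : (i' < j')%N by exact: leq_trans i'i (leq_trans ij jj').
  have i'm : (i' < 2 ^ m)%N by exact: ltn_trans j'm.
  rewrite (bigD1 (Ordinal i'm))//= (bigD1 (Ordinal j'm))//= {1}/pr /= i'j' /ch -!dS.
  rewrite -/(f i') -/(f i'.+1) -/(f j') -/(f j'.+1) ci cj mulr1 -addrA lerDl addr_ge0//.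
    by apply: sumr_ge0.
  by apply: sumr_ge0 => k _; apply: sumr_ge0.
rewrite Ex_sum; last by move=> i; exact: bmeas_sum.
apply: (@le_trans _ _ (\sum_(i < 2 ^ m) \sum_(j < 2 ^ m) b * h * (b * h))).
  apply: ler_sum => i _; rewrite Ex_sum//; apply: ler_sum => j _.
  have bh : 0 <= b * h * (b * h) by apply: mulr_ge0; exact: mulr_ge0.
  have [ij|ji] := boolP (i < j)%N; last first.
    by rewrite (@eq_Ex _ _ _ P _ (fun=> 0)) ?Ex_cst// => w; rewrite /pr (negPf ji).
  rewrite (@eq_Ex _ _ _ P _ (fun w => ch i w * ch j w)) => [|w]; last by rewrite /pr ij.
  by apply: stay_twice => //; rewrite -dS; exact: ple.
have c0 : 2 ^+ m != 0 :> R by rewrite expf_neq0.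
rewrite !sumr_const !card_ord -(mulr_natr (_ * _)) -(mulr_natr (_ * _ * _)) natrX /h; move: (2 ^+ m) c0 => c c0.
by rewrite le_eqVlt; apply/orP; left; apply/eqP; field.
Qed.

Lemma bad_cell_le s s' : 0 <= s -> s <= s' ->
  Ex \1_(bad_cell s s') <= b ^+ 2 * (s' - s) ^+ 2.
Proof.
move=> s0 ss'.
have c : Ex \1_(bad_cell_at s s' m) @[m --> \oo] --> Ex \1_(bad_cell s s').
  apply: (@Ex_cvg _ _ _ P _ _ 1).
  - by move=> m; apply: bmeas_ind; exact: measurable_bad_cell_at.
  - by apply: bmeas_ind; exact: measurable_bad_cell.
  - by move=> m w; rewrite indicE; case: (_ \in _); rewrite ?normr0 ?normr1.
  apply: aeW => w; apply: cvg_near_cst.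
  have [[n _ Vn]|nV] := pselect (bad_cell s s' w).
    near=> m; rewrite !indic_in//; first by exists n.
    apply: bad_cell_at_nd Vn; near: m; exact: nbhs_infty_ge.
  near=> m; rewrite !indic_notin// => Vm; apply: nV.
  by exists m.
apply: (ler_cvg_to c (cvg_cst _)); apply: nearW => m; exact: bad_cell_at_le.
Unshelve. all: by end_near. Qed.

(** By right-continuity, two observations that violate the conclusion would be
    visible at a common dyadic level. *)
Lemma good_cell s s' w : cadlag (X ^~ w) -> 0 <= s -> s < s' -> ~ bad_cell s s' w ->
  forall u v, s <= u -> u <= v -> v <= s' -> X u w = X s w \/ X v w = X s' w.
Proof.
move=> cX s0 ss' nB u v su uv vs'; apply: contrapT => /not_orP[ne ne'].
have {}vs' : v < s' by rewrite lt_neqAle vs' andbT; apply/eqP => E; apply: ne'; rewrite E.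
have u0 : 0 <= u by exact: le_trans su.
have [n1 n10 H1] : exists2 n : R, 0 < n & forall z, u <= z < u + n -> X z w <> X s w.
  have e0 : 0 < `|X u w - X s w| by rewrite normr_gt0 subr_eq0; exact/eqP.
  have [n n0 H] := cadlag_right cX u0 e0; exists n => // z /H Hz E.
  by move: Hz; rewrite E distrC ltxx.
have [n2 n20 H2] : exists2 n : R, 0 < n & forall z, v <= z < v + n -> X z w <> X s' w.
  have e0 : 0 < `|X v w - X s' w| by rewrite normr_gt0 subr_eq0; exact/eqP.
  have [n n0 H] := cadlag_right cX (le_trans u0 uv) e0; exists n => // z /H Hz E.
  by move: Hz; rewrite E distrC ltxx.
have [e [e0 e1 e2]] : exists e : R, [/\ 0 < e, e <= n1 & e <= n2].
  by exists (Num.min n1 n2); rewrite lt_min n10 n20 !ge_min !lexx orbT.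
have sp : 0 < s' - s by rewrite subr_gt0.
have [m hm] : exists m, (s' - s) / 2 ^+ m < e.
  exists (Num.truncn ((s' - s) / e)).
  rewrite ltr_pdivrMr ?exprn_gt0// mulrC -ltr_pdivrMr//.
  have /andP[_ h] := @truncn_itv R _ (ltW (divr_gt0 sp e0)).
  apply: lt_le_trans h _; rewrite -natrX ler_nat; exact: ltn_expl.
set h := _ / _ in hm; have h0 : 0 < h by rewrite divr_gt0// exprn_gt0.
have kS k : k.+1%:R * h = k%:R * h + h by rewrite -natr1 mulrDl mul1r.
have [i /andP[i1 i2]] : exists k : nat, k%:R * h <= u - s < k.+1%:R * h.
  by apply: grid_floor => //; rewrite subr_ge0.
have [j /andP[j1 j2]] : exists k : nat, k%:R * h <= v - s < k.+1%:R * h.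
  by apply: grid_floor => //; rewrite subr_ge0; exact: le_trans uv.
apply: nB; exists m => //; exists i.+1, j.+1; split.
- apply/andP; split.
    by rewrite ltnS -ltnS -(@ltr_nat R) -(ltr_pM2r h0); lra.
  rewrite -(@ltr_nat R) natrX -(ltr_pM2r h0).
  have -> : 2 ^+ m * h = s' - s by rewrite /h mulrC divfK// expf_neq0.
  lra.
- by apply: H1; rewrite /dyadic_pt -/h; apply/andP; split; lra.
- by apply: H2; rewrite /dyadic_pt -/h; apply/andP; split; lra.
Qed.

Definition bad_grid w N : set T := \bigcup_(k < N) bad_cell (k%:R * w) (k.+1%:R * w).

Lemma measurable_bad_grid w N : 0 <= w -> measurable (bad_grid w N).
Proof.
move=> w0; apply: bigcup_measurable => k _; apply: measurable_bad_cell; first by rewrite mulr_ge0.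
by rewrite ler_wpM2r// ler_nat.
Qed.

Lemma bad_grid_le w N : 0 <= w -> Ex \1_(bad_grid w N) <= N%:R * (b ^+ 2 * w ^+ 2).
Proof.
move=> w0.
have mk k : measurable (bad_cell (k%:R * w) (k.+1%:R * w)).
  by apply: measurable_bad_cell; rewrite ?mulr_ge0// ler_wpM2r// ler_nat.
apply: (@le_trans _ _ (Ex (fun t => \sum_(k < N) \1_(bad_cell (k%:R * w) (k.+1%:R * w)) t))).
  apply: le_Ex; first by apply: bmeas_ind; exact: measurable_bad_grid.
    by apply: bmeas_sum => k; exact: bmeas_ind.
  move=> t; have [[k kN Bk]|nB] := pselect (bad_grid w N t); last first.
    by rewrite (indic_notin nB) sumr_ge0// => k _; exact: indic_ge0.
  rewrite indic_in; last by exists k.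
  rewrite (bigD1 (Ordinal kN))//= (indic_in Bk) lerDl sumr_ge0// => l _; exact: indic_ge0.
rewrite Ex_sum; last by move=> k; exact: bmeas_ind.
rewrite (_ : N%:R * _ = \sum_(k < N) b ^+ 2 * w ^+ 2); last by rewrite sumr_const card_ord mulr_natl.
apply: ler_sum => k _; apply: le_trans (bad_cell_le _ _) _; rewrite ?mulr_ge0//.
  by rewrite ler_wpM2r// ler_nat.
by rewrite -natr1 (_ : _ - _ = w)//; ring.
Qed.

Lemma bad_grid_switch w N t : cadlag (X ^~ t) -> 0 < w -> ~ bad_grid w N t ->
  one_switch w N (X ^~ t).
Proof.
move=> cX w0 nB k kN s s' ks ss' s'k; apply: (@good_cell (k%:R * w) (k.+1%:R * w)) => //.
- by rewrite mulr_ge0// ltW.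
- by rewrite ltr_pM2r// ltr_nat.
- by move=> Bk; apply: nB; exists k.
Qed.

End Goodness.

(** * Occupation times of the environment *)

Lemma sum_uniq_le1 {R : realType} N (p : nat -> bool) :
  (forall k l, p k -> p l -> k = l) -> \sum_(k < N) (p k)%:R <= 1 :> R.
Proof.
move=> pu; have [[k kN pk]|np] := pselect (exists2 k, (k < N)%N & p k).
  rewrite (bigD1 (Ordinal kN))//= pk big1 ?addr0// => l lk.
  by case: (boolP (p l)) => // pl; case/eqP: lk; apply/val_inj; exact: pu.
rewrite big1 ?ler01// => k _; case: (boolP (p k)) => // pk.
by case: np; exists k.
Qed.

Section Occupation.
Context {R : realType}.
Variables (E : set R) (y : R -> R) (g : nat -> \bar R).
Hypotheses (finE : finite_set E) (cy : cadlag y) (yE : forall t, 0 <= t -> E (y t)).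
Hypothesis jg : jump_times y g.

Lemma unsteady_count (tau h : R) N m : 0 <= tau -> 0 <= h -> ((tau + N%:R * h)%:E < g m)%E ->
  \sum_(k < N) (~~ `[< exists i, (g i <= (tau + k%:R * h)%:E)%E /\
      ((tau + k%:R * h + h)%:E < g i.+1)%E >])%:R <= m%:R :> R.
Proof.
move=> tau0 h0 gm.
pose p j (k : nat) := ((tau + k%:R * h)%:E < g j)%E && (g j <= (tau + k%:R * h + h)%:E)%E.
have sk k : k.+1%:R * h = k%:R * h + h by rewrite -natr1; ring.
have pu j k l : p j k -> p j l -> k = l.
  wlog: k l / (k <= l)%N => [H pk pl|].
    by case/orP: (leq_total k l) => H'; [exact: H|apply/esym/H].
  rewrite leq_eqVlt => /predU1P[//|kl] /andP[_ pk] /andP[pl _].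
  have := lt_le_trans pl pk; rewrite lte_fin -addrA -sk ltrD2l => H.
  by have := lt_le_trans H (ler_wpM2r h0 (_ : k.+1%:R <= l%:R)); rewrite ler_nat ltxx => /(_ kl).
apply: (@le_trans _ _ (\sum_(k < N) \sum_(j < m) (p j k)%:R)).
  apply: ler_sum => k _; case: asboolP => [_|ns] /=; first by rewrite sumr_ge0.
  have s0 : 0 <= tau + k%:R * h by rewrite addr_ge0// mulr_ge0.
  have [i [i1 i2]] := jump_seg finE cy yE jg s0.
  have i3 : (g i.+1 <= (tau + k%:R * h + h)%:E)%E.
    by rewrite leNgt; apply/negP => H; apply: ns; exists i.
  have im : (i.+1 < m)%N.
    rewrite ltnNge; apply/negP => mi; have := jump_le jg mi.
    apply/negP; rewrite -ltNge; apply: le_lt_trans gm; apply: le_trans i3 _.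
    by rewrite lee_fin -addrA -sk lerD2l ler_wpM2r// ler_nat.
  by rewrite (bigD1 (Ordinal im))//= /p i2 i3/= lerDl sumr_ge0.
rewrite exchange_big/=; apply: (@le_trans _ _ (\sum_(j < m) 1)).
  by apply: ler_sum => j _; exact/sum_uniq_le1/pu.
by rewrite sumr_const card_ord.
Qed.

(** Boundedly many jumps, each spoiling one cell of a vanishing mesh. *)
Lemma unsteady_cvg0 (tau del : R) : 0 <= tau -> 0 <= del ->
  del * mesh N * \sum_(k < N.+1) (~~ `[< exists i,
      (g i <= (tau + k%:R * (del * mesh N))%:E)%E /\
      ((tau + k%:R * (del * mesh N) + del * mesh N)%:E < g i.+1)%E >])%:R @[N --> \oo] --> (0 : R).
Proof.
move=> tau0 del0; have [m gm] := jump_unbounded finE cy yE jg (tau + del).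
apply: (@squeeze_cvgr _ _ _ _ (fun=> 0) (fun N => del * m%:R * mesh N)); last 2 first.
- exact: cvg_cst.
- rewrite -[X in _ --> X](mulr0 (del * m%:R)).
  by apply: cvgMl_tmp; exact: mesh_cvg0.
apply: nearW => N; have dm0 : 0 <= del * mesh N by rewrite mulr_ge0// ltW// mesh_gt0.
rewrite mulr_ge0 ?sumr_ge0//= (mulrAC del m%:R) ler_wpM2l//.
apply: unsteady_count => //.
by rewrite mulrCA meshK mulr1.
Qed.

Lemma measurable_level (c : R) : measurable [set s | 0 <= s /\ y s = c].
Proof.
have [g0 gS gy gc gj] := jg.
rewrite (_ : [set s | _] = \bigcup_i if y (fine (g i)) == c then
    [set s : R | (g i <= s%:E)%E] `&` [set s : R | (s%:E < g i.+1)%E] else set0).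
  apply: bigcupT_measurable => i; case: ifP => // _; apply: measurableI.
    rewrite (_ : [set s : R | _] = EFin @^-1` `[g i, +oo[%classic).
      by rewrite -[X in measurable X]setTI; apply: EFin_measurable => //; exact: emeasurable_itv.
    by apply/seteqP; split=> s /=; rewrite in_itv/= andbT.
  rewrite (_ : [set s : R | _] = EFin @^-1` `]-oo, g i.+1[%classic).
    by rewrite -[X in measurable X]setTI; apply: EFin_measurable => //; exact: emeasurable_itv.
  by apply/seteqP; split=> s /=; rewrite in_itv.
apply/seteqP; split=> s /=.
  move=> [s0 ysc]; have [i [i1 i2]] := jump_seg finE cy yE jg s0.
  by exists i => //; rewrite -(gc i s)// ysc eqxx.
move=> [i _]; case: ifP => // /eqP <- [/= i1 i2]; split; last exact: gc.
by rewrite -lee_fin; apply: le_trans i1; exact: (jump_ge0 jg).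
Qed.

(** Occupation time of the value [c], centred by the frequency [p]. *)
Definition occupation (c p t : R) : R :=
  \int[lebesgue_measure]_(s in `[0, t]) ((y s == c)%:R - p).

Lemma occupation_integrable (c p t : R) (D : set R) : measurable D -> D `<=` `[0, t] ->
  lebesgue_measure.-integrable D (EFin \o (fun s => (y s == c)%:R - p)).
Proof.
move=> mD Dt; apply: measurable_bounded_integrable => //.
- apply: (@le_lt_trans _ _ (lebesgue_measure (`[0, t]%classic : set R))).
    by apply: le_measure => //; rewrite inE.
  by rewrite lebesgue_measure_itv; case: ifP => _; rewrite ?ltry// -EFinB ltry.
- apply: (@eq_measurable_fun _ _ _ _ D (fun s => \1_[set s | 0 <= s /\ y s = c] s - p)).
    move=> s; rewrite inE => /Dt /=; rewrite in_itv/= => /andP[s0 _].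
    congr (_ - _); apply: indic_eq; split; first by move=> [_ ->].
    by move=> /eqP.
  apply: measurable_funB => //; apply: measurable_funTS; apply: measurable_indic; exact: measurable_level.
- exists (1 + `|p|); split; first by rewrite num_real.
  move=> M M1 s _; apply: le_trans (ltW M1); apply: le_trans (ler_normB _ _) _.
  by rewrite lerD2r; case: (_ == _); rewrite ?normr1 ?normr0.
Qed.

(** For the value [v] taken by the integrand at the left end, [C] can be [0] on
    an interval without jumps, and [1] in general. *)
Lemma occupation_increment (c p s t v C : R) : 0 <= s -> s <= t ->
  (forall u, s <= u <= t -> `|(y u == c)%:R - p - v| <= C) ->
  `|occupation c p t - occupation c p s - v * (t - s)| <= C * (t - s).
Proof.
move=> s0 st H.
have iT : lebesgue_measure.-integrable `[0, t] (EFin \o (fun s => (y s == c)%:R - p)).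
  exact: (@occupation_integrable c p t).
rewrite /occupation Rintegral_itvB//= ?bnd_simp//.
have sub : (`]s, t] : set R) `<=` `[0, t].
  by move=> u /=; rewrite !in_itv/= => /andP[su ->]; rewrite (le_trans s0 (ltW su)).
have mI : measurable (`]s, t]%classic : set R) by [].
have iI : lebesgue_measure.-integrable `]s, t] (EFin \o (fun s => (y s == c)%:R - p)).
  exact: (@occupation_integrable c p t).
have muI : fine (lebesgue_measure (`]s, t]%classic : set R)) = t - s.
  rewrite lebesgue_measure_itv /= lte_fin; case: ltP => //= ts.
  by apply/esym/eqP; rewrite subr_eq0 eq_le ts st.
have muI_lty : (lebesgue_measure (`]s, t]%classic : set R) < +oo)%E.
  by rewrite lebesgue_measure_itv; case: ifP => _; rewrite ?ltry// -EFinB ltry.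
have icst r : lebesgue_measure.-integrable `]s, t] (EFin \o (fun=> r : R)).
  by apply: measurable_bounded_integrable => //; exists `|r|; split; [exact: num_real|move=> M /ltW rM u _].
rewrite -muI -!Rintegral_cst// -RintegralB//.
have iB : lebesgue_measure.-integrable `]s, t] (EFin \o (fun s => (y s == c)%:R - p - v)).
  rewrite (_ : _ \o _ = EFin \o (fun s => (y s == c)%:R - (p + v))).
    exact: (@occupation_integrable c _ t).
  by apply/funext => u; rewrite /= opprD addrA.
apply: le_trans; first by apply: le_normr_Rintegral => //; exact: iB.
apply: le_Rintegral => //.
- exact: (integrable_norm iB).
- by move=> u /=; rewrite in_itv/= => /andP[su ut]; apply: H; rewrite ltW.
Qed.

End Occupation.

Lemma cvg_dist_le {R : realType} {K : Type} (F : set_system K) {FF : Filter F} (f r : K -> R) (l : R) :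
  (forall N, `|f N - l| <= r N) -> r N @[N --> F] --> (0 : R) -> f N @[N --> F] --> l.
Proof.
move=> fr r0; apply: (@squeeze_cvgr _ _ _ _ (fun N => l - r N) (fun N => l + r N)).
- by apply: nearW => N; have := fr N; rewrite ler_distl.
- by rewrite -[X in _ --> X]subr0; apply: cvgB => //; exact: cvg_cst.
- by rewrite -[X in _ --> X]addr0; apply: cvgD => //; exact: cvg_cst.
Qed.

Section SlowedOccupation.
Context {R : realType}.
Variables (E : set R) (y : R -> R) (g : nat -> \bar R) (e : R) (ge : nat -> \bar R).
Hypotheses (finE : finite_set E) (cy : cadlag y) (yE : forall t, 0 <= t -> E (y t)).
Hypotheses (jg : jump_times y g) (e0 : 0 < e) (jge : jump_times (fun t => y (t / e)) ge).
Hypotheses (cye : cadlag (fun t => y (t / e))).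

(** Centred occupation time of [c] by the path [fun t => y (t / e)] between
    [tau] and [tau + del], after a change of variables. *)
Definition slowed_occupation (c p tau del : R) : R :=
  e * (occupation y c p ((tau + del) / e) - occupation y c p (tau / e)).

Lemma occupation_cell (c p s h : R) : 0 <= s -> 0 <= h ->
  `|h * ((y (s / e) == c)%:R - p) - slowed_occupation c p s h| <=
  h * (~~ `[< exists i, (ge i <= s%:E)%E /\ ((s + h)%:E < ge i.+1)%E >])%:R.
Proof.
move=> s0 h0; set C := (~~ _)%:R; set v := _ - p.
have hE : (s + h) / e - s / e = h / e by rewrite -mulrBl addrC addKr.
have H : `|occupation y c p ((s + h) / e) - occupation y c p (s / e) - v * ((s + h) / e - s / e)| <=
    C * ((s + h) / e - s / e).
  apply: (occupation_increment finE cy yE jg).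
  - by rewrite divr_ge0// ltW.
  - by rewrite ler_pM2r ?invr_gt0// lerDl.
  move=> u /andP[su us]; rewrite /v /C; case: asboolP => [[i [i1 i2]]|_] /=.
    rewrite (_ : y u = y (s / e)) ?subrr ?normr0//.
    rewrite ler_pdivrMr// in su; rewrite ler_pdivlMr// in us.
    have := jump_const jge (s := u * e) (t := s) _ _ i1 _.
    rewrite mulfK ?gt_eqF//; apply.
    - by apply: le_trans i1 _; rewrite lee_fin.
    - by apply: le_lt_trans i2; rewrite lee_fin.
    - by apply: le_lt_trans i2; rewrite lee_fin lerDl.
  rewrite opprB addrA subrK.
  by case: (_ == c); case: (_ == c); rewrite ?subrr ?subr0 ?sub0r ?normrN ?normr1 ?normr0.
rewrite hE in H; have := ler_wpM2l (ltW e0) H.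
rewrite -{1}(gtr0_norm e0) -normrM -normrN.
rewrite [X in _ <= X -> _](_ : _ = h * C); last by field; rewrite gt_eqF.
apply: le_trans; rewrite le_eqVlt; apply/orP; left; apply/eqP; congr `|_|.
by rewrite /slowed_occupation; field; rewrite gt_eqF.
Qed.

Lemma slowed_occupation_bound (c p s h : R) : 0 <= s -> 0 <= h ->
  `|slowed_occupation c p s h| <= h * (2 + `|p|).
Proof.
move=> s0 h0; have H := occupation_cell c p s0 h0.
rewrite distrC in H; set b := (~~ _)%:R in H.
have b1 : b <= 1 by rewrite /b; case: (~~ _).
have v1 : `|h * ((y (s / e) == c)%:R - p)| <= h * (1 + `|p|).
  rewrite normrM (ger0_norm h0) ler_wpM2l//; apply: le_trans (ler_normB _ _) _.
  by rewrite lerD2r; case: (_ == _); rewrite ?normr1 ?normr0.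
have := ler_distD (h * ((y (s / e) == c)%:R - p)) (slowed_occupation c p s h) 0.
rewrite !subr0 => /le_trans; apply.
have : h * b <= h * 1 by rewrite ler_wpM2l.
have := ltac:(ring) : h * (2 + `|p|) = h * 1 + h * (1 + `|p|).
lra.
Qed.

(** The left Riemann sums are exact on the cells without jumps, and the other
    cells are negligible by [unsteady_cvg0]. *)
Lemma occupation_riemann (c p tau del : R) : 0 <= tau -> 0 <= del ->
  \sum_(k < N.+1) del * mesh N * ((y ((tau + k%:R * (del * mesh N)) / e) == c)%:R - p)
     @[N --> \oo] --> slowed_occupation c p tau del.
Proof.
move=> tau0 del0.
apply: (cvg_dist_le _ (unsteady_cvg0 finE cye _ jge tau0 del0)); last first.
  by move=> t t0; apply: yE; rewrite divr_ge0// ltW.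
move=> N; set h := del * mesh N.
have h0 : 0 <= h by rewrite mulr_ge0// ltW// mesh_gt0.
have -> : slowed_occupation c p tau del = \sum_(k < N.+1) slowed_occupation c p (tau + k%:R * h) h.
  pose G k := e * occupation y c p ((tau + k%:R * h) / e).
  rewrite (eq_bigr (fun k : 'I__ => G k.+1 - G k)).
    rewrite -(big_mkord xpredT (fun k => G k.+1 - G k)) telescope_sumr//.
    by rewrite /G mul0r addr0 /slowed_occupation /h mulrCA meshK mulr1 mulrBr.
  by move=> k _; rewrite /G /slowed_occupation mulrBr -(natr1 k) (mulrDl k%:R) mul1r addrA.
rewrite -sumrB; apply: le_trans (ler_norm_sum _ _ _) _.
rewrite mulr_sumr; apply: ler_sum => k _; apply: occupation_cell => //.
by rewrite addr_ge0// mulr_ge0.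
Qed.

End SlowedOccupation.

(** For a fixed time [s > 0], the occupation time up to [s] is [s] times the
    ergodic average up to [s / e n], a time that tends to infinity. *)
Lemma slowed_occupation_cvg0 {R : realType} (y : R -> R) (c p tau del : R) (e : nat -> R) :
  t^-1 * occupation y c p t @[t --> +oo] --> (0 : R) ->
  0 <= tau -> 0 <= del -> (forall n, 0 < e n) -> e n @[n --> \oo] --> (0 : R) ->
  slowed_occupation y (e n) c p tau del @[n --> \oo] --> (0 : R).
Proof.
move=> H tau0 del0 e0 ecvg.
have one s : 0 <= s -> e n * occupation y c p (s / e n) @[n --> \oo] --> (0 : R).
  rewrite le_eqVlt => /predU1P[<-|s0].
    have H0 : e n * occupation y c p 0 @[n --> \oo] --> 0 * occupation y c p 0 by exact: cvgMr_tmp.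
    by rewrite mul0r in H0; under eq_fun do rewrite mul0r; exact: H0.
  have dv : s / e n @[n --> \oo] --> +oo.
    have ey : (e n)^-1 @[n --> \oo] --> +oo by apply/cvgrVy => //; exact: nearW.
    apply/cvgryPge => A; move/cvgryPge/(_ (A / s)): ey; apply: filterS => n.
    by rewrite ler_pdivrMr// mulrC.
  have -> : (fun n => e n * occupation y c p (s / e n)) =
      (fun n => s * ((s / e n)^-1 * occupation y c p (s / e n))).
    apply/funext => n; rewrite invf_div mulrA; congr (_ * _).
    by rewrite mulrCA divff ?mulr1// gt_eqF.
  rewrite -[X in _ --> X](mulr0 s); apply: cvgMl_tmp.
  exact: (cvg_comp _ _ dv H).
rewrite /slowed_occupation; under eq_fun do rewrite mulrBr.
have := cvgB (one _ (addr_ge0 tau0 del0)) (one _ tau0); rewrite subr0; exact.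
Qed.

(** * Rates of the averaged chain *)

Section RatesOfIntensity.
Context {R : realType}.
Variables (I : set R) (Jl : seq R).
Hypotheses (uJ : uniq Jl) (J0 : 0 \notin Jl).

Lemma exit_rate_seq (Q : R -> R -> R) (a : R) : I a ->
  (forall i j, I i -> I j -> i != j -> 0 <= Q i j) ->
  (forall i j, I i -> I (i + j) -> j != 0 -> j \notin Jl -> Q i (i + j) = 0) ->
  exit_rate I Q a = (\sum_(j <- Jl) jump_rate I Q a j)%:E.
Proof.
move=> Ia Q0 QJ; pose s := [seq a + j | j <- Jl & `[< I (a + j) >]].
have us : uniq s by rewrite map_inj_uniq ?filter_uniq//; exact: addrI.
have sI k : k \in s -> (I `\ a) k.
  move=> /mapP[j]; rewrite mem_filter => /andP[/asboolP Ij jJ] ->; split=> //= E.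
  by move: J0; rewrite -(_ : j = 0) ?jJ//; apply: (addrI a); rewrite addr0.
rewrite /exit_rate (eq_esum (b := fun k => if k \in [set` s] then (Q a k)%:E else 0%E)); last first.
  move=> k [Ik ka]; case: ifPn => // ks; congr _%:E.
  rewrite -(subrK a k) [k - a + a]addrC; apply: QJ => //; first by rewrite addrC subrK.
    by rewrite subr_eq0; exact/eqP.
  apply: contra ks => kJ; rewrite inE/=; apply/mapP; exists (k - a); last by rewrite addrC subrK.
  by rewrite mem_filter kJ andbT; apply/asboolP; rewrite addrC subrK.
rewrite -esum_mkcondr (_ : _ `&` _ = [set` s]); last first.
  by apply/seteqP; split=> k /=; [case|move=> ks; split=> //; exact: sI].
rewrite esum_fset; first last.
  move=> k; rewrite inE /= => /sI[Ik ka]; rewrite lee_fin Q0//.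
  by rewrite eq_sym; exact/eqP.
  by apply/finite_seqP; exists s.
rewrite -fsbig_seq// sumEFin; congr _%:E.
by rewrite big_map big_filter big_mkcond.
Qed.

Lemma bounded_rates_intensity (Q : R -> R -> R) (b : R) : intensity_matrix I Q ->
  (forall i j, I i -> I (i + j) -> j != 0 -> j \notin Jl -> Q i (i + j) = 0) ->
  (forall i, I i -> (exit_rate I Q i <= b%:E)%E) -> bounded_rates I Q Jl b.
Proof.
move=> [Q0 Qd] QJ Qb a Ia; have ex := exit_rate_seq Ia Q0 QJ; split.
- move=> j jJ; rewrite /jump_rate; case: asboolP => // Ij; apply: Q0 => //.
  by rewrite eq_sym -subr_eq0 addrC addKr; apply: contraNneq J0 => <-.
- by apply: EFin_inj; rewrite Qd// ex EFinN.
- by rewrite -lee_fin -ex; exact: Qb.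
Qed.

End RatesOfIntensity.

Section AveragedRates.
Context {R : realType}.
Variables (I : set R) (Es : seq R) (q : R -> R -> R -> R) (Jl : seq R) (b : R) (pi : R -> R).
Hypothesis uEs : uniq Es.
Hypothesis bQ : forall y, y \in Es -> bounded_rates I (q y) Jl b.
Hypotheses (pi0 : forall y, y \in Es -> 0 <= pi y) (pi1 : \sum_(y <- Es) pi y = 1).
Local Notation qhat := (averaged [set` Es] q pi).

Lemma averagedE i j : qhat i j = \sum_(y <- Es) pi y * q y i j.
Proof. by rewrite /averaged -fsbig_seq//; apply: eq_bigr => y _; rewrite mulrC. Qed.

Lemma jump_rate_averaged a j : jump_rate I qhat a j = \sum_(y <- Es) pi y * jump_rate I (q y) a j.
Proof.
rewrite /jump_rate; case: asboolP => _; first exact: averagedE.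
by rewrite big1// => y _; rewrite mulr0.
Qed.

Lemma generator_averaged u a : generator I qhat Jl u a = mean_generator I Es q Jl pi u a.
Proof.
rewrite /generator /mean_generator.
under [RHS]eq_bigr do rewrite mulr_sumr.
rewrite [RHS]exchange_big/=; apply: eq_bigr => j _.
by rewrite jump_rate_averaged mulr_suml; apply: eq_bigr => y _; rewrite mulrA.
Qed.

Lemma bounded_rates_averaged : bounded_rates I qhat Jl b.
Proof.
move=> a Ia.
have sumE : \sum_(j <- Jl) jump_rate I qhat a j =
    \sum_(y <- Es) pi y * \sum_(j <- Jl) jump_rate I (q y) a j.
  under [RHS]eq_bigr do rewrite mulr_sumr.
  by rewrite [RHS]exchange_big/=; apply: eq_bigr => j _; rewrite jump_rate_averaged.
split.
- move=> j jJ; rewrite jump_rate_averaged big_seq; apply: sumr_ge0 => y yE.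
  by apply: mulr_ge0; [exact: pi0|have [H _ _] := bQ yE Ia; exact: H].
- rewrite averagedE sumE -sumrN big_seq [RHS]big_seq; apply: eq_bigr => y yE.
  by have [_ -> _] := bQ yE Ia; rewrite mulrN.
- rewrite sumE -[leRHS]mul1r -pi1 mulr_suml big_seq [leRHS]big_seq.
  apply: ler_sum => y yE; apply: ler_wpM2l; first exact: pi0.
  by have [_ _] := bQ yE Ia.
Qed.

End AveragedRates.

(** * Euler scheme for the switching process and for the averaged chain *)

Lemma cadlag_scale {R : realType} (y : R -> R) (e : R) : 0 < e -> cadlag y ->
  cadlag (fun t => y (t / e)).
Proof.
move=> e0 cy t t0; have te0 : 0 <= t / e by rewrite divr_ge0// ltW.
have c : s / e @[s --> t] --> t / e by apply: cvgMr_tmp; exact: cvg_id.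
have [cr cl] := cy _ te0; split.
  apply: cvg_comp cr => A HA; have HA' : nbhs (t / e) (fun u => t / e < u -> A u) by exact: HA.
  have HB : nbhs t (fun s => t / e < s / e -> A (s / e)) by exact: c _ HA'.
  apply: (filterS _ HB) => s H ts.
  by apply: H; rewrite /= ltr_pM2r// invr_gt0.
move=> t'0; have [l Hl] := cl (divr_gt0 t'0 e0); exists l.
apply: cvg_comp Hl => A HA; have HA' : nbhs (t / e) (fun u => u < t / e -> A u) by exact: HA.
have HB : nbhs t (fun s => s / e < t / e -> A (s / e)) by exact: c _ HA'.
apply: (filterS _ HB) => s H ts.
by apply: H; rewrite /= ltr_pM2r// invr_gt0.
Qed.

Section SlowSwitching.
Context {d : measure_display} {T : measurableType d} {R : realType}.
Variables (P : probability T R) (I : set R) (Es : seq R) (q : R -> R -> R -> R) (Jl : seq R).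
Variables (b x0 : R) (pi : R -> R) (Y : R -> {RV P >-> R}) (X : R -> T -> R) (e : R).
Local Notation Ex f := (Rintegral P setT f).
Hypotheses (cI : countable I) (uEs : uniq Es) (b0 : 0 <= b) (uJ : uniq Jl) (J0 : 0 \notin Jl).
Hypothesis bQ : forall y, y \in Es -> bounded_rates I (q y) Jl b.
Hypotheses (Ix0 : I x0) (modY : modulating_process [set` Es] Y) (e0 : 0 < e).
Hypothesis sw : switching_process [set` Es] I q x0 (fun t => Y (t / e)) X.

Let finE : finite_set [set` Es]. Proof. by apply/finite_seqP; exists Es. Qed.

Let cadYe : cadlag_process [set` Es] (fun t => Y (t / e)).
Proof.
move=> w; have [cY YE] := modY.1 w; split; first exact: (cadlag_scale e0 cY).
by move=> t t0; apply: YE; rewrite divr_ge0// ltW.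
Qed.

Let YE (t : R) w : 0 <= t -> Y (t / e) w \in Es.
Proof. by move=> t0; have [_ /(_ t t0)] := cadYe w. Qed.

Lemma slow_in (t : R) w : 0 <= t -> I (X t w).
Proof. by case: sw => g [Z [jY cZ _ XZ]]; exact: (X_in finE cadYe jY cZ XZ). Qed.

Lemma slow_measurable (t : R) : 0 <= t -> measurable_fun setT (X t).
Proof. by case: sw => g [Z [jY cZ _ XZ]]; exact: (measurable_X cI finE cadYe jY cZ XZ). Qed.

Lemma slow_start : {ae P, forall w, X 0 w = x0}.
Proof.
case: sw => g [Z [jY cZ chZ XZ]].
apply: filterS (chain_start_ae cI finE cadYe jY cZ Ix0 chZ 0) => w H.
have [g0 gS _ _ _] := jY w.
have g0y : (g 0%N w < +oo)%E by rewrite g0 ltry.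
rewrite (XZ 0%N) ?g0//=; last by rewrite -g0; exact: gS.
by rewrite subr0 H.
Qed.

Lemma slow_stay n (t a : nat -> R) (h : R) :
  (forall k, t k <= t k.+1) -> 0 <= t 0%N -> (forall k, I (a k)) -> 0 <= h ->
  Ex (fun w => \1_(passes X n t a) w * (X (t n) w != X (t n + h) w)%:R) <=
  b * h * Ex \1_(passes X n t a).
Proof.
case: sw => g [Z [jY cZ chZ XZ]] tm t0 Ia h0.
exact: (atom_stay cI finE cadYe jY cZ XZ Ix0 b0 chZ bQ).
Qed.

Let riemann (tau del y : R) w : 0 <= tau -> 0 <= del ->
  \sum_(k < N.+1) del * mesh N * ((Y ((tau + k%:R * (del * mesh N)) / e) w == y)%:R - pi y)
     @[N --> \oo] --> slowed_occupation (Y ^~ w) e y (pi y) tau del.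
Proof.
move=> tau0 del0; case: sw => g [Z [jY _ _ _]].
have [cY YEs] := modY.1 w; have [gY jY'] := modY.2 w.
exact: (occupation_riemann finE cY YEs jY' e0 (jY w) (cadYe w).1).
Qed.

Lemma measurable_slowed_occupation (tau del y : R) : 0 <= tau -> 0 <= del ->
  measurable_fun setT (fun w => slowed_occupation (Y ^~ w) e y (pi y) tau del).
Proof.
move=> tau0 del0; apply: (@measurable_fun_cvg _ _ _ setT (fun N w =>
    \sum_(k < N.+1) del * mesh N * ((Y ((tau + k%:R * (del * mesh N)) / e) w == y)%:R - pi y))).
  move=> N; apply: measurable_sum => k; apply: measurable_funM => //.
  apply: measurable_funB => //.
  rewrite (_ : (fun w => _) = \1_(Y ((tau + k%:R * (del * mesh N)) / e) @^-1` [set y])).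
    by apply: measurable_indic; rewrite -[X in measurable X]setTI; exact: measurable_funPT.
  apply/funext => w; apply/esym/indic_eq => /=; split; first by move=> ->.
  by move=> /eqP.
by move=> w _; exact: riemann.
Qed.

Definition occupation_error (tau del : R) w : R :=
  4 * b ^+ 2 * del ^+ 2 + 2 * b * \sum_(y <- Es) `|slowed_occupation (Y ^~ w) e y (pi y) tau del|.

Lemma bmeas_slowed_occupation (tau del y : R) : 0 <= tau -> 0 <= del ->
  bmeas (fun w => slowed_occupation (Y ^~ w) e y (pi y) tau del).
Proof.
move=> tau0 del0; split; first exact: measurable_slowed_occupation.
exists (del * (2 + `|pi y|)) => w; case: sw => g [Z [jY _ _ _]].
have [cY YEs] := modY.1 w; have [gY jY'] := modY.2 w.
exact: (slowed_occupation_bound finE cY YEs jY' e0 (jY w)).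
Qed.

Lemma bmeas_occupation_error (tau del : R) : 0 <= tau -> 0 <= del ->
  bmeas (occupation_error tau del).
Proof.
move=> tau0 del0; apply: bmeasD; first exact: bmeas_cst.
by apply: bmeasZ; apply: bmeas_sum => y; apply: bmeas_abs; exact: bmeas_slowed_occupation.
Qed.

Lemma slow_step n (t a : nat -> R) (u : R -> R) (del : R) :
  (forall k, t k <= t k.+1) -> 0 <= t 0%N -> (forall k, I (a k)) ->
  (forall z, `|u z| <= 1) -> 0 <= del ->
  `|Ex (fun w => \1_(passes X n t a) w *
      (u (X (t n + del) w) - (u (a n) + del * mean_generator I Es q Jl pi u (a n))))| <=
  Ex (fun w => \1_(passes X n t a) w * occupation_error (t n) del w).
Proof.
move=> tm t0 Ia u1 del0.
have tn0 : 0 <= t n by elim: (n) => // k IHk; exact: le_trans IHk (tm k).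
have tk0 k : 0 <= t k by elim: k => // k IHk; exact: le_trans IHk (tm k).
case: (sw) => g [Z [jY cZ chZ XZ]].
have K0 : 0 <= 8 * (size Jl)%:R * b ^+ 2 by rewrite mulr_ge0 ?exprn_ge0// mulr_ge0.
have mYe (s : R) : 0 <= s -> measurable_fun setT (Y (s / e) : T -> R) by move=> _; exact: measurable_funPT.
have stE s s' w : \1_(~` steady g s s') w =
    (~~ `[< exists i, (g i w <= s%:E)%E /\ (s'%:E < g i.+1 w)%E >])%:R :> R.
  by apply: indic_eq; split=> [H|/asboolPn//]; exact/asboolPn.
have H := block_step cI uEs b0 K0 bQ YE mYe slow_in slow_measurable
  (measurable_steady Z jY) (atom_stay cI finE cadYe jY cZ XZ Ix0 b0 chZ bQ)
  (fun n t a s del tm t00 Ia ts del0 =>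
    atom_unsteady cI finE cadYe jY cZ XZ Ix0 b0 chZ bQ tm t00 Ia ts del0)
  (fun n t a s del y u tm t00 Ia ts del0 Ey u1 =>
    atom_steady cI finE cadYe jY cZ XZ Ix0 b0 chZ bQ uJ J0 tm t00 Ia ts del0 Ey u1)
  (pi := pi) tm t0 Ia u1 del0
  (fun y yE => @measurable_slowed_occupation (t n) del y tn0 del0)
  (fun y w _ => @riemann (t n) del y w tn0 del0).
apply: le_trans (H _) _.
  move=> w; have := unsteady_cvg0 finE (cadYe w).1 (cadYe w).2 (jY w) tn0 del0.
  by under [in X in _ -> X]eq_fun do under eq_bigr do rewrite stE.
have mA : measurable (passes X n t a) by apply: measurable_passes => k _; exact: slow_measurable.
have bA : bmeas (\1_(passes X n t a) : T -> R) by exact: bmeas_ind.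
have bD y : bmeas (fun w => \1_(passes X n t a) w * `|slowed_occupation (Y ^~ w) e y (pi y) (t n) del|).
  by apply: bmeasM => //; apply: bmeas_abs; exact: bmeas_slowed_occupation.
rewrite -Ex_sum// -!ExZ//; last exact: bmeas_sum.
rewrite -ExD; first last.
- by apply: bmeasZ; exact: bmeas_sum.
- exact: bmeasZ.
rewrite le_eqVlt; apply/orP; left; apply/eqP/eq_Ex => w.
by rewrite -mulr_sumr /occupation_error; ring.
Qed.

Hypotheses (pi0 : forall y, y \in Es -> 0 <= pi y) (pi1 : \sum_(y <- Es) pi y = 1).

Lemma slow_euler (del : R) m (Psi : seq R -> R) : 0 <= del -> del * b <= 1 ->
  (forall s, `|Psi s| <= 1) ->
  `|Ex (fun w => Psi (grid_path X del m w)) - iter m (euler I Es q Jl pi del) Psi [:: x0]| <=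
  \sum_(k < m) Ex (occupation_error (k%:R * del) del).
Proof.
move=> del0 delb Psi1; have kd k : 0 <= k%:R * del by rewrite mulr_ge0.
apply: (euler_iter_start bQ pi0 pi1 cI slow_in slow_measurable del0 delb
  (err := fun k => occupation_error (k%:R * del) del)) => //.
- by move=> k; exact: bmeas_occupation_error.
- move=> k a u Ia u1.
  have kdS : k.+1%:R * del = k%:R * del + del by rewrite -natr1 mulrDl mul1r.
  by rewrite kdS; apply: slow_step => // j; rewrite ler_wpM2r// ler_nat.
- exact: slow_start.
Qed.

End SlowSwitching.

Section AveragedChain.
Context {d : measure_display} {T : measurableType d} {R : realType}.
Variables (P : probability T R) (I : set R) (Es : seq R) (q : R -> R -> R -> R) (Jl : seq R).
Variables (b x0 : R) (pi : R -> R) (Z : R -> T -> R).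
Local Notation Ex f := (Rintegral P setT f).
Hypotheses (cI : countable I) (uEs : uniq Es) (b0 : 0 <= b) (uJ : uniq Jl) (J0 : 0 \notin Jl).
Hypothesis bQ : forall y, y \in Es -> bounded_rates I (q y) Jl b.
Hypotheses (pi0 : forall y, y \in Es -> 0 <= pi y) (pi1 : \sum_(y <- Es) pi y = 1).
Hypotheses (Ix0 : I x0) (mZ : forall t : R, 0 <= t -> measurable_fun setT (Z t)).
Hypothesis chain : markov_chain P I (averaged [set` Es] q pi) x0 Z.

Let ZI (t : R) w : 0 <= t -> I (Z t w). Proof. exact: (chain.1 w).2. Qed.

Let bQhat := bounded_rates_averaged uEs bQ pi0 pi1.

Lemma averaged_start : {ae P, forall w, Z 0 w = x0}.
Proof.
have mN : measurable (Z 0 @^-1` [set~ x0]).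
  by rewrite -[X in measurable X]setTI; apply: mZ => //; apply: measurableC.
have H := chain_starts mZ measurableT Ix0 chain.2.
have : {ae P, forall w, ~ (Z 0 @^-1` [set~ x0]) w}.
  apply: Ex_ind_ae0 => //; rewrite -[leRHS]H le_eqVlt; apply/orP; left; apply/eqP/eq_Ex => w.
  by rewrite (indic_in (Logic.I : setT w)) mul1r.
by apply: filterS => w /= /contrapT.
Qed.

Lemma averaged_euler (del : R) m (Psi : seq R -> R) : 0 <= del -> del * b <= 1 ->
  (forall s, `|Psi s| <= 1) ->
  `|Ex (fun w => Psi (grid_path Z del m w)) - iter m (euler I Es q Jl pi del) Psi [:: x0]| <=
  m%:R * (8 * (size Jl)%:R * b ^+ 2 * del ^+ 2).
Proof.
move=> del0 delb Psi1; set K := _ * del ^+ 2.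
have -> : m%:R * K = \sum_(k < m) Ex (fun=> K).
  by under eq_bigr do rewrite Ex_cst; rewrite sumr_const card_ord mulr_natl.
apply: (euler_iter_start bQ pi0 pi1 cI ZI mZ del0 delb (err := fun _ _ => K)) => //.
- by move=> k; exact: bmeas_cst.
- move=> k a u Ia u1.
  have kdS : k.+1%:R * del = k%:R * del + del by rewrite -natr1 mulrDl mul1r.
  have mp : measurable (passes Z k (fun j => j%:R * del) a).
    by apply: measurable_passes => j _; apply: mZ; rewrite mulr_ge0.
  have bp : bmeas (\1_(passes Z k (fun j => j%:R * del) a) : T -> R) by exact: bmeas_ind.
  have [a0|a0] := eqVneq (a 0%N) x0.
    have t0 : 0%:R * del = 0 by rewrite mul0r.
    have tm j : j%:R * del <= j.+1%:R * del by rewrite ler_wpM2r// ler_nat.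
    have := @chain_step _ _ _ _ _ _ _ _ _ _ _ mZ ZI measurableT cI chain.2 bQhat uJ J0 k
      (fun j => j%:R * del) a del t0 tm a0 Ia del0 u u1.
    rewrite setTI -kdS generator_averaged//.
    move=> /le_trans; apply; rewrite -ExZ// le_eqVlt; apply/orP; left; apply/eqP/eq_Ex => w.
    by rewrite mulrC.
  (* observations that do not start at [x0] have probability zero *)
  have p0 : {ae P, forall w, ~ passes Z k (fun j => j%:R * del) a w}.
    apply: filterS averaged_start => w Z0 /(_ 0%N isT); rewrite mul0r Z0 => /esym/eqP.
    by rewrite (negPf a0).
  have z (f : T -> R) : bmeas f -> Ex (fun w => \1_(passes Z k (fun j => j%:R * del) a) w * f w) = 0.
    move=> bf; rewrite -[RHS](Ex_cst P); apply: ae_eq_Ex.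
    - exact: bmeasM.
    - exact: bmeas_cst.
    - by apply: filterS p0 => w nw; rewrite (indic_notin nw) mul0r.
  rewrite !z ?normr0//; first exact: bmeas_cst.
  apply: bmeasB; last exact: bmeas_cst.
  apply: (@bmeas_countable _ _ _ I _ u 1 cI) => //; last by apply: mZ; rewrite mulr_ge0.
  by move=> w; apply: ZI; rewrite mulr_ge0.
- exact: averaged_start.
Qed.

End AveragedChain.

(** * Convergence of the values on a grid *)

Definition coarsen (M N : nat) {R : realType} (s : seq R) : seq R :=
  [seq nth 0 s (k * M)%N | k <- iota 0 N.+1].

Lemma coarsen_grid_path {d} {T : measurableType d} {R : realType} (W : R -> T -> R) (w : R) M N t :
  coarsen M.+1 N (grid_path W (w * mesh M) (N * M.+1) t) = grid_path W w N t.
Proof.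
apply/eq_in_map => k; rewrite mem_iota /= add0n ltnS => kN.
rewrite (nth_map 0%N) ?size_iota ?ltnS ?leq_mul// nth_iota ?ltnS ?leq_mul// add0n.
by rewrite natrM -mulrA (mulrCA _ w) meshK mulr1.
Qed.

Section FddLimit.
Context {d : measure_display} {T : measurableType d} {R : realType}.
Context {d' : measure_display} {T' : measurableType d'}.
Variables (P : probability T R) (P' : probability T' R).
Variables (I : set R) (Es : seq R) (q : R -> R -> R -> R) (Jl : seq R).
Variables (b x0 : R) (pi : R -> R) (Y : R -> {RV P >-> R}).
Variables (e : nat -> R) (X : nat -> R -> T -> R) (Z : R -> T' -> R).
Hypotheses (cI : countable I) (uEs : uniq Es) (b0 : 0 <= b) (uJ : uniq Jl) (J0 : 0 \notin Jl).
Hypothesis bQ : forall y, y \in Es -> bounded_rates I (q y) Jl b.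
Hypotheses (pi0 : forall y, y \in Es -> 0 <= pi y) (pi1 : \sum_(y <- Es) pi y = 1).
Hypotheses (Ix0 : I x0) (modY : modulating_process [set` Es] Y).
Hypotheses (ergY : ergodic P [set` Es] pi Y).
Hypotheses (e0 : forall n, 0 < e n) (ecvg : e n @[n --> \oo] --> (0 : R)).
Hypothesis sw : forall n, switching_process [set` Es] I q x0 (fun t => Y (t / e n)) (X n).
Hypotheses (mZ : forall t : R, 0 <= t -> measurable_fun setT (Z t)).
Hypothesis chain : markov_chain P' I (averaged [set` Es] q pi) x0 Z.
Local Notation Ex f := (Rintegral P setT f).
Local Notation Ex' f := (Rintegral P' setT f).

Lemma Ex_occupation_cvg0 (tau del y : R) : 0 <= tau -> 0 <= del -> y \in Es ->
  Ex (fun w => `|slowed_occupation (Y ^~ w) (e n) y (pi y) tau del|) @[n --> \oo] --> (0 : R).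
Proof.
move=> tau0 del0 yE; rewrite -[X in _ --> X](Ex_cst P 0).
have finE : finite_set [set` Es] by apply/finite_seqP; exists Es.
apply: (@Ex_cvg _ _ _ P _ _ (del * (2 + `|pi y|))).
- move=> n; apply: bmeas_abs.
  exact: (bmeas_slowed_occupation pi modY (e0 n) (sw n)).
- exact: bmeas_cst.
- move=> n w; rewrite normr_id; have [cY YEs] := modY.1 w; have [gY jY'] := modY.2 w.
  have [g [Z' [jY _ _ _]]] := sw n.
  exact: (slowed_occupation_bound finE cY YEs jY' (e0 n) (jY w)).
- apply: filterS (ergY yE) => w H; 
  rewrite -[X in _ --> X](@normr0 R R).
  by apply: cvg_norm; exact: (slowed_occupation_cvg0 H).
Qed.

Lemma occupation_error_cvg (del : R) m : 0 <= del ->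
  \sum_(k < m) Ex (occupation_error Es b pi Y (e n) (k%:R * del) del) @[n --> \oo] -->
  m%:R * (4 * b ^+ 2 * del ^+ 2).
Proof.
move=> del0; have kd k : 0 <= k%:R * del by rewrite mulr_ge0.
have -> : m%:R * (4 * b ^+ 2 * del ^+ 2) = \sum_(k < m) 4 * b ^+ 2 * del ^+ 2.
  by rewrite sumr_const card_ord mulr_natl.
apply: (cvg_sum_seq (s := index_enum 'I_m)) => k _.
have EE n : Ex (occupation_error Es b pi Y (e n) (k%:R * del) del) = 4 * b ^+ 2 * del ^+ 2 +
    2 * b * \sum_(y <- Es) Ex (fun w => `|slowed_occupation (Y ^~ w) (e n) y (pi y) (k%:R * del) del|).
  have bD y : bmeas (fun w => `|slowed_occupation (Y ^~ w) (e n) y (pi y) (k%:R * del) del|).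
    by apply: bmeas_abs; exact: (bmeas_slowed_occupation pi modY (e0 n) (sw n)).
  have bS := bmeas_sum Es xpredT bD.
  by rewrite /occupation_error (ExD P (bmeas_cst _) (bmeasZ _ bS)) Ex_cst (ExZ P _ bS) Ex_sum.
rewrite (funext EE) -[X in _ --> X]addr0; apply: cvgD; first exact: cvg_cst.
rewrite -[X in _ --> X](mulr0 (2 * b)); apply: cvgMl_tmp.
rewrite [X in _ --> X](_ : _ = \sum_(y <- Es) 0 :> R); last by rewrite big1.
by apply: (cvg_sum_seq (f := fun y n => Ex (fun w => `|slowed_occupation (Y ^~ w) (e n) y (pi y) (k%:R * del) del|))
  (l := fun=> 0)) => y yE; exact: Ex_occupation_cvg0.
Qed.

(** Both laws are compared with the same Euler scheme, on a grid [M] times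
    finer than the one of interest; [M] goes to infinity after [n]. *)
Lemma grid_path_cvg1 (w : R) N (Psi : seq R -> R) : 0 <= w -> (forall s, `|Psi s| <= 1) ->
  Ex (fun t => Psi (grid_path (X n) w N t)) @[n --> \oo] --> Ex' (fun t => Psi (grid_path Z w N t)).
Proof.
move=> w0 Psi1; apply/cvgrPdist_le => eta eta0.
pose K := 8 * (size Jl)%:R * b ^+ 2.
have K0 : 0 <= K by rewrite mulr_ge0 ?exprn_ge0// mulr_ge0.
pose C := N%:R * w ^+ 2 * (4 * b ^+ 2 + K) + w * b + 1.
have wb0 : 0 <= w * b by exact: mulr_ge0.
have A0 : 0 <= N%:R * w ^+ 2 * (4 * b ^+ 2 + K).
  by rewrite mulr_ge0 ?addr_ge0// mulr_ge0 ?exprn_ge0.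
have C1 : 1 <= C by rewrite /C; lra.
have Cpos : 0 < C by exact: lt_le_trans C1.
have r0 : 0 < Num.min 1 (eta / 2) / C.
  by rewrite divr_gt0// lt_min ltr01 divr_gt0.
have [M _ /(_ M (leqnn M))] := mesh_lt r0.
rewrite ltr_pdivlMr// lt_min => /andP[CM1 CM2].
have mp := mesh_gt0 (R := R) M.
set del := w * mesh M; have del0 : 0 <= del by rewrite mulr_ge0// ltW.
have delb : del * b <= 1.
  apply: le_trans (ltW CM1); rewrite /del mulrAC mulrC ler_wpM2l ?ltW//.
  by rewrite /C; lra.
pose m := (N * M.+1)%N; pose Phi s := Psi (coarsen M.+1 N s).
have Phi1 s : `|Phi s| <= 1 by exact: Psi1.
have mdel : m%:R * del ^+ 2 = N%:R * w ^+ 2 * mesh M.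
  rewrite /m /del natrM exprMn expr2 (expr2 (mesh M)).
  rewrite (_ : _ * _ = N%:R * (w * w) * mesh M * (M.+1%:R * mesh M)); last by ring.
  by rewrite meshK mulr1.
have hZ := averaged_euler cI uEs uJ J0 bQ pi0 pi1 Ix0 mZ chain m del0 delb Phi1.
have hX n := slow_euler cI uEs b0 uJ J0 bQ Ix0 modY (e0 n) (sw n) pi0 pi1 m del0 delb Phi1.
have cE := @occupation_error_cvg del m del0.
have eta2 : 0 < eta - C * mesh M by rewrite mulrC; lra.
move/cvgrPdist_lt/(_ _ eta2): cE; apply: filterS => n Hn.
have EX : Ex (fun t => Phi (grid_path (X n) del m t)) = Ex (fun t => Psi (grid_path (X n) w N t)).
  by apply: eq_Ex => t; rewrite /Phi coarsen_grid_path.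
have EZ : Ex' (fun t => Phi (grid_path Z del m t)) = Ex' (fun t => Psi (grid_path Z w N t)).
  by apply: eq_Ex => t; rewrite /Phi coarsen_grid_path.
have := hX n; rewrite -EX -EZ => hXn.
apply: le_trans (ler_distD (iter m (euler I Es q Jl pi del) Phi [:: x0]) _ _) _.
rewrite [X in _ + X]distrC; move: Hn => /ltr_distlCDr Hn.
have rE : m%:R * (4 * b ^+ 2 * del ^+ 2) + m%:R * (K * del ^+ 2) <= C * mesh M.
  rewrite (_ : _ + _ = (m%:R * del ^+ 2) * (4 * b ^+ 2 + K)); last by ring.
  rewrite mdel -mulrA (mulrC (mesh M)) mulrA ler_pM2r// /C -addrA lerDl.
  by rewrite addr_ge0// mulr_ge0.
rewrite -/K in hZ; apply: le_trans (lerD hZ hXn) _.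
by move: (\sum_(k < m) _) Hn => r Hn; lra.
Qed.

End FddLimit.

(** * From values on a grid to functionals of the path *)

Section CellSupremum.
Context {R : realType}.
Variables (f : skorokhod R -> R) (M w : R) (N : nat).
Hypotheses (M0 : 0 <= M) (fM : forall x, `|f x| <= M).

Let candidates (s : seq R) : set R := [set r | r = - M \/ exists z : skorokhod R,
  [/\ one_switch w N z, [seq z (k%:R * w) | k <- iota 0 N.+1] = s & r = f z]].

(** An upper envelope of [f] that depends on the values on the grid only. The
    candidate [- M] is there for the lists [s] that no such path realizes. *)
Definition cell_sup (s : seq R) : R := sup (candidates s).

Let has_supc s : has_sup (candidates s).
Proof.
split; first by exists (- M); left.
by exists M => r [->|[z [_ _ ->]]]; [by rewrite (le_trans _ M0)// oppr_le0|have := fM z; rewrite ler_norml => /andP[]].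
Qed.

Lemma cell_sup_le s r : - M <= r ->
  (forall z : skorokhod R, one_switch w N z -> [seq z (k%:R * w) | k <- iota 0 N.+1] = s -> f z <= r) ->
  cell_sup s <= r.
Proof.
move=> Mr H; apply: ge_sup; first by exists (- M); left.
by move=> _ [->//|[z [z1 z2 ->]]]; exact: H.
Qed.

Lemma cell_sup_bound s : `|cell_sup s| <= M.
Proof.
rewrite ler_norml; apply/andP; split; first by apply: ub_le_sup; [exact: (has_supc s).2|left].
by apply: cell_sup_le => [|z _ _]; [by rewrite (le_trans _ M0)// oppr_le0|have := fM z; rewrite ler_norml => /andP[]].
Qed.

Lemma le_cell_sup (z : skorokhod R) : one_switch w N z ->
  f z <= cell_sup [seq z (k%:R * w) | k <- iota 0 N.+1].
Proof. by move=> Hz; apply: ub_le_sup; [exact: (has_supc _).2|right; exists z]. Qed.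

End CellSupremum.

(** With meshes of width [(r + 1) ^- 2] up to the horizon [r + 1], the expected
    number of meshes with two changes is of order [r ^- 1]. *)
Definition fine_sup {R : realType} (f : skorokhod R -> R) M r : seq R -> R :=
  cell_sup f M (mesh r ^+ 2) (r.+1 ^ 3).

(** By [one_switch_nbhd] the competitors in the supremum are close to [x]; the
    maximum is there because [x] itself need not be one of them. *)
Lemma fine_sup_cvg {R : realType} (f : skorokhod R -> R) M (x : skorokhod R) :
  0 <= M -> (forall x, `|f x| <= M) -> continuous f ->
  Num.max (f x) (fine_sup f M r [seq x (k%:R * mesh r ^+ 2) | k <- iota 0 (r.+1 ^ 3).+1])
    @[r --> \oo] --> f x.
Proof.
move=> M0 fM cf; apply/cvgrPdist_le => e e0.
have [a [n [n0 Hn]]] := continuous_skorokhod_nbhd x cf e0.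
have [w0 [A [w00 HA]]] := one_switch_nbhd x a n0.
near=> r.
have mp := mesh_gt0 (R := R) r.
have m1 : mesh r <= 1 :> R by rewrite invf_le1// ler1n.
have mw : mesh r ^+ 2 <= w0.
  have : mesh r < w0 by near: r; exact: mesh_lt.
  by rewrite expr2 => /ltW; apply: le_trans; rewrite ler_piMl// ltW.
have Ar : A <= (r.+1 ^ 3)%:R * mesh r ^+ 2.
  rewrite natrX exprSr mulrAC -exprMn meshK expr1n mul1r.
  apply: (@le_trans _ _ r%:R); last by rewrite ler_nat.
  by near: r; exact: nbhs_infty_ger.
rewrite distrC ger0_norm ?subr_ge0 ?le_max ?lexx// lerBlDl ge_max lerDl ltW//=.
apply: cell_sup_le => //.
  by have := fM x; rewrite ler_norml => /andP[]; lra.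
move=> z z1 /eq_in_map zx.
have := Hn z (HA _ _ z _ Ar z1 _); rewrite exprn_gt0 ?mesh_gt0// mw => /(_ isT).
move=> H; apply: ltW; apply: ltr_distlDr; apply: H => k kN.
by apply: zx; rewrite mem_iota add0n ltnS.
Unshelve. all: by end_near. Qed.

Section WeakLimit.
Context {d : measure_display} {T : measurableType d} {R : realType}.
Context {d' : measure_display} {T' : measurableType d'}.
Variables (P : probability T R) (P' : probability T' R).
Variables (I : set R) (Es : seq R) (q : R -> R -> R -> R) (Jl : seq R).
Variables (b x0 : R) (pi : R -> R) (Y : R -> {RV P >-> R}).
Variables (e : nat -> R) (X : nat -> {RV P >-> skorokhod R}) (Z : {RV P' >-> skorokhod R}).
Hypotheses (cI : countable I) (uEs : uniq Es) (b0 : 0 <= b) (uJ : uniq Jl) (J0 : 0 \notin Jl).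
Hypothesis bQ : forall y, y \in Es -> bounded_rates I (q y) Jl b.
Hypotheses (pi0 : forall y, y \in Es -> 0 <= pi y) (pi1 : \sum_(y <- Es) pi y = 1).
Hypotheses (Ix0 : I x0) (modY : modulating_process [set` Es] Y).
Hypotheses (ergY : ergodic P [set` Es] pi Y).
Hypotheses (e0 : forall n, 0 < e n) (ecvg : e n @[n --> \oo] --> (0 : R)).
Hypothesis sw : forall n,
  switching_process [set` Es] I q x0 (fun t => Y (t / e n)) (fun t w => X n w t).
Hypothesis chain : markov_chain P' I (averaged [set` Es] q pi) x0 (fun t w => Z w t).
Local Notation Ex f := (Rintegral P setT f).
Local Notation Ex' f := (Rintegral P' setT f).

Let mZ (t : R) : 0 <= t -> measurable_fun setT (fun w => Z w t).
Proof. by move=> t0; exact: (measurableT_comp (measurable_eval t0) (measurable_funPT Z)). Qed.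

Lemma grid_path_cvg (w : R) N (Psi : seq R -> R) M : 0 <= w -> 0 < M -> (forall s, `|Psi s| <= M) ->
  Ex (fun t => Psi (grid_path (fun s t => X n t s) w N t)) @[n --> \oo] -->
  Ex' (fun t => Psi (grid_path (fun s t => Z t s) w N t)).
Proof.
move=> w0 M0 PsiM; pose Phi s : R := M^-1 * Psi s.
have Phi1 s : `|Phi s| <= 1 by rewrite normrM gtr0_norm ?invr_gt0// mulrC ler_pdivrMr// mul1r.
have PhiE s : Psi s = M * Phi s by rewrite mulrA divff ?mul1r// gt_eqF.
have H := grid_path_cvg1 cI uEs b0 uJ J0 bQ pi0 pi1 Ix0 modY ergY e0 ecvg sw mZ chain (N := N) w0 Phi1.
have EZ : Ex' (fun t => Psi (grid_path (fun s t => Z t s) w N t)) =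
    M * Ex' (fun t => Phi (grid_path (fun s t => Z t s) w N t)).
  rewrite -ExZ; first by apply: eq_Ex => t.
  apply: (@bmeas_seq _ _ _ I cI (fun k t => Z t (k%:R * w)) N.+1 Phi 1) => //.
  - by move=> k t; apply: (chain.1 t).2; rewrite mulr_ge0.
  - by move=> k; apply: mZ; rewrite mulr_ge0.
have EX n : Ex (fun t => Psi (grid_path (fun s t => X n t s) w N t)) =
    M * Ex (fun t => Phi (grid_path (fun s t => X n t s) w N t)).
  rewrite -ExZ; first by apply: eq_Ex => t.
  apply: (@bmeas_seq _ _ _ I cI (fun k t => X n t (k%:R * w)) N.+1 Phi 1) => //.
  - by move=> k t; apply: (slow_in modY (e0 n) (sw n)); rewrite mulr_ge0.
  - by move=> k; apply: (slow_measurable cI modY (e0 n) (sw n)); rewrite mulr_ge0.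
by rewrite EZ (funext EX); apply: cvgMl_tmp.
Qed.

Lemma bmeas_functional {dS} {S : measurableType dS} (Q : probability S R) (W : {RV Q >-> skorokhod R})
  (f : skorokhod R -> R) M : continuous f -> (forall x, `|f x| <= M) -> bmeas (fun w => f (W w)).
Proof.
move=> cf fM; split; last by exists M => w.
exact: (measurableT_comp (continuous_measurable_skorokhod cf) (measurable_funPT W)).
Qed.

(** Outside a bad event of small probability, [f] is bounded by its envelope,
    which depends on finitely many values; for these the laws converge by
    [grid_path_cvg], and the envelope comes down to [f] along the averaged chain
    as the grid is refined. *)
Lemma Ex_upper (f : skorokhod R -> R) M eta : 0 < M -> (forall x, `|f x| <= M) -> continuous f ->
  0 < eta -> \forall n \near \oo, Ex (fun w => f (X n w)) <= Ex' (fun w => f (Z w)) + eta.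
Proof.
move=> M0 fM cf eta0; have M0' := ltW M0.
have fsM r s : `|fine_sup f M r s| <= M by exact: cell_sup_bound.
have bfZ := bmeas_functional Z cf fM.
have w0 r : 0 <= mesh r ^+ 2 :> R by rewrite exprn_ge0// ltW// mesh_gt0.
pose gZ r w := grid_path (fun s t => Z t s) (mesh r ^+ 2) (r.+1 ^ 3) w.
have bsZ r : bmeas (fun w => fine_sup f M r (gZ r w)).
  apply: (@bmeas_seq _ _ _ I cI (fun k t => Z t (k%:R * mesh r ^+ 2)) (r.+1 ^ 3).+1 _ M) => //.
  - by move=> k t; apply: (chain.1 t).2; rewrite mulr_ge0.
  - by move=> k; apply: mZ; rewrite mulr_ge0.
pose h r w := Num.max (f (Z w)) (fine_sup f M r (gZ r w)).
have hM r w : `|h r w| <= M by rewrite /h; case: (leP (f (Z w))).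
have bh r : bmeas (h r).
  by split; [apply: measurable_maxr; [exact: bfZ.1|exact: (bsZ r).1]|exists M => w].
have ch : Ex' (h r) @[r --> \oo] --> Ex' (fun w => f (Z w)).
  by apply: (@Ex_cvg _ _ _ P' h _ M) => //; apply: aeW => w; exact: fine_sup_cvg.
have eta3 : 0 < eta / 3 by rewrite divr_gt0.
have mr : 2 * M * b ^+ 2 * mesh r @[r --> \oo] --> (0 : R).
  by rewrite -[X in _ --> X](mulr0 (2 * M * b ^+ 2)); apply: cvgMl_tmp; exact: mesh_cvg0.
have [r [hr br]] : exists r, Ex' (h r) < Ex' (fun w => f (Z w)) + eta / 3 /\
    2 * M * b ^+ 2 * mesh r < eta / 3.
  have H1 : \forall r \near \oo, Ex' (h r) < Ex' (fun w => f (Z w)) + eta / 3.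
    by move/cvgrPdist_lt/(_ _ eta3): ch; apply: filterS => r; rewrite distrC => /ltr_distlDr.
  have H2 : \forall r \near \oo, 2 * M * b ^+ 2 * mesh r < eta / 3.
    move/cvgrPdist_lt/(_ _ eta3): mr; apply: filterS => r.
    by rewrite sub0r normrN => /(le_lt_trans (ler_norm _)).
  by have [r [? ?]] := filter_ex (filterI H1 H2); exists r.
have cX := grid_path_cvg (N := r.+1 ^ 3) (w0 r) M0 (fsM r).
move/cvgrPdist_lt/(_ _ eta3): cX; apply: filterS => n; rewrite distrC => /ltr_distlDr Hn.
pose Xn s w := X n w s; pose gX w := grid_path Xn (mesh r ^+ 2) (r.+1 ^ 3) w.
pose B := bad_grid Xn (mesh r ^+ 2) (r.+1 ^ 3).
have XI (t : R) w : 0 <= t -> I (Xn t w) by exact: (slow_in modY (e0 n) (sw n)).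
have mX (t : R) : 0 <= t -> measurable_fun setT (Xn t) by exact: (slow_measurable cI modY (e0 n) (sw n)).
have mB : measurable B by exact: measurable_bad_grid.
have bB : bmeas (\1_B : T -> R) by exact: bmeas_ind.
have bsX : bmeas (fun w => fine_sup f M r (gX w)).
  apply: (@bmeas_seq _ _ _ I cI (fun k t => X n t (k%:R * mesh r ^+ 2)) (r.+1 ^ 3).+1 _ M) => //.
  - by move=> k t; apply: XI; rewrite mulr_ge0.
  - by move=> k; apply: mX; rewrite mulr_ge0.
have PB : Ex \1_B <= b ^+ 2 * mesh r.
  apply: le_trans (bad_grid_le cI b0 XI mX (slow_stay cI b0 bQ Ix0 modY (e0 n) (sw n)) _ (w0 r)) _.
  rewrite natrX le_eqVlt; apply/orP; left; apply/eqP.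
  rewrite (_ : _ * _ = b ^+ 2 * ((r.+1%:R * mesh r) ^+ 3) * mesh r); last by ring.
  by rewrite meshK expr1n mulr1.
have step1 : Ex (fun w => f (X n w)) <= Ex (fun w => fine_sup f M r (gX w)) + 2 * M * Ex \1_B.
  rewrite -ExZ// -ExD//; last exact: bmeasZ.
  apply: le_Ex; first exact: (bmeas_functional (X n) cf fM).
    by apply: bmeasD => //; exact: bmeasZ.
  move=> w; have [Bw|nB] := pselect (B w).
    rewrite (indic_in Bw); have := fM (X n w); have := fsM r (gX w).
    by rewrite !ler_norml => /andP[? ?] /andP[? ?]; lra.
  rewrite (indic_notin nB) mulr0 addr0; apply: le_cell_sup => //.
  apply: (bad_grid_switch (X := Xn)) => //; first exact: path_cadlag.
  by rewrite exprn_gt0// mesh_gt0.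
have step2 : Ex' (fun w => fine_sup f M r (gZ r w)) <= Ex' (h r).
  by apply: le_Ex => // w; rewrite le_max lexx orbT.
have step3 : 2 * M * Ex \1_B <= 2 * M * b ^+ 2 * mesh r.
  by rewrite -(mulrA (2 * M)) ler_wpM2l// mulr_ge0.
apply: le_trans step1 _; rewrite -/gX in Hn; move: Hn; rewrite -/(gZ r).
lra.
Qed.

Lemma Ex_cvg_functional (f : skorokhod R -> R) M : (forall x, `|f x| <= M) -> continuous f ->
  Ex (fun w => f (X n w)) @[n --> \oo] --> Ex' (fun w => f (Z w)).
Proof.
move=> fM cf; have M1 : 0 < `|M| + 1 by rewrite ltr_wpDl.
have {}fM x : `|f x| <= `|M| + 1.
  by apply: le_trans (fM x) _; apply: le_trans (ler_norm M) _; rewrite lerDl.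
apply/cvgrPdist_le => eta eta0.
have H1 := Ex_upper M1 fM cf eta0.
have cfN : continuous (fun x => - f x) by move=> x; have H : f y @[y --> x] --> f x := cf x; exact: (cvgN H).
have fMN x : `|- f x| <= `|M| + 1 by rewrite normrN.
have H2 := Ex_upper M1 fMN cfN eta0.
apply: filterS2 H1 H2 => n.
rewrite !ExN; [|exact: (bmeas_functional _ cf fM)..] => h1 h2.
by rewrite ler_distlC; apply/andP; split; lra.
Qed.

End WeakLimit.

Lemma Rintegral_distribution {d} {T : measurableType d} {R : realType} (P : probability T R)
  (X : {RV P >-> skorokhod R}) (f : skorokhod R -> R) M : continuous f -> (forall x, `|f x| <= M) ->
  \int[distribution P X]_x f x = \int[P]_w f (X w).
Proof.
move=> cf fM; rewrite /Rintegral integral_distribution//.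
  by apply/measurable_EFinP; exact: continuous_measurable_skorokhod.
exact: (bmeas_integrable P (bmeas_functional X cf fM)).
Qed.

Lemma finite_set_uniq {R : realType} (A : set R) : finite_set A ->
  exists2 s, uniq s & A = [set` s].
Proof.
move=> /finite_seqP[s ->]; exists (undup s); first exact: undup_uniq.
by apply/seteqP; split=> x /=; rewrite mem_undup.
Qed.

Theorem theorem3p4 (R : realType)
  (d : measure_display) (T : measurableType d) (P : probability T R)
  (d' : measure_display) (T' : measurableType d') (P' : probability T' R)
  (E I J : set R) (x0 : R) (q : R -> R -> R -> R) (pi : R -> R)
  (Y : R -> {RV P >-> R})
  (X : R -> {RV P >-> skorokhod R}) (Xhat : {RV P' >-> skorokhod R})
  (finE : finite_set E) (countI : countable I) (Ix0 : I x0)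
  (qE : forall y, E y -> intensity_matrix I (q y))
  (finJ : finite_set J) (J0 : ~ J 0)
  (qJ : forall i j y, I i -> I (i + j) -> E y -> j != 0 -> ~ J j ->
    q y i (i + j) = 0)
  (q_bounded :
    (ereal_sup [set exit_rate I (q y) i | i in I & y in E] < +oo)%E)
  (modY : modulating_process E Y)
  (pi_dist : prob_dist E pi) (ergY : ergodic P E pi Y)
  (switchX : forall e : R, 0 < e ->
    switching_process E I q x0 (fun t => Y (t / e)) (fun t w => X e w t))
  (chainXhat : markov_chain P' I (averaged E q pi) x0 (fun t w => Xhat w t)) :
  weak_cvg 0^'+ (fun e => distribution P (X e)) (distribution P' Xhat).
Proof.
have [Es uEs EE] := finite_set_uniq finE; have [Jl uJ JE] := finite_set_uniq finJ; subst E J.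
have {}J0 : 0 \notin Jl by apply/negP.
have [b b0 qb] : exists2 b : R, 0 <= b &
    forall y i, y \in Es -> I i -> (exit_rate I (q y) i <= b%:E)%E.
  set S := [set _ | _ in _ & _ in _] in q_bounded.
  have [c Sc] : exists c : R, (ereal_sup S <= c%:E)%E.
    case: (ereal_sup S) q_bounded => [c _| // |_]; first by exists c.
    by exists 0; rewrite leNye.
  exists (Num.max c 0); first by rewrite le_max lexx orbT.
  move=> y i yE Ii; apply: (@le_trans _ _ c%:E); last by rewrite lee_fin le_max lexx.
  by apply: le_trans Sc; apply: ereal_sup_ubound; exists i => //; exists y.
have bQ y : y \in Es -> bounded_rates I (q y) Jl b.
  move=> yE; apply: bounded_rates_intensity => //; first exact: qE.
    by move=> i j Ii Iij j0 jJ; apply: qJ => //; exact/negP.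
  by move=> i Ii; exact: qb.
have [pi0 pi1] := pi_dist; rewrite -fsbig_seq// in pi1.
move=> f cf [M fM].
apply/cvg_at_rightP => e [e0 ecvg].
rewrite (Rintegral_distribution Xhat cf fM).
under eq_fun do rewrite (Rintegral_distribution _ cf fM).
exact: (Ex_cvg_functional countI uEs b0 uJ J0 bQ pi0 pi1 Ix0 modY ergY e0 ecvg
  (fun n => switchX (e n) (e0 n)) chainXhat fM cf).
Qed.
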